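(* Let $G$ be a Lie group, let $V$ be a complete locally convex topological vector space, and let $\pi\colon G\to\mathrm{Aut}(V)$ be a group representation by continuous linear operators. Then $\pi$ is (topologically) smooth if and only if it can be extended to a bounded algebra homomorphism $\int\pi\colon\mathcal{E}'(G)\to\mathrm{End}(V)$, where $\mathrm{End}(V)$ carries the equicontinuous bornology and ''extended'' means $\int\pi(\delta_g)=\pi_g$ for all $g\in G$.
   Context: Here $\mathrm{End}(V)$ is the algebra of continuous linear operators on the complex topological vector space $V$, equipped with the bornology of equicontinuous subsets, and $\mathrm{Aut}(V)$ is its group of invertible elements. A representation is a group homomorphism $\pi\colon G\to\mathrm{Aut}(V)$ (no continuity in $g$ assumed). $\mathcal{E}(G,V)$ is the usual topological vector space of smooth functions $G\to V$, with the topology of locally uniform convergence of all derivatives. $\pi$ is called smooth if its adjoint $\pi_\ast\colon V\to\mathcal{E}(G,V)$, $\pi_\ast(v)(g)=\pi_g(v)$, is a (well-defined) continuous linear map. $\mathcal{E}'(G)$ is the space of compactly supported distributions on $G$, the dual of the space $\mathcal{E}(G)$ of smooth functions on $G$ (a subset of $\mathcal{E}(G)$ is bounded if all derivatives are uniformly bounded on compact sets), equipped with the equibounded bornology (a set of functionals is bounded if it is uniformly bounded on each bounded subset of $\mathcal{E}(G)$) and with convolution as multiplication; $\delta_g$ is the point mass at $g$. *)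

(* Defs.v *)
From HB Require Import structures.
From mathcomp Require Import all_boot all_order all_algebra.
From mathcomp Require Import all_classical all_reals all_analysis.
From mathcomp Require Import complex.

Set Implicit Arguments.
Unset Strict Implicit.
Unset Printing Implicit Defensive.

Import Order.TTheory GRing.Theory Num.Theory.
Import numFieldNormedType.Exports.

Local Open Scope classical_set_scope.
Local Open Scope complex_scope.
Local Open Scope ring_scope.

(* In tvsType the uniformity is only required to induce the topology.  The
   second axiom forces it to be the translation-invariant uniformity of the
   topological vector space, the one meant by "complete" and "equicontinuous". *)
HB.mixin Record Tvs_isLocallyConvex (K : numFieldType) V & Tvs K V := {
  lcs_hausdorff : hausdorff_space V ;
  lcs_sub_unif_continuous : unif_continuous (fun x : V * V => x.1 - x.2)
}.

#[short(type="lcsType")]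
HB.structure Definition LocallyConvex (K : numFieldType) :=
  {V of Tvs K V & Tvs_isLocallyConvex K V}.

Definition complete_space (V : uniformType) :=
  forall F : set_system V, ProperFilter F -> cauchy F -> exists v : V, F --> v.

Section regular_lcs.
Variable K : numFieldType.

Let regular_sub_unif_continuous :
  unif_continuous (fun x : K^o * K^o => x.1 - x.2).
Proof.
apply/unif_continuousP => e e0; exists (e / 2); first by rewrite divr_gt0.
move=> [[a1 a2] [b1 b2]] [] /=; rewrite -!ball_normE /= => h1 h2.
rewrite (_ : a1 - a2 - (b1 - b2) = (a1 - b1) - (a2 - b2)); last first.
  by rewrite opprD addrACA -opprD.
by rewrite (splitr e) (le_lt_trans (ler_normB _ _))// ltrD.
Qed.

HB.instance Definition _ := Tvs_isLocallyConvex.Build K K^o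
  (@norm_hausdorff K K^o) regular_sub_unif_continuous.

End regular_lcs.

Section smooth_on_Rn.
Context (R : realType) (n : nat) (V : lcsType R[i]).
Implicit Types (i : 'I_n) (f : 'rV[R]_n -> V) (U : set 'rV[R]_n).

Definition diff_quot i f (x : 'rV[R]_n) (h : R) : V :=
  (h^-1)%:C *: (f (x + h *: delta_mx ord0 i) - f x).

Definition partial i f (x : 'rV[R]_n) : V :=
  xget 0 [set l | diff_quot i f x h @[h --> 0^'] --> l].

Definition partials (s : seq 'I_n) f : 'rV[R]_n -> V := foldr partial f s.

(* Meant for U open: all iterated partial derivatives exist and are continuous
   on U. *)
Definition smooth_on U f := forall s,
  {in U, continuous (partials s f)} /\
  forall i, {in U, forall x, exists l : V,
    diff_quot i (partials s f) x h @[h --> 0^'] --> l}.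

End smooth_on_Rn.

Section smooth_on_theory.
Context (R : realType) (n : nat) (V : lcsType R[i]).
Implicit Types (i : 'I_n) (f g : 'rV[R]_n -> V) (U : set 'rV[R]_n).

Lemma cvg_lin (K : numFieldType) (W : topologicalLmodType K) (T : Type)
    (F : set_system T) {FF : Filter F} (f g : T -> W) (a : K) (l m : W) :
  f @ F --> l -> g @ F --> m -> a *: f x + g x @[x --> F] --> a *: l + m.
Proof.
move=> fl gm; have afl : a *: f x @[x --> F] --> a *: l.
  exact: (cvg_comp2 (@cvg_cst _ (a : K^o) _ F _) fl (@scale_continuous K W (a, l))).
exact: (cvg_comp2 afl gm (@add_continuous W (a *: l, m))).
Qed.

Lemma partialE i f x (l : V) :
  diff_quot i f x h @[h --> 0^'] --> l -> partial i f x = l.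
Proof.
move=> fl; rewrite /partial; case: xgetP => [m _ fm|/(_ l)//].
exact: (@cvg_unique V (@lcs_hausdorff _ V) _ _ _ _ fm fl).
Qed.

Lemma partial_cvg i f x : (exists l : V, diff_quot i f x h @[h --> 0^'] --> l) ->
  diff_quot i f x h @[h --> 0^'] --> partial i f x.
Proof. by move=> [l fl]; rewrite (partialE fl). Qed.

Lemma near_line U i x : open U -> U x ->
  \forall h \near (0 : R)^', U (x + h *: delta_mx ord0 i).
Proof.
move=> Uo Ux; apply: cvg_within.
have : x + h *: delta_mx ord0 i @[h --> (0 : R)] --> x + 0 *: delta_mx ord0 i.
  by apply: cvgD; [exact: cvg_cst|apply: cvgZr_tmp; exact: cvg_id].
by rewrite scale0r addr0; apply; exact: open_nbhs_nbhs.
Qed.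

Lemma diff_quot_lin U i (a : R[i]) f g k x (l m : V) : open U -> U x ->
  {in U, forall y, k y = a *: f y + g y} ->
  diff_quot i f x h @[h --> 0^'] --> l ->
  diff_quot i g x h @[h --> 0^'] --> m ->
  diff_quot i k x h @[h --> 0^'] --> a *: l + m.
Proof.
move=> Uo Ux kE fl gm.
have : (fun h => a *: diff_quot i f x h + diff_quot i g x h) h @[h --> 0^'] -->
    a *: l + m.
  exact: cvg_lin.
apply: cvg_trans; apply: near_eq_cvg; near=> h.
rewrite /diff_quot !kE ?inE//; last by near: h; exact: near_line.
by rewrite scalerA mulrC -scalerA -scalerDr scalerBr opprD addrACA.
Unshelve. all: by end_near. Qed.

Lemma partials_lin U (a : R[i]) f g s x : open U -> smooth_on U f ->
  smooth_on U g -> U x ->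
  partials s (a *: f + g) x = a *: partials s f x + partials s g x.
Proof.
move=> Uo sf sg; elim: s x => [//|i s IH] x Ux /=.
apply: partialE; apply: (diff_quot_lin Uo Ux (f := partials s f)
  (g := partials s g)); first by move=> y /[1!inE] /IH.
- by apply: partial_cvg; apply: (sf s).2; rewrite inE.
- by apply: partial_cvg; apply: (sg s).2; rewrite inE.
Qed.

Lemma smooth_on_lin U (a : R[i]) f g : open U -> smooth_on U f ->
  smooth_on U g -> smooth_on U (a *: f + g).
Proof.
move=> Uo sf sg s.
have E : {in U, forall y, partials s (a *: f + g) y =
    a *: partials s f y + partials s g y}.
  by move=> y /[1!inE]; exact: partials_lin.
split=> [x Ux|i x Ux].
  have Ux' : U x by rewrite -inE.
  rewrite /continuous_at E//.
  have : a *: partials s f y + partials s g y @[y --> x] -->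
      a *: partials s f x + partials s g x.
    exact: (@cvg_lin _ V _ (nbhs x) _ _ _ a _ _ ((sf s).1 x Ux) ((sg s).1 x Ux)).
  apply: cvg_trans; apply: (@near_eq_cvg _ _ (nbhs x) (nbhs_filter x)); near=> y.
  by rewrite E// inE; near: y; exact: open_nbhs_nbhs.
have [l fl] := (sf s).2 i x Ux; have [m gm] := (sg s).2 i x Ux.
by exists (a *: l + m); apply: diff_quot_lin Uo _ E fl gm; rewrite -inE.
Unshelve. all: by end_near. Qed.

Lemma smooth_on0 U : smooth_on U (0 : 'rV[R]_n -> V).
Proof.
have c i x : diff_quot i (0 : 'rV[R]_n -> V) x h @[h --> 0^'] --> (0 : V).
  rewrite /diff_quot; under eq_fun do rewrite subrr scaler0.
  exact: cvg_cst.
have E s : partials s (0 : 'rV[R]_n -> V) = 0.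
  elim: s => //= i s ->; apply/funext => x; by rewrite (partialE (c i x)).
move=> s; rewrite E; split=> [x _|i x _]; last by exists 0.
exact: (@cvg_cst V 0 _ (nbhs x) (nbhs_filter x)).
Qed.

End smooth_on_theory.

(* A real function is smooth if and only if it is smooth as a complex one. *)
Definition smooth_map_on (R : realType) (m n : nat) (U : set 'rV[R]_m)
    (f : 'rV[R]_m -> 'rV[R]_n) :=
  forall j, smooth_on U (fun x => (f x ord0 j)%:C : R[i]^o).

Record chart (R : realType) (n : nat) (G : topologicalType) := Chart {
  chart_dom : set G ;
  chart_img : set 'rV[R]_n ;
  chart_fun :> G -> 'rV[R]_n ;
  chart_inv : 'rV[R]_n -> G ;
  chart_dom_open : open chart_dom ;
  chart_img_open : open chart_img ;
  chart_fun_img : {homo chart_fun : x / chart_dom x >-> chart_img x} ;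
  chart_inv_dom : {homo chart_inv : x / chart_img x >-> chart_dom x} ;
  chart_funK : {in chart_dom, cancel chart_fun chart_inv} ;
  chart_invK : {in chart_img, cancel chart_inv chart_fun} ;
  chart_fun_continuous : {in chart_dom, continuous chart_fun} ;
  chart_inv_continuous : {in chart_img, continuous chart_inv}
}.

HB.instance Definition _ R n G := gen_eqMixin (chart R n G).
HB.instance Definition _ R n G := gen_choiceMixin (chart R n G).

(* The atlas need not be maximal.  Second countability is not required: a Lie
   group may have uncountably many connected components. *)
HB.mixin Record isLieGroup (R : realType) (n : nat) G
    & Topological G & Group G := {
  lie_hausdorff : hausdorff_space G ;
  atlas : set (chart R n G) ;
  atlas_cover : forall x, exists2 c, atlas c & chart_dom c x ;
  atlas_compatible : forall c d, atlas c -> atlas d ->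
    smooth_map_on (chart_img c `&` chart_inv c @^-1` chart_dom d)
      (d \o chart_inv c) ;
  lie_mul_continuous : continuous (fun xy : G * G => (xy.1 * xy.2)%g) ;
  lie_mul_smooth : forall c d e, atlas c -> atlas d -> atlas e ->
    let mul (z : 'rV[R]_(n + n)) :=
      (chart_inv c (lsubmx z) * chart_inv d (rsubmx z))%g in
    smooth_map_on
      [set z | [/\ chart_img c (lsubmx z), chart_img d (rsubmx z)
                 & chart_dom e (mul z)]]
      (e \o mul) ;
  lie_inv_continuous : continuous (fun x : G => (x^-1)%g) ;
  lie_inv_smooth : forall c d, atlas c -> atlas d ->
    let inv z := ((chart_inv c z)^-1)%g in
    smooth_map_on (chart_img c `&` inv @^-1` chart_dom d) (d \o inv)
}.

#[short(type="lieGroupType")]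
HB.structure Definition LieGroup (R : realType) (n : nat) :=
  {G of Topological G & Group G & isLieGroup R n G}.

Arguments atlas {R n} s : rename.

Section smooth_space.
Context (R : realType) (n : nat) (G : lieGroupType R n) (V : lcsType R[i]).

Definition smooth (f : G -> V) :=
  forall c, atlas G c -> smooth_on (chart_img c) (f \o chart_inv c).

Definition smooth_pred : {pred G -> V} := fun f => `[< smooth f >].

Lemma smooth_submod_closed : submod_closed smooth_pred.
Proof.
split=> [|a f g /asboolP sf /asboolP sg]; apply/asboolP => c cG.
  exact: smooth_on0.
exact: (smooth_on_lin a (@chart_img_open _ _ _ c) (sf c cG) (sg c cG)).
Qed.

HB.instance Definition _ :=
  GRing.isSubmodClosed.Build _ _ smooth_pred smooth_submod_closed.

Record smooth_space := SmoothSpace {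
  smooth_fun :> G -> V ;
  smooth_funP : smooth_fun \in smooth_pred
}.

HB.instance Definition _ := [isSub for smooth_fun].
HB.instance Definition _ := [Choice of smooth_space by <:].
HB.instance Definition _ := [SubChoice_isSubLmodule of smooth_space by <:].

(* The topology of smooth_space is the coarsest one such that, for every chart
   c and every iterated partial derivative, f |-> partials s (f \o c^-1) is
   continuous for uniform convergence on the compact subsets of the image
   of c. *)
Definition compacts_in (U : set 'rV[R]_n) :=
  [set K : set 'rV[R]_n | compact K /\ K `<=` U].

Definition derivatives_topology :=
  @prod_topology (set_type (atlas G) * seq 'I_n) (fun cs =>
    {family compacts_in (chart_img (val cs.1)), 'rV[R]_n -> V}).

Definition derivatives (f : smooth_space) : derivatives_topology :=
  fun cs => partials cs.2 (f \o chart_inv (val cs.1)).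

HB.instance Definition _ :=
  Topological.copy smooth_space (initial_topology derivatives).

End smooth_space.

Section continuous_linear_maps.
Context (K : numFieldType).

Section def.
Context (V W : preTopologicalLmodType K).

Definition clin_pred : {pred V -> W} :=
  fun f => `[< linear f /\ continuous f >].

Record clin := Clin {
  clin_fun :> V -> W ;
  clin_funP : clin_fun \in clin_pred
}.

HB.instance Definition _ := [isSub for clin_fun].
HB.instance Definition _ := [Choice of clin by <:].

End def.

Section lmod.
Context (V : preTopologicalLmodType K) (W : topologicalLmodType K).

Lemma clin_submod_closed : submod_closed (@clin_pred V W).
Proof.
split=> [|a f g /asboolP[lf cf] /asboolP[lg cg]]; apply/asboolP; split.
- by move=> b u v /=; rewrite scaler0 addr0.
- by move=> x; exact: cvg_cst.
- move=> b u v; rewrite !fctE lf lg !scalerDr !scalerA (mulrC a b).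
  by rewrite addrACA.
- move=> x.
  exact: (@cvg_lin _ W _ (nbhs x) _ _ _ a _ _ (cf x) (cg x)).
Qed.

HB.instance Definition _ :=
  GRing.isSubmodClosed.Build _ _ (@clin_pred V W) clin_submod_closed.

HB.instance Definition _ := [SubChoice_isSubLmodule of clin V W by <:].

End lmod.

End continuous_linear_maps.

Section distributions.
Context (R : realType) (n : nat) (G : lieGroupType R n).

Lemma family_eval (T : choiceType) (W : uniformType) (fam : set_system T)
    (F : set_system (T -> W)) (FF : Filter F) (f : T -> W) (x : T) :
  fam [set x] -> {family fam, F --> f} -> h x @[h --> F] --> f x.
Proof. by move=> famx /fam_cvgP/(_ _ famx); rewrite uniform_set1. Qed.

Lemma eval_linear (V : lcsType R[i]) (g : G) :
  linear (fun f : smooth_space G V => f g).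
Proof. by []. Qed.

Lemma eval_continuous (V : lcsType R[i]) (g : G) :
  continuous (fun f : smooth_space G V => f g).
Proof.
move=> f; have [c cG cg] := atlas_cover g.
pose i : set_type (atlas G) * seq 'I_n := (exist _ c (mem_set cG), [::]).
pose D (j : set_type (atlas G) * seq 'I_n) : topologicalType :=
  {family compacts_in (chart_img (val j.1)), 'rV[R]_n -> V}.
have df : {family compacts_in (chart_img c), derivatives k i @[k --> f]
    --> derivatives f i}.
  have h1 := @initial_continuous _ _ (@derivatives R n G V) f.
  have h2 := @proj_continuous _ D i (derivatives f).
  exact: (@cvg_comp _ _ _ _ _ _ _ _ h1 h2).
have -> : (fun k : smooth_space G V => k g) = (fun k => derivatives k i (c g)).
  by apply/funext => k; rewrite /derivatives /= chart_funK ?inE.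
apply: (@family_eval _ V _ _ _ _ (c g) _ df).
  exact: (@fmap_filter _ _ _ (nbhs f) (nbhs_filter f)).
by split; [exact: compact_set1|move=> _ ->; exact: chart_fun_img].
Qed.

(* A distribution has compact support if and only if it extends to a continuous
   functional on all smooth functions. *)
Definition cs_distribution :=
  clin (smooth_space G R[i]^o) (R[i]^o : tvsType R[i]).

HB.instance Definition _ := GRing.Lmodule.on cs_distribution.

Definition delta_dist (g : G) : cs_distribution :=
  Clin (asboolT (conj (@eval_linear R[i]^o g) (@eval_continuous R[i]^o g))).

(* <D1 * D2, f> = <D1, x |-> <D2, y |-> f (x y)>>.  insubd 0 u is u packaged as
   a smooth function (resp. a distribution), or 0 if u is not one; translates
   of smooth functions, x |-> <D2, y |-> f (x y)> and the resulting functional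
   always are. *)
Definition convolution (D1 D2 : cs_distribution) : cs_distribution :=
  let smooth_of (u : G -> R[i]^o) : smooth_space G R[i]^o := insubd 0 u in
  insubd (0 : cs_distribution) (fun f : smooth_space G R[i]^o =>
    D1 (smooth_of (fun x => D2 (smooth_of (fun y => f (x * y)%g))))).

Definition bounded_smooth (B : set (smooth_space G R[i]^o)) :=
  forall c (s : seq 'I_n) (K : set 'rV[R]_n),
    atlas G c -> compact K -> K `<=` chart_img c ->
  exists M : R, forall f x, B f -> K x ->
    `|partials s (f \o chart_inv c) x| <= M%:C.

Definition bounded_dist (S : set cs_distribution) :=
  forall B, bounded_smooth B ->
  exists M : R, forall D f, S D -> B f -> `|D f| <= M%:C.

End distributions.

Section representations.
Context (R : realType) (n : nat) (G : lieGroupType R n) (V : lcsType R[i]).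

Definition invertible (T : clin V V) :=
  exists S : clin V V, cancel T S /\ cancel S T.

Record representation := Representation {
  rep_fun :> G -> clin V V ;
  rep_invertible : forall g, invertible (rep_fun g) ;
  rep_mul : forall g h, rep_fun (g * h)%g =1 rep_fun g \o rep_fun h
}.

Definition smooth_representation (pi : representation) :=
  exists pi_ : clin V (smooth_space G V), forall v g, pi_ v g = pi g v.

Definition algebra_hom (Phi : cs_distribution G -> clin V V) :=
  linear Phi /\
  forall D1 D2, Phi (convolution D1 D2) =1 Phi D1 \o Phi D2.

(* equicontinuous of the library, which asks for a pointed uniform space *)
Definition equicontinuous_set (S : set (clin V V)) :=
  forall (x : V) (E : set (V * V)), entourage E ->
    \forall y \near x, forall T, S T -> E (T x, T y).

Definition bounded_hom (Phi : cs_distribution G -> clin V V) :=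
  forall S, bounded_dist S -> equicontinuous_set (Phi @` S).

End representations.

(* Main.v *)
From HB Require Import structures.
Require Import Defs.
From mathcomp Require Import all_boot all_order all_algebra.
From mathcomp Require Import all_classical all_reals all_analysis.
From mathcomp Require Import complex.
From mathcomp Require Import lra ring.

(** Let pi_* v be the orbit map g |-> pi_g v.  Both directions rest on describing
    E(G) by jets: a jet is a derivative in a chart at a point, and the seminorms of
    E(G) are the suprema of jets over compact sets of jets.

    Suppose that pi is smooth.  For a distribution D the operator int pi (D) sends
    v to D applied to the vector-valued function pi_* v, that is, to the vector w
    with l w = D (l o pi_* v) for all continuous functionals l (weak_pairing).  To
    find w, extend D by the Hahn-Banach theorem from jets of smooth functions to
    all bounded functions on a compact set of jets; this is a finitely additive
    measure, and the jets of pi_* v, which are totally bounded, can be integrated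
    against it because V is complete.  Functionals separate the points of V, so
    linearity and the values at point masses are read off from the characterization
    of w.  For products one needs that the convolution is what it should be, namely
    that x |-> D2 (y |-> f (x y)) is smooth and depends continuously on f
    (convolutionE): derivatives in x pass under the extension of D2, and the chain
    rule bounds the derivatives of f (x y) by the jets of f.  Finally int pi is
    bounded because a bounded set of distributions is equicontinuous
    (bounded_dist_equicontinuous), a uniform boundedness principle in which the
    group structure makes up for the lack of countability of G.

    Conversely, let Phi be a bounded homomorphism with Phi (delta_g) = pi_g.  By
    Taylor's formula the difference quotients of point masses converge to
    derivatives of point masses, with an error of the form h times a bounded set of
    distributions (second_difference_bounded).  Phi maps bounded sets to
    equicontinuous sets, so the derivatives of pi_* v exist and are the vectors
    Phi (D) v for D a derivative of a point mass; over compact sets these D are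
    bounded, whence the continuity of pi_*. *)

Set Implicit Arguments.
Unset Strict Implicit.
Unset Printing Implicit Defensive.

Import Order.TTheory GRing.Theory Num.Theory.
Import numFieldNormedType.Exports.

Local Open Scope classical_set_scope.
Local Open Scope complex_scope.
Local Open Scope ring_scope.

Local Notation Re := complex.Re.
Local Notation Im := complex.Im.

(** * The modulus of complex numbers *)

Section modulus.
Context (R : realType).
Implicit Types (z w : R[i]) (r M : R).

Definition cmod z : R := Re `|z|.

Lemma normcE z : `|z| = (cmod z)%:C.
Proof.
have : `|z| \is Num.real by rewrite normr_real.
by rewrite /cmod; case: z => a b; rewrite normc_def.
Qed.

Lemma cmod_le z M : (`|z| <= M%:C) = (cmod z <= M).
Proof. by rewrite normcE lecR. Qed.

Lemma cmod_lt z M : (`|z| < M%:C) = (cmod z < M).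
Proof. by rewrite normcE ltcR. Qed.

Lemma cmod_ge0 z : 0 <= cmod z.
Proof. by rewrite -ler0c -normcE. Qed.

Lemma cmodM z w : cmod (z * w) = cmod z * cmod w.
Proof. by apply: (@complexI R); rewrite rmorphM /= -!normcE normrM. Qed.

Lemma cmodD z w : cmod (z + w) <= cmod z + cmod w.
Proof. by rewrite -lecR rmorphD /= -!normcE ler_normD. Qed.

Lemma cmodN z : cmod (- z) = cmod z.
Proof. by apply: (@complexI R); rewrite -!normcE normrN. Qed.

Lemma cmodB z w : cmod (z - w) <= cmod z + cmod w.
Proof. by rewrite -(cmodN w) cmodD. Qed.

Lemma cmodBC z w : cmod (z - w) = cmod (w - z).
Proof. by rewrite -cmodN opprB. Qed.

Lemma cmod0 : cmod 0 = 0.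
Proof. by apply: (@complexI R); rewrite -normcE normr0. Qed.

Lemma cmod1 : cmod 1 = 1.
Proof. by apply: (@complexI R); rewrite -normcE normr1. Qed.

Lemma cmodR r : cmod r%:C = `|r|.
Proof. by rewrite /cmod normc_def /= expr0n addr0 sqrtr_sqr. Qed.

Lemma cmodV z : cmod z^-1 = (cmod z)^-1.
Proof. by apply: (@complexI R); rewrite fmorphV /= -!normcE normfV. Qed.

Lemma cmod_eq0 z : cmod z = 0 -> z = 0.
Proof. by move=> z0; apply/eqP; rewrite -normr_eq0 normcE z0. Qed.

Lemma cmod_gt0 z : z != 0 -> 0 < cmod z.
Proof.
move=> z0; rewrite lt_neqAle cmod_ge0 eq_sym andbT.
by apply: contra_neq z0; exact: cmod_eq0.
Qed.

Lemma cmodi : cmod 'i = 1.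
Proof. by rewrite /cmod normc_def /= expr0n expr1n add0r sqrtr1. Qed.

Lemma normRe_le_cmod z : `|Re z| <= cmod z.
Proof. by rewrite /cmod normc_def /= -sqrtr_sqr ler_wsqrtr// lerDl sqr_ge0. Qed.

Lemma normIm_le_cmod z : `|Im z| <= cmod z.
Proof. by rewrite /cmod normc_def /= -sqrtr_sqr ler_wsqrtr// lerDr sqr_ge0. Qed.

Lemma Re_le_cmod z : Re z <= cmod z.
Proof. exact: le_trans (ler_norm _) (normRe_le_cmod z). Qed.

Lemma cmod_le_ReIm z : cmod z <= `|Re z| + `|Im z|.
Proof.
rewrite {1}(complexE z) (le_trans (cmodD _ _))// cmodM cmodi mul1r.
by rewrite !cmodR.
Qed.

Lemma cmod_sum (I : Type) (s : seq I) (F : I -> R[i]) :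
  cmod (\sum_(k <- s) F k) <= \sum_(k <- s) cmod (F k).
Proof.
elim/big_rec2: _ => [|k x y _ xy]; first by rewrite cmod0.
by rewrite (le_trans (cmodD _ _))// lerD2l.
Qed.

Lemma posc_real (e : R[i]) : 0 < e -> exists2 r : R, 0 < r & e = r%:C.
Proof.
case: e => a b; rewrite ltcE /= => /andP[/eqP -> a0].
by exists a.
Qed.

End modulus.

(** This passes from a bound on the real part of a functional to a bound on its
    modulus. *)
Lemma phase (R : realType) (z : R[i]) :
  exists2 a : R[i], cmod a = 1 & a * z = (cmod z)%:C.
Proof.
have [->|z0] := eqVneq z 0; first by exists 1; rewrite ?cmod1// mulr0 cmod0.
have m0 : cmod z != 0 by rewrite gt_eqF// cmod_gt0.
exists ((cmod z)%:C / z); last by rewrite mulfVK.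
by rewrite cmodM cmodR cmodV ger0_norm ?cmod_ge0// divff.
Qed.

(** * Seminorms and the Hahn-Banach theorem *)

Section hahn_banach.
Context (R : realType) (E : lmodType R[i]).

Definition seminorm (p : E -> R) :=
  (forall u v, p (u + v) <= p u + p v) /\
  (forall a u, p (a *: u) = cmod a * p u).

Lemma seminorm0 p : seminorm p -> p 0 = 0.
Proof. by move=> [_ pZ]; rewrite -(scale0r 0) pZ cmod0 mul0r. Qed.

Lemma seminormN p u : seminorm p -> p (- u) = p u.
Proof. by move=> [_ pZ]; rewrite -scaleN1r pZ cmodN cmod1 mul1r. Qed.

Lemma seminorm_ge0 p u : seminorm p -> 0 <= p u.
Proof.
move=> sp; have := sp.1 u (- u).
by rewrite subrr (seminorm0 sp) (seminormN _ sp) -mulr2n pmulrn_lge0.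
Qed.

Section real_extension.
Variables (p : E -> R) (sp : seminorm p) (G0 : set (E * R)).

Let subspace (G : set (E * R)) :=
  forall (r : R) x y, G x -> G y -> G (r%:C *: x.1 + y.1, r * x.2 + y.2).
Let dominated (G : set (E * R)) := forall x, G x -> x.2 <= p x.1.

Hypotheses (G00 : G0 (0, 0)) (G0sub : subspace G0) (G0dom : dominated G0).

Let partial_ext G := [/\ G0 `<=` G, subspace G & dominated G].

Let pR (r : R) u : 0 <= r -> p (r%:C *: u) = r * p u.
Proof. by move=> r0; rewrite sp.2 cmodR ger0_norm. Qed.

(* c0 may be any number between the values that the two signs of v0 impose; the
   triangle inequality for p says that there is one *)
Let one_more A (v0 : E) : partial_ext A -> exists c0 : R,
  (forall x, A x -> x.2 - p (x.1 - v0) <= c0) /\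
  (forall x, A x -> c0 <= p (x.1 + v0) - x.2).
Proof.
move=> [G0A sA dA]; pose S := [set x.2 - p (x.1 - v0) | x in A].
have A0 : A (0, 0) by exact: G0A.
have AB x y : A x -> A y -> x.2 - p (x.1 - v0) <= p (y.1 + v0) - y.2.
  move=> Ax Ay; rewrite lerBlDr addrAC lerBrDr.
  have /dA /= : A (1%:C *: x.1 + y.1, 1 * x.2 + y.2) by exact: sA.
  rewrite scale1r mul1r => /le_trans; apply.
  by rewrite addrC (le_trans _ (sp.1 _ _))// addrACA addNr addr0 addrC.
have hs : has_sup S.
  split; first by exists (0 - p (0 - v0)); exists (0, 0).
  by exists (p (0 + v0) - 0) => _ [x Ax <-]; exact: (AB x (0, 0)).
exists (sup S); split => [x Ax|y Ay].
  by apply: sup_upper_bound => //; exists x.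
by apply: ge_sup; [exact: hs.1|move=> _ [x Ax <-]; exact: AB].
Qed.

(** Zorn's lemma on the graphs of partial extensions of G0: as a subset of E * R
    a graph is automatically that of a function, because it is dominated by p. *)
Lemma dominated_extension : exists g : E -> R,
  [/\ forall r u v, g (r%:C *: u + v) = r * g u + g v,
      forall x, G0 x -> g x.1 = x.2 & forall u, g u <= p u].
Proof.
(* the empty set is admitted for the sake of the empty chain *)
have [F FP Ftot|A [PA Amax]] :=
    @Zorn_bigcup _ (fun G => G !=set0 -> partial_ext G).
  move=> [x0 [G FG Gx0]]; split.
  - have [G0G _ _] := FP _ FG (ex_intro _ _ Gx0).
    by apply: subset_trans G0G _; exact: bigcup_sup.
  - move=> r x y [G1 FG1 G1x] [G2 FG2 G2y].
    have [G12|G21] := Ftot _ _ FG1 FG2.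
      exists G2 => //; have [_ sG _] := FP _ FG2 (ex_intro _ _ G2y).
      by apply: sG => //; exact: G12.
    exists G1 => //; have [_ sG _] := FP _ FG1 (ex_intro _ _ G1x).
    by apply: sG => //; exact: G21.
  - move=> x [G1 FG1 G1x]; have [_ _ dG] := FP _ FG1 (ex_intro _ _ G1x).
    exact: dG.
have {PA} PA : partial_ext A.
  apply: PA; apply/set0P/eqP => A0; apply: (Amax G0); last by split.
  by rewrite A0; split => // /(_ _ G00).
have [G0A sA dA] := PA; have A0 : A (0, 0) by exact: G0A.
have fA u c d : A (u, c) -> A (u, d) -> c = d.
  have le u' c' d' : A (u', c') -> A (u', d') -> c' <= d'.
    move=> Ac Ad.
    have /dA /= : A ((-1)%:C *: u' + u', -1 * d' + c') by exact: (sA (-1) (u', d') (u', c')).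
    rewrite rmorphN1 scaleN1r addNr (seminorm0 sp).
    by rewrite mulN1r addrC subr_le0.
  by move=> Ac Ad; apply/eqP; rewrite eq_le (le u c d)// (le u d c).
have tA v0 : exists c, A (v0, c).
  apply: contrapT => nv0; have [c0 [lo hi]] := one_more v0 PA.
  pose B := [set y : E * R | exists x r, A x /\ y = (x.1 + r%:C *: v0, x.2 + r * c0)].
  have AB : A `<=` B.
    by move=> [x1 x2] Ax; exists (x1, x2), 0; rewrite /= scale0r mul0r !addr0.
  apply: (Amax B); first split => // BA.
    apply: nv0; exists c0; apply: BA; exists (0, 0), 1; split => //=.
    by rewrite scale1r mul1r !add0r.
  move=> _; split; first exact: subset_trans AB.
    move=> r _ _ [x [a [Ax ->]]] [y [b [Ay ->]]] /=.
    exists (r%:C *: x.1 + y.1, r * x.2 + y.2), (r * a + b); split; first exact: sA.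
    congr (_, _) => /=; last by ring.
    by rewrite scalerDr scalerA -rmorphM rmorphD scalerDl addrACA.
  move=> _ [x [r [Ax ->]]] /=.
  have Asc s : A (s%:C *: x.1, s * x.2).
    by have := sA s x (0, 0) Ax A0; rewrite /= !addr0.
  have [r0|r0|->] := ltrgt0P r; last by rewrite mul0r scale0r !addr0; exact: dA.
  - have -> : x.1 + r%:C *: v0 = r%:C *: (r^-1%:C *: x.1 + v0).
      by rewrite scalerDr scalerA -rmorphM /= divff ?gt_eqF// scale1r.
    rewrite pR ?(ltW r0)//; have /= := hi _ (Asc r^-1); rewrite -(ler_pM2l r0).
    rewrite mulrBr mulrA divff ?gt_eqF// mul1r; lra.
  - have s0 : 0 < - r by rewrite oppr_gt0.
    have -> : x.1 + r%:C *: v0 = (- r)%:C *: ((- r)^-1%:C *: x.1 - v0).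
      rewrite scalerBr scalerA -rmorphM /= divff ?gt_eqF// scale1r.
      by rewrite rmorphN scaleNr opprK.
    rewrite pR ?(ltW s0)//; have /= := lo _ (Asc (- r)^-1); rewrite -(ler_pM2l s0).
    by rewrite mulrBr mulrA divff ?gt_eqF// mul1r; lra.
pose g v := sval (cid (tA v)); have gA v : A (v, g v) by exact: (svalP (cid (tA v))).
exists g; split => [r u v|[u c] /G0A Auc|u]; last exact: (dA (u, g u)).
- by apply: fA (gA _) _; exact: (sA r (u, g u) (v, g v)).
- exact: fA (gA u) Auc.
Qed.

End real_extension.

(** The functional is given on the image of a linear map j, rather than on a
    subspace: the domination by p makes it well defined there, and this is the
    form in which it is used, both for jets and for lines in V. *)
Theorem hahn_banach (S : lmodType R[i]) (j : {linear S -> E})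
    (D : S -> R[i]) (p : E -> R) :
  (forall a u v, D (a *: u + v) = a * D u + D v) ->
  seminorm p -> (forall s, cmod (D s) <= p (j s)) ->
  exists L : E -> R[i], [/\ forall a u v, L (a *: u + v) = a * L u + L v,
    forall s, L (j s) = D s & forall u, cmod (L u) <= p u].
Proof.
move=> Dl sp Dp.
have D0 : D 0 = 0.
  by have := Dl (-1) 0 0; rewrite scaler0 addr0 mulN1r addNr.
have DZ a s : D (a *: s) = a * D s by rewrite -[a *: s]addr0 Dl D0 addr0.
have [|||g [gl gD gp]] :=
    @dominated_extension p sp [set (j s, Re (D s)) | s in [set: S]].
- by exists 0 => //; rewrite linear0 D0.
- move=> r _ _ [s _ <-] [t _ <-] /=; exists (r%:C *: s + t) => //.
  rewrite linearP Dl; congr (_, _).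
  by case: (D s) (D t) => [a b] [c d] /=; rewrite mul0r subr0.
- by move=> _ [s _ <-] /=; exact: le_trans (Re_le_cmod _) (Dp s).
(* the complex functional with real part g *)
pose L u := g u -i* g ('i *: u).
have g0 : g 0 = 0.
  by have := gl (-1) 0 0; rewrite scaler0 addr0 mulN1r addNr.
have gD' u v : g (u + v) = g u + g v by rewrite -{1}[u]scale1r (gl 1) mul1r.
have gZ r u : g (r%:C *: u) = r * g u by rewrite -[_ *: u]addr0 gl g0 addr0.
have LD u v : L (u + v) = L u + L v.
  by rewrite /L scalerDr !gD'; simpc.
have Li u : L ('i *: u) = 'i * L u.
  have gN v : g (- v) = - g v.
    by rewrite -[- v]scaleN1r -(rmorphN1 (real_complex R)) gZ mulN1r.
  by rewrite /L scalerA -expr2 sqr_i scaleN1r gN; simpc.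
have LR r u : L (r%:C *: u) = r%:C * L u.
  by rewrite /L scalerA mulrC -scalerA !gZ; simpc.
have LZ a u : L (a *: u) = a * L u.
  by rewrite {1}(complexE a) scalerDl LD LR -scalerA Li LR mulrA -mulrDl -complexE.
exists L; split => [a u v|s|u]; first by rewrite LD LZ.
  rewrite /L -linearZ.
  rewrite (gD (j s, Re (D s))); last by exists s.
  rewrite (gD (j ('i *: s), Re (D ('i *: s)))); last by exists ('i *: s).
  by rewrite /= DZ mulrC ReiNIm opprK; case: (D s).
have [a a1 aL] := phase (L u).
have : g (a *: u) <= p (a *: u) by exact: gp.
rewrite sp.2 a1 mul1r; apply: le_trans.
by rewrite (_ : g _ = Re (L (a *: u)))// LZ aL.
Qed.

End hahn_banach.

(** * Continuous seminorms of a locally convex space *)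

Section lcs_seminorms.
Context (R : realType) (V : lcsType R[i]).
Implicit Types (N U : set V) (x y : V) (p : V -> R).

Lemma nbhs_scale (a : R[i]) x N : nbhs (a *: x) N ->
  exists2 e : R, 0 < e & exists2 W, nbhs x W &
    forall b y, cmod (b - a) < e -> W y -> N (b *: y).
Proof.
move=> /(@scale_continuous _ V (a, x))[[/= B W] [/nbhs_ballP[e /= e0 eB] nW] sub].
have [r r0 er] := posc_real e0; exists r => //; exists W => // b y ab Wy.
apply: (sub (b, y)); split => //=; apply: eB.
by rewrite -ball_normE /= er cmod_lt cmodBC.
Qed.

Lemma nbhs_add x y N : nbhs (x + y) N ->
  exists2 W : set V * set V, nbhs x W.1 /\ nbhs y W.2 &
    forall u v, W.1 u -> W.2 v -> N (u + v).
Proof.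
move=> /(@add_continuous V (x, y))[W [nW1 nW2] sub]; exists W => // u v Wu Wv.
by apply: (sub (u, v)).
Qed.

Lemma nbhs_translate x N : nbhs x N -> nbhs 0 [set u | N (x + u)].
Proof.
rewrite -{1}[x]addr0 => /nbhs_add[W [nW1 nW2] sub]; apply: filterS nW2 => u Wu.
by apply: sub => //; exact: nbhs_singleton.
Qed.

Lemma entourage_diff N : nbhs 0 N -> entourage [set z : V * V | N (z.1 - z.2)].
Proof.
move=> /nbhsP[E eE sub].
have [[/= E1 E2] [eE1 eE2] sub12] := @lcs_sub_unif_continuous _ V E eE.
apply: filterS (entourage_inv eE1) => -[x y] /= E1yx; apply: sub.
apply/xsectionP; rewrite -(subrr y).
have /sub12 /= : (E1 `*` E2) ((y, x), (y, y)).
  by split => //=; exact: entourage_refl.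
by move=> [[[a1 a2] [b1 b2]] /= ab [h1 h2 h3 h4]]; move: ab; rewrite h1 h2 h3 h4.
Qed.

Lemma diff_entourage (E : set (V * V)) : entourage E ->
  exists2 N, nbhs 0 N & forall x y, N (y - x) -> E (x, y).
Proof.
move=> eE; have [[/= E1 E2] [eE1 eE2] sub12] := @lcs_sub_unif_continuous _ V E eE.
have [[/= F1 F2] [eF1 eF2] subF] := @lcs_sub_unif_continuous _ V E2 eE2.
exists (xsection F2 0); first exact: nbhs_entourage.
move=> x y /xsectionP F2xy.
have : E2 (0, x - y).
  have /subF /= : (F1 `*` F2) ((0, 0), (0, y - x)).
    by split => //=; exact: entourage_refl.
  move=> [[[a1 a2] [b1 b2]] /= ab [h1 h2 h3 h4]]; move: ab.
  by rewrite h1 h2 h3 h4 subrr sub0r opprB.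
move=> E2xy; have /sub12 /= : (E1 `*` E2) ((x, x), (0, x - y)).
  by split => //=; exact: entourage_refl.
move=> [[[a1 a2] [b1 b2]] /= ab [h1 h2 h3 h4]]; move: ab.
by rewrite h1 h2 h3 h4 subr0 subKr.
Qed.

(** By homogeneity, boundedness near the origin is the same as continuity. *)
Definition cseminorm p := seminorm p /\ nbhs 0 [set x | p x < 1].

Lemma cseminorm_small p (e : R) : cseminorm p -> 0 < e ->
  nbhs 0 [set x | p x < e].
Proof.
move=> [sp np] e0.
have : nbhs (e^-1%:C *: (0 : V)) [set x | p x < 1] by rewrite scaler0.
move=> /nbhs_scale[d d0 [W nW sub]]; apply: filterS nW => x Wx.
have /= := sub e^-1%:C x; rewrite subrr cmod0 sp.2 cmodR gtr0_norm ?invr_gt0//.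
by move=> /(_ d0 Wx); rewrite mulrC ltr_pdivrMr// mul1r.
Qed.

Lemma cseminormD p q : cseminorm p -> cseminorm q -> cseminorm (p \+ q).
Proof.
move=> cp cq; split; last first.
  have h0 : 0 < 2^-1 :> R by rewrite invr_gt0.
  have np := cseminorm_small cp h0; have nq := cseminorm_small cq h0.
  apply: filterS2 np nq => x /= px qx.
  by rewrite (splitr 1) mul1r ltrD.
move: cp cq => [[pD pZ] _] [[qD qZ] _].
split => [u v|a u] /=; first by rewrite addrACA lerD.
by rewrite mulrDr pZ qZ.
Qed.

Lemma cseminormZ p (r : R) : 0 <= r -> cseminorm p -> cseminorm (fun x => r * p x).
Proof.
move=> r0 cp; have [[pD pZ] _] := cp; split.
  by split => [u v|a u]; [rewrite -mulrDr ler_wpM2l|rewrite pZ mulrCA].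
have r1 : 0 < (r + 1)^-1 by rewrite invr_gt0 ltr_wpDl.
apply: filterS (cseminorm_small cp r1) => x /= px.
have p0 : 0 <= p x := seminorm_ge0 x cp.1.
have : (r + 1) * p x < 1 by rewrite mulrC -ltr_pdivlMr ?mul1r// ltr_wpDl.
by apply: le_lt_trans; rewrite mulrDl mul1r lerDl.
Qed.

Section gauge.
Variable U : set V.
Hypotheses (Uconvex : forall x y (t : R), 0 <= t <= 1 -> U x -> U y ->
    U (t%:C *: x + (1 - t)%:C *: y))
  (Ubal : forall a x, cmod a <= 1 -> U x -> U (a *: x))
  (U0 : nbhs 0 U).

Let scales x := [set t : R | 0 < t /\ U (t^-1%:C *: x)].

Definition gauge x := inf (scales x).

Let scales_lb x : lbound (scales x) 0.
Proof. by move=> t [/ltW]. Qed.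

Let scales_inf x : has_inf (scales x).
Proof.
split; last by exists 0; exact: scales_lb.
have : nbhs (0 *: x) U by rewrite scale0r.
move=> /nbhs_scale[e e0 [W nW sub]]; exists (e / 2)^-1; split.
  by rewrite invr_gt0 divr_gt0.
apply: sub; last exact: nbhs_singleton.
rewrite subr0 invrK cmodR gtr0_norm ?divr_gt0//.
by rewrite ltr_pdivrMr// ltr_pMr// ltr1n.
Qed.

Let gauge_le x t : 0 < t -> U (t^-1%:C *: x) -> gauge x <= t.
Proof. by move=> t0 Ut; apply: ge_inf; [exact: (scales_inf x).2|]. Qed.

Let gauge_gt x t : gauge x < t -> U (t^-1%:C *: x) /\ 0 < t.
Proof.
move=> /inf_lt[|s [s0 Us] st]; first exact: (scales_inf x).1.
have t0 := lt_trans s0 st; split => //.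
have -> : t^-1%:C *: x = (s / t)%:C *: (s^-1%:C *: x).
  by rewrite scalerA -rmorphM /= mulrAC divff ?mul1r// gt_eqF.
apply: Ubal => //; rewrite cmodR gtr0_norm ?divr_gt0//.
by rewrite ler_pdivrMr// mul1r ltW.
Qed.

Let gauge_ge0 x : 0 <= gauge x.
Proof. by apply: lb_le_inf; [exact: (scales_inf x).1|exact: scales_lb]. Qed.

Let gaugeZ_le a x : gauge (a *: x) <= cmod a * gauge x.
Proof.
have [->|a0] := eqVneq a 0.
  rewrite scale0r cmod0 mul0r; apply/ler_addgt0Pr => e e0; rewrite add0r.
  by apply: gauge_le => //; rewrite scaler0; exact: nbhs_singleton.
have ca := cmod_gt0 a0.
rewrite mulrC -ler_pdivrMr//; apply/ler_addgt0Pr => e e0.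
have [] : U ((gauge x + e)^-1%:C *: x) /\ 0 < gauge x + e.
  by apply: gauge_gt; rewrite ltrDl.
set t := gauge x + e => Ut t0; rewrite ler_pdivrMr//.
apply: gauge_le; first by rewrite mulr_gt0.
have -> : (t * cmod a)^-1%:C *: (a *: x) = (a / (cmod a)%:C) *: (t^-1%:C *: x).
  by rewrite !scalerA invfM rmorphM /= [X in X *: _](_ : _ = a / (cmod a)%:C * t^-1%:C)//
    [(cmod a)^-1%:C]fmorphV /=; ring.
by apply: Ubal => //; rewrite cmodM cmodV cmodR gtr0_norm// divff ?gt_eqF.
Qed.

Lemma gauge_seminorm : seminorm gauge.
Proof.
split => [x y|a x].
  apply/ler_addgt0Pr => e e0; have e2 : 0 < e / 2 by rewrite divr_gt0.
  have [] : U ((gauge x + e / 2)^-1%:C *: x) /\ 0 < gauge x + e / 2.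
    by apply: gauge_gt; rewrite ltrDl.
  have [] : U ((gauge y + e / 2)^-1%:C *: y) /\ 0 < gauge y + e / 2.
    by apply: gauge_gt; rewrite ltrDl.
  rewrite {5}(splitr e) addrACA.
  move: (gauge x + _) (gauge y + _) => t s Us s0 Ut t0.
  apply: gauge_le; first exact: addr_gt0.
  have ts0 : t + s != 0 by rewrite gt_eqF// addr_gt0.
  have := @Uconvex _ _ (t / (t + s)) _ Ut Us.
  rewrite !scalerA -!rmorphM /=.
  have -> : t / (t + s) * t^-1 = (t + s)^-1 by field; rewrite ts0 gt_eqF.
  have -> : (1 - t / (t + s)) * s^-1 = (t + s)^-1 by field; rewrite ts0 gt_eqF.
  rewrite -scalerDr; apply; rewrite divr_ge0 ?addr_ge0 ?(ltW t0) ?(ltW s0)//=.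
  by rewrite ler_pdivrMr ?addr_gt0// mul1r lerDl ltW.
apply/eqP; rewrite eq_le gaugeZ_le /=.
have [->|a0] := eqVneq a 0; first by rewrite cmod0 mul0r gauge_ge0.
have ca := cmod_gt0 a0.
have := gaugeZ_le a^-1 (a *: x).
by rewrite scalerA mulVf// scale1r cmodV mulrC ler_pdivlMr// mulrC.
Qed.

Lemma gauge_cseminorm : cseminorm gauge.
Proof.
split; first exact: gauge_seminorm.
have : nbhs (2%:C *: (0 : V)) U by rewrite scaler0.
move=> /nbhs_scale[e e0 [W nW sub]]; apply: filterS nW => x Wx /=.
apply: (@le_lt_trans _ _ 2^-1); last by rewrite invf_lt1// ltr1n.
apply: gauge_le; first by rewrite invr_gt0.
by rewrite invrK; apply: sub => //; rewrite subrr cmod0.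
Qed.

Lemma gauge_lt1 x : gauge x < 1 -> U x.
Proof. by move=> /gauge_gt[]; rewrite invr1 scale1r. Qed.

End gauge.

(** The gauge of the balanced core of a convex neighbourhood. *)
Lemma nbhs_cseminorm N : nbhs 0 N ->
  exists2 p, cseminorm p & [set x | p x < 1] `<=` N.
Proof.
move=> nN; have [B Bc [Bo Bb]] := @locally_convex _ V.
have [b [Bb' b0] bN] := Bb 0 N nN.
have nb : nbhs (0 *: (0 : V)) b by rewrite scaler0; apply: open_nbhs_nbhs; split => //; exact: Bo.
have cb : forall x y (t : R), 0 <= t <= 1 -> b x -> b y ->
    b (t%:C *: x + (1 - t)%:C *: y).
  move=> x y t /andP[t0 t1] bx by_.
  have t0' : 0 <= t%:C by rewrite lecR.
  have t1' : t%:C <= 1 :> R[i] by rewrite lecR.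
  have := Bc _ (mem_set Bb') x y (Itv01 t0' t1') (mem_set bx) (mem_set by_).
  by move=> /set_mem; rewrite rmorphB rmorph1.
(* the largest balanced subset of b *)
pose U := [set x | forall a, cmod a <= 1 -> b (a *: x)].
have Uc x y (t : R) : 0 <= t <= 1 -> U x -> U y ->
    U (t%:C *: x + (1 - t)%:C *: y).
  move=> t01 Ux Uy a a1; rewrite scalerDr !scalerA ![a * _]mulrC -!scalerA.
  by apply: cb => //; [exact: Ux|exact: Uy].
have Ub a x : cmod a <= 1 -> U x -> U (a *: x).
  by move=> a1 Ux c c1; rewrite scalerA; apply: Ux; rewrite cmodM mulr_ile1 ?cmod_ge0.
have U0 : nbhs 0 U.
  have [e e0 [W nW sub]] := nbhs_scale nb.
  have : nbhs ((2 / e)%:C *: (0 : V)) W by rewrite scaler0.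
  move=> /nbhs_scale[d d0 [W' nW' sub']]; apply: filterS nW' => x W'x a a1.
  have -> : a *: x = (a * (e / 2)%:C) *: ((2 / e)%:C *: x).
    rewrite scalerA -mulrA -rmorphM /= (_ : _ / _ * _ = 1) ?mulr1//.
    by field; rewrite gt_eqF.
  apply: sub; last by apply: sub' => //; rewrite subrr cmod0.
  rewrite subr0 cmodM cmodR gtr0_norm ?divr_gt0//.
  apply: (@le_lt_trans _ _ (e / 2)); first by rewrite ler_piMl// ltW// divr_gt0.
  by rewrite ltr_pdivrMr// ltr_pMr// ltr1n.
exists (gauge U); first exact: gauge_cseminorm.
move=> x /(gauge_lt1 Ub U0) /(_ 1); rewrite cmod1 scale1r => /(_ (lexx _)).
exact: bN.
Qed.

Lemma cseminorm_entourage p (e : R) : cseminorm p -> 0 < e ->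
  entourage [set z : V * V | p (z.1 - z.2) < e].
Proof.
move=> cp e0; apply: (@entourage_diff [set x | p x < e]).
exact: cseminorm_small.
Qed.

Lemma entourage_cseminorm (E : set (V * V)) : entourage E ->
  exists2 p, cseminorm p & forall x y, p (x - y) < 1 -> E (x, y).
Proof.
move=> /diff_entourage[N nN NE]; have [p cp pN] := nbhs_cseminorm nN.
exists p => // x y pxy; apply: NE; apply: pN => /=.
by rewrite -opprB (seminormN _ cp.1).
Qed.

Lemma near_cseminorm x p (e : R) : cseminorm p -> 0 < e ->
  \forall y \near x, p (y - x) < e.
Proof.
move=> cp e0; have := cseminorm_entourage cp e0.
move=> /entourage_inv/(nbhs_entourage x); apply: filterS => y /xsectionP /=.
by [].
Qed.

Lemma cvg_cseminormP (T : Type) (F : set_system T) {FF : Filter F} (f : T -> V) x :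
  f @ F --> x <-> forall p, cseminorm p -> \forall t \near F, p (f t - x) < 1.
Proof.
split => [fx p cp|fx N nN].
  have near1 := near_cseminorm x cp ltr01.
  exact: (fx _ near1).
have [p cp pN] := nbhs_cseminorm (nbhs_translate nN).
apply: filterS (fx p cp) => t /= pt.
by have /= := pN (f t - x) pt; rewrite addrC subrK.
Qed.

Lemma cvg_cseminorm_lt (T : Type) (F : set_system T) {FF : Filter F}
    (f : T -> V) x p (e : R) :
  f @ F --> x -> cseminorm p -> 0 < e -> \forall t \near F, p (f t - x) < e.
Proof.
move=> fx cp e0; have near1 := near_cseminorm x cp e0; exact: (fx _ near1).
Qed.

Lemma cseminorm_eq0 x : (forall p, cseminorm p -> p x = 0) -> x = 0.
Proof.
move=> px; apply: (@lcs_hausdorff _ V) => A B nA nB.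
exists x; split; first exact: nbhs_singleton.
by have [p cp pB] := nbhs_cseminorm nB; apply: pB; rewrite /= px.
Qed.

End lcs_seminorms.

(** * Continuous linear functionals *)

Lemma clinP (K : numFieldType) (W : preTopologicalLmodType K)
    (U : preTopologicalLmodType K) (f : clin W U) : linear f /\ continuous f.
Proof. exact/asboolP/(clin_funP f). Qed.

Section scalars.
Context (R : realType).
Local Notation C := (R[i]^o).

Lemma cmod_seminorm : seminorm (fun z : C => cmod z).
Proof. by split => [u v|a u]; [exact: cmodD|exact: cmodM]. Qed.

Lemma nbhs_cmod (z : C) (e : R) : 0 < e -> \forall w \near z, cmod (w - z) < e.
Proof.
move=> e0; apply/nbhs_ballP; exists e%:C => /=; first by rewrite ltcR.
by move=> w; rewrite -ball_normE /= cmod_lt cmodBC.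
Qed.

Lemma cmod_cseminorm : cseminorm (fun z : C => cmod z).
Proof.
split; first exact: cmod_seminorm.
by apply: filterS (nbhs_cmod 0 ltr01) => w; rewrite subr0.
Qed.

Lemma cvg_cmodP (T : Type) (F : set_system T) {FF : Filter F} (f : T -> C) (l : C) :
  f @ F --> l <-> forall e : R, 0 < e -> \forall t \near F, cmod (f t - l) < e.
Proof.
split=> [fl e e0|fl]; first by apply: (fl _ (nbhs_cmod l e0)).
apply/cvg_cseminormP => p [sp np].
have pE z : p z = cmod z * p 1 by rewrite -sp.2 /= /GRing.scale /= mulr1.
have p1 : 0 < (p 1 + 1)^-1 by rewrite invr_gt0 ltr_wpDl// seminorm_ge0.
apply: filterS (fl _ p1) => t /= h; rewrite pE.
apply: (@le_lt_trans _ _ (cmod (f t - l) * (p 1 + 1))).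
  by rewrite ler_wpM2l ?cmod_ge0// lerDl.
by rewrite -ltr_pdivlMr ?mul1r// -invr_gt0.
Qed.

Lemma cvg_cmod_lt (T : Type) (F : set_system T) {FF : Filter F} (f : T -> C) (l : C)
    (e : R) : f @ F --> l -> 0 < e -> \forall t \near F, cmod (f t - l) < e.
Proof. by move=> /cvg_cmodP; apply. Qed.

End scalars.

Section functionals.
Context (R : realType) (V : lcsType R[i]).
Local Notation C := (R[i]^o).

Lemma clin_cseminorm (W : lcsType R[i]) (l : clin V W) q :
  cseminorm q -> cseminorm (fun x => q (l x)).
Proof.
have [ll lc] := clinP l; have lD x y : l (x + y) = l x + l y.
  by rewrite -{1}[x]scale1r ll scale1r.
have l0 : l 0 = 0 by rewrite -[X in l X](subrr 0) -{1}scaleN1r addrC ll scaleN1r addNr.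
move=> [sq nq]; split.
  split => [x y|a x]; first by rewrite lD sq.1.
  by rewrite -[a *: x]addr0 ll l0 addr0 sq.2.
have := lc 0 [set x | q x < 1]; rewrite l0 => /(_ nq).
exact.
Qed.

Lemma cseminorm_clin (W : lcsType R[i]) (l : V -> W) :
  linear l -> (forall q, cseminorm q -> cseminorm (fun x => q (l x))) ->
  continuous l.
Proof.
move=> ll lq x; apply/cvg_cseminormP => q /lq cq.
apply: filterS (near_cseminorm x cq ltr01) => y; congr (q _ < 1).
by rewrite -scaleN1r addrC ll scaleN1r addrC.
Qed.

(** Hahn-Banach on the line spanned by w.  Through this lemma estimates of
    vectors by seminorms are reduced to estimates of scalars. *)
Lemma norming_functional p (w : V) : cseminorm p ->
  exists l : clin V (C : tvsType R[i]), l w = (p w)%:C /\ forall x, cmod (l x) <= p x.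
Proof.
move=> cp; have sp := cp.1.
have jl : linear (fun a : C => a *: w).
  by move=> a u v; rewrite scalerDl scalerA.
pose j : {linear C -> V} := HB.pack (fun a : C => a *: w)
  (GRing.isLinear.Build _ _ _ _ _ jl).
have [||L [Ll LE Lp]] := @hahn_banach R V C j (fun a => a * (p w)%:C) p _ sp.
- by move=> a u v; rewrite mulrDl mulrA.
- by move=> a; rewrite /= sp.2 cmodM cmodR ger0_norm// seminorm_ge0.
have Lc : continuous (L : V -> C).
  apply: cseminorm_clin => // q [sq nq].
  have qE z : q z = cmod z * q 1 by rewrite -sq.2 /= /GRing.scale /= mulr1.
  have [[_ _] nq1] := cseminormZ (seminorm_ge0 1 sq) cp.
  split; last first.
    apply: filterS nq1 => x /=; apply: le_lt_trans; rewrite qE mulrC.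
    by rewrite ler_wpM2l ?seminorm_ge0.
  have L0 : L 0 = 0.
    by have := Ll (-1) 0 0; rewrite scaler0 addr0 mulN1r addNr.
  split => [x y|a x]; first by rewrite -[x]scale1r Ll mul1r scale1r sq.1.
  by rewrite -[a *: x]addr0 Ll L0 addr0 -sq.2.
exists (Clin (asboolT (conj (Ll : linear (L : V -> C)) Lc))); split => //=.
by have := LE 1; rewrite /= scale1r mul1r.
Qed.

Lemma functionals_separate (x y : V) :
  (forall l : clin V (C : tvsType R[i]), l x = l y) -> x = y.
Proof.
move=> lxy; apply/eqP; rewrite -subr_eq0; apply/eqP/cseminorm_eq0 => p cp.
have [l [lE _]] := norming_functional (x - y) cp.
have [ll _] := clinP l; apply: (@complexI R).
by rewrite -lE -scaleN1r addrC ll lxy scaleN1r addNr.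
Qed.

End functionals.

(** * The mean value inequality *)

Section mean_value.
Context (R : realType).
Local Notation C := (R[i]^o).

Lemma real_mean_value (u u' : R -> R) (d e t : R) :
  (forall s : R, `|s| < d -> is_derive s (1 : R) u (u' s) /\ `|u' s| <= e) ->
  `|t| < d -> `|u t - u 0| <= e * `|t|.
Proof.
move=> du td.
have sd a b s : `|a| < d -> `|b| < d -> s \in `[a, b] -> `|s| < d.
  rewrite in_itv /= !ltr_norml => /andP[a1 a2] /andP[b1 b2] /andP[as_ sb].
  by rewrite (lt_le_trans a1)// (le_lt_trans sb).
have mv a b : `|a| < d -> `|b| < d -> a <= b -> `|u b - u a| <= e * (b - a).
  move=> ad bd ab.
  have [||c cab ->] := @MVT_segment R u u' a b ab.
  - move=> s /subset_itv_oo_cc sab; have sd' := sd a b s ad bd sab.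
    by have [] := du s sd'.
  - apply: continuous_in_subspaceT => s; rewrite inE => sab.
    have [dus _] := du s (sd a b s ad bd sab).
    exact/differentiable_continuous/derivable1_diffP/ex_derive.
  rewrite normrM (ger0_norm (_ : 0 <= b - a)) ?subr_ge0//.
  by rewrite ler_wpM2r ?subr_ge0//; have [] := du c (sd a b c ad bd cab).
have d0 : `|0 : R| < d by rewrite normr0 (le_lt_trans _ td).
have [t0|t0] := leP 0 t; first by have := mv _ _ d0 td t0; rewrite subr0 (ger0_norm t0).
have := mv _ _ td d0 (ltW t0).
by rewrite distrC sub0r (ltr0_norm t0).
Qed.

(** The constant 2 is lost by treating real and imaginary parts apart. *)
Lemma mean_value (g g' : R -> C) (c : C) (d e t : R) :
  (forall s, `|s| < d ->
    h^-1%:C *: (g (s + h) - g s) @[h --> 0^'] --> g' s) ->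
  (forall s, `|s| < d -> cmod (g' s - c) <= e) ->
  `|t| < d -> cmod (g t - g 0 - t%:C * c) <= 2 * e * `|t|.
Proof.
move=> dg ge td.
have part (L : C -> R) : (forall z w, L (z - w) = L z - L w) ->
    (forall (r : R) z, L (r%:C * z) = r * L z) ->
    (forall z, `|L z| <= cmod z) ->
    `|L (g t - g 0 - t%:C * c)| <= e * `|t|.
  move=> LB LZ Lm; pose u s := L (g s) - s * L c.
  have -> : L (g t - g 0 - t%:C * c) = u t - u 0.
    by rewrite !LB LZ /u mul0r subr0; ring.
  apply: (@real_mean_value u (fun s => L (g' s) - L c) d) => // s sd.
  split; last by rewrite -LB (le_trans (Lm _))// ge.
  have cv : (fun h => h^-1 *: ((u \o shift s) (h *: 1) - u s)) @ 0^' --> L (g' s) - L c.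
    apply/cvgrPdist_lt => r r0; have /cvg_cmodP/(_ _ r0) := dg s sd.
    have nz : \forall h \near (0 : R)^', h != 0 by exact: nbhs_dnbhs_neq.
    apply: filterS2 nz => h h0 /=; apply: le_lt_trans.
    rewrite (le_trans _ (Lm _))// distrC /GRing.scale /= LB LZ LB mulr1 /u.
    rewrite [h + s]addrC (_ : _ - _ = h^-1 * (L (g (s + h)) - L (g s)) - L (g' s))//.
    by field.
  have ec : (fun h => h^-1 *: ((u \o shift s) (h *: 1) - u s)) @ 0^' --> 'D_1 u s.
    by apply: cvgP; exact: cv.
  by split; [apply: cvgP; exact: cv|exact: cvg_lim cv].
apply: (le_trans (cmod_le_ReIm _)); rewrite -mulrA mulr_natl mulr2n lerD//.
- apply: part => [[a b] [a' b']|r [a b]|z] //=; last exact: normRe_le_cmod.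
  by rewrite mul0r subr0.
- apply: part => [[a b] [a' b']|r [a b]|z] //=; last exact: normIm_le_cmod.
  by rewrite mul0r addr0.
Qed.

End mean_value.

(** * Partial derivatives *)

Section boxes.
Context (R : realType) (n : nat).
Implicit Types (x y k : 'rV[R]_n) (d : R).

Definition box x d := [set y : 'rV[R]_n | forall j, `|y ord0 j - x ord0 j| < d].

Lemma nbhs_box x d : 0 < d -> nbhs x (box x d).
Proof.
move=> d0; apply/nbhs_ballP; exists d => //= y [_ xy] j.
by have := xy ord0 j; rewrite /ball /= distrC.
Qed.

Lemma nbhs_boxP x (A : set 'rV[R]_n) : nbhs x A ->
  exists2 d, 0 < d & box x d `<=` A.
Proof.
move=> /nbhs_ballP[d /= d0 dA]; exists d => // y xy; apply: dA; split=> // i j.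
by rewrite (ord1 i) /ball /= distrC; exact: xy.
Qed.

End boxes.

Section partial_derivatives.
Context (R : realType) (n : nat) (V : lcsType R[i]).
Implicit Types (i : 'I_n) (f g : 'rV[R]_n -> V) (U : set 'rV[R]_n).

Lemma diff_quot_cvg_eq U i f g x (l : V) : open U -> U x ->
  {in U, f =1 g} -> diff_quot i f x h @[h --> 0^'] --> l ->
  diff_quot i g x h @[h --> 0^'] --> l.
Proof.
move=> Uo Ux fg; apply: cvg_trans; apply: near_eq_cvg.
apply: filterS (near_line i Uo Ux) => h Uh.
by rewrite /diff_quot !fg// inE.
Qed.

Lemma partial_eq U i f g x : open U -> U x -> {in U, f =1 g} ->
  partial i f x = partial i g x.
Proof.
move=> Uo Ux fg; rewrite /partial; congr xget; apply/seteqP; split=> l /=.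
  exact: (diff_quot_cvg_eq Uo Ux fg).
exact: (diff_quot_cvg_eq Uo Ux (fun y Uy => esym (fg y Uy))).
Qed.

Lemma partials_eq U s f g : open U -> {in U, f =1 g} ->
  {in U, partials s f =1 partials s g}.
Proof.
move=> Uo fg; elim: s => // i s IH x /[!inE] Ux /=.
exact: partial_eq IH.
Qed.

Lemma continuous_eq U f g x : open U -> U x -> {in U, f =1 g} ->
  {for x, continuous f} -> {for x, continuous g}.
Proof.
move=> Uo Ux fg; rewrite /prop_for /continuous_at (fg x) ?inE//.
apply: cvg_trans; apply: (@near_eq_cvg _ _ (nbhs x) (nbhs_filter x)).
have nU : nbhs x U by exact: open_nbhs_nbhs.
by apply: filterS nU => y Uy; rewrite fg// inE.
Qed.

Lemma smooth_on_eq U f g : open U -> {in U, f =1 g} ->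
  smooth_on U f -> smooth_on U g.
Proof.
move=> Uo fg sf s; split=> [x /[!inE] Ux|i x /[!inE] Ux].
  apply: (continuous_eq Uo Ux (partials_eq s Uo fg)).
  exact: ((sf s).1 x (mem_set Ux)).
have [l fl] := (sf s).2 i x (mem_set Ux); exists l.
exact: (diff_quot_cvg_eq Uo Ux (partials_eq s Uo fg) fl).
Qed.

Lemma smooth_on_local U f : (forall x, U x ->
    exists A : set 'rV[R]_n, A x /\ smooth_on A f) -> smooth_on U f.
Proof.
move=> loc s; split=> [x /[!inE] /loc[A [Ax sf]]|i x /[!inE] /loc[A [Ax sf]]].
  exact: ((sf s).1 x (mem_set Ax)).
exact: ((sf s).2 i x (mem_set Ax)).
Qed.

Lemma smooth_on_sub U A f : A `<=` U -> smooth_on U f -> smooth_on A f.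
Proof. by move=> AU sf; apply: smooth_on_local => x /AU Ux; exists U. Qed.

Lemma smooth_on_cvg U f s i x : smooth_on U f -> U x ->
  diff_quot i (partials s f) x h @[h --> 0^'] --> partials (i :: s) f x.
Proof. by move=> sf Ux; apply: partial_cvg; exact: ((sf s).2 i x (mem_set Ux)). Qed.

Lemma smooth_on_partials U f s : smooth_on U f -> smooth_on U (partials s f).
Proof.
by move=> sf t; have := sf (t ++ s); rewrite /partials foldr_cat.
Qed.

Lemma smooth_on_continuous U f : smooth_on U f -> {in U, continuous f}.
Proof. by move=> /(_ [::])[]. Qed.

(** Smoothness concerns all iterated derivatives; rather than computing them one
    exhibits a class of functions that contains its own derivatives. *)
Lemma smooth_on_coind U (P : ('rV[R]_n -> V) -> Prop) : open U ->
  (forall f, P f -> {in U, continuous f} /\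
     forall i, exists2 g, P g &
       {in U, forall x, diff_quot i f x h @[h --> 0^'] --> (g x : V)}) ->
  forall f, P f -> smooth_on U f.
Proof.
move=> Uo Pstep f Pf.
have Ps s : exists2 g, P g & {in U, partials s f =1 g}.
  elim: s => [|i s [g Pg fg]]; first by exists f.
  have [_ /(_ i)[k Pk gk]] := Pstep g Pg; exists k => // x /[!inE] Ux /=.
  apply: partialE; apply: (diff_quot_cvg_eq Uo Ux (fun y Uy => esym (fg y Uy))).
  exact: (gk x (mem_set Ux)).
move=> s; have [g Pg fg] := Ps s; have [cg dg] := Pstep g Pg.
split=> [x /[!inE] Ux|i x /[!inE] Ux].
  apply: (continuous_eq Uo Ux (fun y Uy => esym (fg y Uy))).
  exact: (cg x (mem_set Ux)).
have [k _ gk] := dg i; exists (k x).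
apply: (diff_quot_cvg_eq Uo Ux (fun y Uy => esym (fg y Uy))).
exact: (gk x (mem_set Ux)).
Qed.

Lemma diff_quot_sum (I : finType) i (f : I -> 'rV[R]_n -> V) (l : I -> V) x :
  (forall a, diff_quot i (f a) x h @[h --> 0^'] --> l a) ->
  diff_quot i (fun y => \sum_a f a y) x h @[h --> 0^'] --> \sum_a l a.
Proof.
move=> fl; suff gen (s : seq I) :
    diff_quot i (fun y => \sum_(a <- s) f a y) x h @[h --> 0^'] --> \sum_(a <- s) l a.
  exact: gen.
elim: s => [|a s IH].
  rewrite big_nil /diff_quot; under eq_fun do rewrite !big_nil subrr scaler0.
  exact: cvg_cst.
rewrite big_cons -[l a]scale1r.
apply: (@diff_quot_lin _ _ _ setT _ _ (f a)
  (fun y => \sum_(b <- s) f b y)) => // [|y _]; first exact: openT.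
by rewrite big_cons scale1r.
Qed.

End partial_derivatives.

Arguments smooth_on_cvg {R n V U f} s i {x} _ _.

Section scalar_calculus.
Context (R : realType) (n : nat).
Local Notation C := (R[i]^o).
Implicit Types (i : 'I_n) (F : 'rV[R]_n -> C) (U : set 'rV[R]_n) (x y k : 'rV[R]_n).

Lemma line_diff_quot i F x (s : R) (l : C) :
  diff_quot i F (x + s *: delta_mx ord0 i) h @[h --> 0^'] --> l ->
  h^-1%:C *: (F (x + (s + h) *: delta_mx ord0 i) - F (x + s *: delta_mx ord0 i))
    @[h --> 0^'] --> l.
Proof.
by apply: cvg_trans; apply: near_eq_cvg; apply: nearW => h;
  rewrite /diff_quot scalerDl addrA.
Qed.

Lemma line_estimate i F x (G : 'rV[R]_n -> C) (c : C) (d e t : R) :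
  (forall s : R, `|s| < d -> let y := x + s *: delta_mx ord0 i in
     diff_quot i F y h @[h --> 0^'] --> G y /\ cmod (G y - c) <= e) ->
  `|t| < d ->
  cmod (F (x + t *: delta_mx ord0 i) - F x - t%:C * c) <= 2 * e * `|t|.
Proof.
move=> dF td; have := @mean_value R (fun s => F (x + s *: delta_mx ord0 i))
  (fun s => G (x + s *: delta_mx ord0 i)) c d e t.
rewrite scale0r addr0; apply=> // s sd; last exact: (dF s sd).2.
exact: line_diff_quot (dF s sd).1.
Qed.

(** The increment k is split along the coordinate axes, where the mean value
    inequality applies to one partial derivative at a time. *)
Lemma c1_estimate F x k (G : 'I_n -> 'rV[R]_n -> C) (D : 'I_n -> C) (d e : R) :
  (forall y i, box x d y -> diff_quot i F y h @[h --> 0^'] --> G i y /\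
     cmod (G i y - D i) <= e) ->
  (forall i, `|k ord0 i| < d) ->
  cmod (F (x + k) - F x - \sum_i (k ord0 i)%:C * D i) <=
    2 * e * \sum_i `|k ord0 i|.
Proof.
move=> dF kd; pose kk l : 'rV[R]_n := \row_(j < n) (if (j < l)%N then k ord0 j else 0).
have kS (i : 'I_n) : kk i.+1 = kk i + k ord0 i *: delta_mx ord0 i.
  apply/rowP => j; rewrite !mxE eqxx /= ltnS leq_eqVlt.
  have [->|ji] := eqVneq j i; first by rewrite eqxx ltnn add0r mulr1.
  by rewrite (_ : (val j == val i) = false) ?mulr0 ?addr0//; apply/negbTE.
have k0 : kk 0%N = 0 by apply/rowP => j; rewrite !mxE ltn0.
have kn : kk n = k by apply/rowP => j; rewrite !mxE ltn_ord.
have -> : F (x + k) - F x = \sum_(i < n) (F (x + kk i.+1) - F (x + kk i)).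
  rewrite -(big_mkord xpredT (fun l => F (x + kk l.+1) - F (x + kk l))).
  by rewrite (@telescope_sumr _ 0 n (fun l => F (x + kk l)))// kn k0 addr0.
rewrite -sumrB mulr_sumr; apply: (le_trans (cmod_sum _ _)).
apply: ler_sum => i _; rewrite kS addrA.
apply: (@line_estimate i F (x + kk i) (G i) _ d e) => // s sd /=.
apply: dF => j; rewrite !mxE eqxx /=.
have [->|ji] := eqVneq j i; first by rewrite ltnn addr0 mulr1 addrAC subrr add0r.
rewrite mulr0 addr0 addrAC subrr add0r; case: ifP => // _.
by rewrite normr0 (le_lt_trans _ (kd i)).
Qed.

End scalar_calculus.

(** * Products and composites of smooth functions *)

Lemma cvg_sum_lcs (R : realType) (V : lcsType R[i]) (T : Type) (F : set_system T)
    {FF : Filter F} (I : finType) (f : I -> T -> V) (l : I -> V) :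
  (forall k, f k @ F --> l k) -> \sum_k f k t @[t --> F] --> \sum_k l k.
Proof.
move=> fl; suff gen (s : seq I) : \sum_(k <- s) f k t @[t --> F] --> \sum_(k <- s) l k.
  exact: gen.
elim: s => [|k s IH].
  by rewrite big_nil; under eq_fun do rewrite big_nil; exact: cvg_cst.
rewrite big_cons -[l k]scale1r; under eq_fun do rewrite big_cons -[f k _]scale1r.
exact: (@cvg_lin R[i] V T F FF (f k) (fun t => \sum_(k <- s) f k t) 1 (l k) _ (fl k) IH).
Qed.

Section chain_rule.
Context (R : realType).
Local Notation C := (R[i]^o).

Lemma diff_quotR n i (F : 'rV[R]_n -> C) x (h : R) :
  diff_quot i F x h = h^-1%:C * (F (x + h *: delta_mx ord0 i) - F x).
Proof. by []. Qed.

Lemma diff_quot_line_cvg n i (F : 'rV[R]_n -> C) x (l : C) :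
  diff_quot i F x h @[h --> 0^'] --> l ->
  F (x + h *: delta_mx ord0 i) @[h --> (0 : R)^'] --> F x.
Proof.
move=> Fl; apply/cvg_cmodP => e e0.
have cl0 : 0 < cmod l + 1 by rewrite ltr_wpDl ?cmod_ge0.
have small : \forall h \near (0 : R)^', `|h| < e / (cmod l + 1).
  apply: nbhs_dnbhs; apply/nbhs_ballP.
  exists (e / (cmod l + 1)) => /=; first by rewrite divr_gt0.
  by move=> h; rewrite /ball /= sub0r normrN.
have nz : \forall h \near (0 : R)^', h != 0 by exact: nbhs_dnbhs_neq.
have n1 : \forall h \near (0 : R)^', cmod (diff_quot i F x h - l) < 1.
  exact: cvg_cmod_lt Fl ltr01.
apply: (filterS3 _ _ small nz n1) => h hs h0 /= dh.
have -> : F (x + h *: delta_mx ord0 i) - F x = h%:C * diff_quot i F x h.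
  by rewrite diff_quotR mulrA -rmorphM /= divff// mul1r.
rewrite cmodM cmodR; have dl : cmod (diff_quot i F x h) < cmod l + 1.
  rewrite -[diff_quot _ _ _ _](subrK l) addrC (le_lt_trans (cmodD _ _))//.
  by rewrite ltrD2l.
rewrite ltr_pdivlMr// in hs; apply: le_lt_trans hs.
by rewrite ler_wpM2l// ltW.
Qed.

Lemma cvg_mulC (T : Type) (F : set_system T) {FF : Filter F} (f g : T -> C) (l m : C) :
  f @ F --> l -> g @ F --> m -> f t * g t @[t --> F] --> l * m.
Proof.
by move=> fl gm; exact: (cvg_comp2 fl gm (@scale_continuous R[i] C (l, m))).
Qed.

Lemma product_rule n i (a b : 'rV[R]_n -> C) x (a' b' : C) :
  diff_quot i a x h @[h --> 0^'] --> a' -> diff_quot i b x h @[h --> 0^'] --> b' ->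
  diff_quot i (fun y => a y * b y : C) x h @[h --> 0^'] --> a' * b x + a x * b'.
Proof.
move=> da db; have bx := diff_quot_line_cvg db.
have h1 : diff_quot i a x h * b (x + h *: delta_mx ord0 i) @[h --> 0^'] --> a' * b x.
  exact: cvg_mulC da bx.
have h2 : a x * diff_quot i b x h @[h --> 0^'] --> a x * b'.
  by apply: cvg_mulC db; exact: cvg_cst.
have : 1 *: (diff_quot i a x h * b (x + h *: delta_mx ord0 i) : C) +
    (a x * diff_quot i b x h : C) @[h --> 0^'] --> 1 *: (a' * b x : C) + (a x * b' : C).
  exact: cvg_lin h1 h2.
rewrite scale1r; apply: cvg_trans; apply: near_eq_cvg; apply: nearW => h.
rewrite scale1r !diff_quotR.
by rewrite mulrCA -mulrA -mulrDr mulrBl mulrBr; congr (_ * _); ring.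
Qed.

(** Continuity of the partial derivatives of F makes the error in c1_estimate
    small compared with the increment of theta. *)
Lemma chain_rule m k i (F : 'rV[R]_m -> C) (G : 'I_m -> 'rV[R]_m -> C)
    (theta : 'rV[R]_k -> 'rV[R]_m) (theta' : 'I_m -> C) (y : 'rV[R]_k) :
  (\forall x \near theta y, forall j, diff_quot j F x h @[h --> 0^'] --> G j x) ->
  (forall j, {for theta y, continuous (G j)}) ->
  (forall j, diff_quot i (fun z => (theta z ord0 j)%:C : C) y h @[h --> 0^'] -->
     theta' j) ->
  diff_quot i (F \o theta) y h @[h --> 0^'] -->
    \sum_j theta' j * G j (theta y).
Proof.
move=> dF cG dtheta; apply/cvg_cmodP => e e0.
pose M := \sum_j (cmod (theta' j) + 1); pose N := \sum_j cmod (G j (theta y)).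
have M0 : 0 <= M by apply: sumr_ge0 => j _; rewrite addr_ge0 ?cmod_ge0.
have N0 : 0 <= N by apply: sumr_ge0 => j _; rewrite cmod_ge0.
pose r := e / (2 * M + N + 1).
have D0 : 0 < 2 * M + N + 1 by rewrite ltr_wpDl// addr_ge0// mulr_ge0.
have r0 : 0 < r by rewrite divr_gt0.
have [d d0 dbox] : exists2 d, 0 < d & forall x, box (theta y) d x -> forall j,
    diff_quot j F x h @[h --> 0^'] --> G j x /\
      cmod (G j x - G j (theta y)) <= r.
  have cG' : \forall x \near theta y, forall j, cmod (G j x - G j (theta y)) < r.
    apply: (@filter_forall _ _ (fun j x => cmod (G j x - G j (theta y)) < r)
      (nbhs (theta y)) (nbhs_filter _)) => j.
    exact: (@cvg_cmod_lt R _ (nbhs (theta y)) _ _ _ _ (cG j) r0).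
  have [d d0 dA] := nbhs_boxP (filterI dF cG'); exists d => // x /dA[h1 h2] j.
  by split; [exact: h1|exact/ltW/h2].
pose q j h := diff_quot i (fun z => (theta z ord0 j)%:C : C) y h.
pose kk h := theta (y + h *: delta_mx ord0 i) - theta y.
have near_kk : \forall h \near (0 : R)^', forall j, `|kk h ord0 j| < d.
  apply: (@filter_forall _ _ (fun j h => `|kk h ord0 j| < d)) => j.
  apply: filterS (cvg_cmod_lt (diff_quot_line_cvg (dtheta j)) d0) => h.
  by rewrite -rmorphB cmodR !mxE.
have r1 : 0 < Num.min r 1 by rewrite lt_min r0 ltr01.
have near_q : \forall h \near (0 : R)^', forall j,
    cmod (q j h - theta' j) < Num.min r 1.
  apply: (@filter_forall _ _ (fun j h => cmod (q j h - theta' j) < Num.min r 1)) => j.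
  exact: (cvg_cmod_lt (dtheta j) r1).
have nz : \forall h \near (0 : R)^', h != 0 by exact: nbhs_dnbhs_neq.
apply: (filterS3 _ _ near_kk near_q nz) => h kd qd h0.
have kq j : (kk h ord0 j)%:C = h%:C * q j h.
  rewrite /q diff_quotR mulrA -rmorphM /= divff// mul1r -rmorphB.
  by congr (_ %:C); rewrite !mxE.
have dE : diff_quot i (F \o theta) y h =
    h^-1%:C * (F (theta y + kk h) - F (theta y)).
  by rewrite diff_quotR /= /kk [theta y + _]addrC subrK.
have hc : h^-1%:C * h%:C = 1 :> R[i] by rewrite -rmorphM /= mulVf.
have est := @c1_estimate R m F (theta y) (kk h) G (fun j => G j (theta y)) d r
  (fun x j bx => dbox x bx j) kd.
have step1 : cmod (diff_quot i (F \o theta) y h - \sum_j q j h * G j (theta y))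
    <= 2 * r * M.
  have -> : diff_quot i (F \o theta) y h - \sum_j q j h * G j (theta y) =
     h^-1%:C * (F (theta y + kk h) - F (theta y) -
       \sum_j (kk h ord0 j)%:C * G j (theta y)).
    rewrite dE [RHS]mulrBr mulr_sumr; congr (_ - _); apply: eq_bigr => j _.
    by rewrite kq !mulrA hc mul1r.
  rewrite cmodM cmodR; apply: (le_trans (ler_wpM2l (normr_ge0 _) est)).
  rewrite mulrCA; apply: ler_wpM2l; first by rewrite mulr_ge0// ltW.
  rewrite mulr_sumr; apply: ler_sum => j _.
  rewrite -(cmodR (kk h ord0 j)) kq cmodM cmodR mulrA -normrM mulVf// normr1 mul1r.
  rewrite -[q j h](subrK (theta' j)) addrC (le_trans (cmodD _ _))// lerD2l.
  by rewrite ltW// (lt_le_trans (qd j))// ge_min lexx orbT.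
have step2 : cmod (\sum_j q j h * G j (theta y) - \sum_j theta' j * G j (theta y))
    <= r * N.
  rewrite -sumrB (le_trans (cmod_sum _ _))// mulr_sumr; apply: ler_sum => j _.
  rewrite -mulrBl cmodM ler_wpM2r ?cmod_ge0// ltW// (lt_le_trans (qd j))//.
  by rewrite ge_min lexx.
rewrite -[X in cmod X](subrKA (\sum_j q j h * G j (theta y))).
apply: (le_lt_trans (cmodD _ _)); apply: (le_lt_trans (lerD step1 step2)).
have -> : e = r * (2 * M + N + 1) by rewrite /r divfK// gt_eqF.
by rewrite !mulrDr mulr1 mulrA [r * 2]mulrC ltrDl.
Qed.

Section products.
Context (n : nat) (U : set 'rV[R]_n) (Uo : open U).

Lemma smooth_on_prod_sum (I : finType) (a b : I -> 'rV[R]_n -> C) :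
  (forall k, smooth_on U (a k)) -> (forall k, smooth_on U (b k)) ->
  smooth_on U (fun y => \sum_k a k y * b k y : C).
Proof.
move=> sa sb.
apply: (@smooth_on_coind _ _ C U (fun f => exists (I : finType) (a b : I -> 'rV[R]_n -> C),
  [/\ forall k, smooth_on U (a k), forall k, smooth_on U (b k) &
      f = (fun y => \sum_k a k y * b k y)])) => //; last by exists I, a, b.
move=> {I a b sa sb} _ [I [a [b [sa sb ->]]]]; split => [x Ux|i].
  apply: (@cvg_sum_lcs R C _ (nbhs x) _) => k; apply: (@cvg_mulC _ (nbhs x) _).
    exact: (smooth_on_continuous (sa k)).
  exact: (smooth_on_continuous (sb k)).
exists (fun y => \sum_k (partial i (a k) y * b k y + a k y * partial i (b k) y)).
  exists (I + I)%type, (fun k => match k with inl k => partial i (a k) | inr k => a k end),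
    (fun k => match k with inl k => b k | inr k => partial i (b k) end).
  split=> [[] k|[] k|]; try exact: sa; try exact: sb.
  - exact: (smooth_on_partials [:: i] (sa k)).
  - exact: (smooth_on_partials [:: i] (sb k)).
  by apply/funext => y; rewrite big_sumType /= big_split.
move=> x /[!inE] Ux; apply: diff_quot_sum => k.
have /= da := smooth_on_cvg [::] i (sa k) Ux.
have /= db := smooth_on_cvg [::] i (sb k) Ux.
exact: product_rule da db.
Qed.

Lemma smooth_on_mul (a b : 'rV[R]_n -> C) :
  smooth_on U a -> smooth_on U b -> smooth_on U (fun y => a y * b y : C).
Proof.
move=> sa sb; have := @smooth_on_prod_sum 'I_1 (fun=> a) (fun=> b) (fun=> sa) (fun=> sb).
by apply: smooth_on_eq => // y _; rewrite big_ord1.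
Qed.

Lemma smooth_on_cst (c : C) : smooth_on U (fun=> c).
Proof.
apply: (@smooth_on_coind _ _ C U (fun f => exists c : C, f = fun=> c)) => //; last by exists c.
move=> _ [d ->]; split => [x _|i].
  exact: (@cvg_cst C d _ (nbhs x) (nbhs_filter x)).
exists (fun=> 0); first by exists 0.
move=> x _; rewrite /diff_quot; under eq_fun do rewrite subrr scaler0.
exact: cvg_cst.
Qed.

End products.

End chain_rule.

Section composition.
Context (R : realType) (m k : nat).
Local Notation C := (R[i]^o).
Variables (A : set 'rV[R]_k) (U : set 'rV[R]_m) (theta : 'rV[R]_k -> 'rV[R]_m).
Hypotheses (Ao : open A) (Uo : open U) (thetaU : {homo theta : y / A y >-> U y})
  (sth : smooth_map_on A theta).

Lemma smooth_map_continuous : {in A, continuous theta}.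
Proof.
move=> y /[!inE] Ay N /nbhs_boxP[d d0 dN].
have near_d : \forall z \near y, forall j, `|theta z ord0 j - theta y ord0 j| < d.
  apply: (@filter_forall _ _ (fun j z => `|theta z ord0 j - theta y ord0 j| < d)
    (nbhs y) (nbhs_filter _)) => j.
  have cj := smooth_on_continuous (sth j) (mem_set Ay).
  apply: filterS (@cvg_cmod_lt R _ (nbhs y) (nbhs_filter y) _ _ _ cj d0) => z.
  by rewrite -rmorphB cmodR.
by apply: filterS near_d => z zd; exact: dN.
Qed.

(** The shape of a partial derivative of F o theta.  The coefficients do not
    depend on F, which makes the estimates below uniform in F. *)
Definition jet_combination (I : finType) (a : I -> 'rV[R]_k -> C)
    (t : I -> seq 'I_m) (F : 'rV[R]_m -> C) (y : 'rV[R]_k) : C :=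
  \sum_p a p y * partials (V := C) (t p) F (theta y).

Lemma partials_theta_continuous F s : smooth_on (V := C) U F ->
  {in A, continuous (fun y => partials s F (theta y))}.
Proof.
move=> sF y /[!inE] Ay.
apply: (@continuous_comp _ _ _ theta (partials s F)).
  exact: (smooth_map_continuous (mem_set Ay)).
exact: ((sF s).1 _ (mem_set (thetaU Ay))).
Qed.

Lemma jet_combination_continuous I a t F : (forall p, smooth_on (V := C) A (a p)) ->
  smooth_on (V := C) U F -> {in A, continuous (@jet_combination I a t F)}.
Proof.
move=> sa sF y Ay; apply: (@cvg_sum_lcs R C _ (nbhs y) _) => p.
apply: (@cvg_mulC R _ (nbhs y) _).
  exact: (smooth_on_continuous (sa p) Ay).
exact: (@partials_theta_continuous F (t p) sF y Ay).
Qed.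

Lemma jet_combination_derive (I : finType) (a : I -> 'rV[R]_k -> C)
    (t : I -> seq 'I_m) (i : 'I_k) :
  (forall p, smooth_on (V := C) A (a p)) ->
  exists (J : finType) (b : J -> 'rV[R]_k -> C) (u : J -> seq 'I_m),
  (forall p, smooth_on (V := C) A (b p)) /\
  forall F, smooth_on (V := C) U F -> forall y, A y ->
    diff_quot (V := C) i (jet_combination a t F) y h @[h --> 0^'] -->
      jet_combination b u F y.
Proof.
move=> sa; pose th j (y : 'rV[R]_k) := (theta y ord0 j)%:C : C.
exists (I + I * 'I_m)%type,
  (fun p => match p with inl p => partial i (a p)
            | inr (p, j) => fun y => a p y * partial i (th j) y end),
  (fun p => match p with inl p => t p | inr (p, j) => j :: t p end).
split=> [[p|[p j]]|F sF y Ay].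
- exact: (smooth_on_partials [:: i] (sa p)).
- apply: smooth_on_mul => //; exact: (smooth_on_partials [:: i] (sth j)).
have -> : jet_combination
    (fun p : I + I * 'I_m => match p with inl p => partial i (a p)
            | inr (p, j) => fun y => a p y * partial i (th j) y end)
    (fun p => match p with inl p => t p | inr (p, j) => j :: t p end) F y =
    \sum_p (partial i (a p) y * partials (t p) F (theta y) +
      a p y * \sum_j partial i (th j) y * partials (j :: t p) F (theta y)).
  rewrite /jet_combination big_sumType /= big_split; congr (_ + _).
  under [RHS]eq_bigr do rewrite mulr_sumr.
  by rewrite pair_bigA; apply: eq_bigr => -[p j] _ /=; rewrite mulrA.
apply: (@diff_quot_sum R k C I i (fun p y => a p y * partials (t p) F (theta y))) => p.
have /= da := smooth_on_cvg [::] i (sa p) Ay.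
apply: product_rule da _.
apply: (@chain_rule R m k i (partials (t p) F) (fun j => partials (j :: t p) F) theta
  (fun j => partial i (th j) y)).
- have nU : nbhs (theta y) U by apply: open_nbhs_nbhs; split => //; exact: thetaU.
  by apply: filterS nU => x Ux j; exact: (smooth_on_cvg (t p) j sF Ux).
- by move=> j; exact: ((sF (j :: t p)).1 _ (mem_set (thetaU Ay))).
- by move=> j; exact: (smooth_on_cvg [::] i (sth j) Ay).
Qed.

Lemma smooth_on_jet_combination I a t F : (forall p, smooth_on (V := C) A (a p)) ->
  smooth_on (V := C) U F -> smooth_on (V := C) A (@jet_combination I a t F).
Proof.
move=> sa sF; apply: (@smooth_on_coind _ _ C A (fun f => exists I a t,
  (forall p, smooth_on (V := C) A (a p)) /\ f = @jet_combination I a t F)) => //; last first.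
  by exists I, a, t.
move=> _ {I a t sa} [I [a [t [sa ->]]]]; split.
  exact: jet_combination_continuous.
move=> i; have [J [b [u [sb dab]]]] := @jet_combination_derive I a t i sa.
exists (jet_combination b u F); first by exists J, b, u.
by move=> y /[!inE] Ay; exact: dab.
Qed.

Let comp_jet F : F \o theta = jet_combination (fun _ : 'I_1 => fun=> 1 : C) (fun=> [::]) F.
Proof. by apply/funext => y; rewrite /jet_combination big_ord1 mul1r. Qed.

Lemma smooth_on_comp F : smooth_on (V := C) U F -> smooth_on (V := C) A (F \o theta).
Proof.
move=> sF; rewrite comp_jet; apply: smooth_on_jet_combination => // p.
exact: smooth_on_cst.
Qed.

(** Faa di Bruno's formula, without its coefficients. *)
Lemma partials_comp s :
  exists (I : finType) (a : I -> 'rV[R]_k -> C) (t : I -> seq 'I_m),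
  (forall p, smooth_on (V := C) A (a p)) /\
  forall F, smooth_on (V := C) U F ->
    {in A, partials (V := C) s (F \o theta) =1 jet_combination a t F}.
Proof.
elim: s => [|i s [I [a [t [sa sE]]]]].
  exists 'I_1, (fun _ => fun=> 1), (fun=> [::]); split => [_|F sF y _].
    exact: smooth_on_cst.
  by rewrite comp_jet.
have [J [b [u [sb dab]]]] := @jet_combination_derive I a t i sa.
exists J, b, u; split => // F sF y /[!inE] Ay /=; apply: partialE.
apply: (diff_quot_cvg_eq Ao Ay _ (dab F sF y Ay)) => z Az.
by rewrite (sE F sF).
Qed.

End composition.

(** * Jets and the topology of the space of smooth functions *)

Section jets.
Context (R : realType) (n : nat) (G : lieGroupType R n).

(** A chart, a multi-index and a point.  Indexing all the derivatives at all the
    points by one set makes a smooth function on G a function on that set. *)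
Definition jet := (chart R n G * seq 'I_n * 'rV[R]_n)%type.

Definition jet_eval (V : lcsType R[i]) (f : G -> V) (j : jet) : V :=
  partials j.1.2 (f \o chart_inv j.1.1) j.2.

Definition jet_piece c s (K : set 'rV[R]_n) : set jet :=
  [set j | j.1 = (c, s) /\ K j.2].

(** The index sets of the seminorms that define the topology of E(G). *)
Inductive compact_jets : set jet -> Prop :=
| compact_jets_piece c s K : atlas G c -> compact K -> K `<=` chart_img c ->
    compact_jets (jet_piece c s K)
| compact_jets0 : compact_jets set0
| compact_jetsU J1 J2 : compact_jets J1 -> compact_jets J2 ->
    compact_jets (J1 `|` J2).

Lemma compact_jetsP J j : compact_jets J -> J j ->
  atlas G j.1.1 /\ chart_img j.1.1 j.2.
Proof.
move=> cJ; elim: cJ j => [c s K cG Kc Kimg [cs x] [/= -> Kx]|//|].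
  by split => //; exact: Kimg.
by move=> J1 J2 _ IH1 _ IH2 j [/IH1|/IH2].
Qed.

Section smooth_functions.
Context (V : lcsType R[i]).
Implicit Types (f g : smooth_space G V).

Lemma smooth_spaceP f : smooth f.
Proof. exact/asboolP/(smooth_funP f). Qed.

Lemma jet_eval_linear (a : R[i]) f g j : atlas G j.1.1 -> chart_img j.1.1 j.2 ->
  jet_eval (a *: f + g) j = a *: jet_eval f j + jet_eval g j.
Proof.
case: j => [[c s] x] /= cG cx; rewrite /jet_eval /=.
by apply: (partials_lin a s (@chart_img_open _ _ _ c)) cx; exact: smooth_spaceP.
Qed.

Lemma jet_evalB f g j : atlas G j.1.1 -> chart_img j.1.1 j.2 ->
  jet_eval (g - f) j = jet_eval g j - jet_eval f j.
Proof.
by move=> cG cx; rewrite addrC -scaleN1r jet_eval_linear// scaleN1r addrC.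
Qed.

Lemma jet_evalZ (a : R[i]) f j : atlas G j.1.1 -> chart_img j.1.1 j.2 ->
  jet_eval (a *: f) j = a *: jet_eval f j.
Proof.
move=> jG jc; have z : jet_eval (0 : smooth_space G V) j = 0.
  by rewrite -(subrr f) jet_evalB// subrr.
by rewrite -[a *: f]addr0 jet_eval_linear// z addr0.
Qed.

Lemma near_jets f J (p : V -> R) (e : R) : compact_jets J -> cseminorm p -> 0 < e ->
  nbhs f [set g : smooth_space G V | forall j, J j ->
    p (jet_eval g j - jet_eval f j) < e].
Proof.
move=> cJ cp e0; elim: cJ => [c s K cG Kc Kimg||J1 J2 _ IH1 _ IH2].
- pose i : set_type (atlas G) * seq 'I_n := (exist _ c (mem_set cG), s).
  pose D (j : set_type (atlas G) * seq 'I_n) : topologicalType :=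
    {family compacts_in (chart_img (val j.1)), 'rV[R]_n -> V}.
  have h1 := @initial_continuous _ _ (@derivatives R n G V) f.
  have h2 := @proj_continuous _ D i (derivatives f).
  have /fam_cvgP h3 : {family compacts_in (chart_img c), derivatives k i @[k --> f]
      --> derivatives f i}.
    exact: (@cvg_comp _ _ _ _ _ _ _ _ h1 h2).
  have /= h4 := h3 (@fmap_filter _ _ _ (nbhs f) (nbhs_filter f)) K (conj Kc Kimg).
  have /h4 nf : nbhs (derivatives f i : {uniform` K -> V})
      [set h | forall y, K y -> p (h y - derivatives f i y) < e].
    apply/uniform_nbhs; exists [set z : V * V | p (z.2 - z.1) < e]; split => //.
    exact: (entourage_inv (cseminorm_entourage cp e0)).
  have {}nf : nbhs f [set g : smooth_space G V |
      forall y, K y -> p (derivatives g i y - derivatives f i y) < e] by exact: nf.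
  by apply: filterS nf => g gK [[c' s'] x] [/= [-> ->] Kx]; exact: gK.
- apply: (@filterS _ _ (nbhs_filter f) setT) => [g _ j []|].
  exact: (@filterT _ _ (nbhs_filter f)).
- apply: (@filterS2 _ _ (nbhs_filter f) _ _ _ _ IH1 IH2) => g h1 h2 j.
  by move=> [/h1|/h2].
Qed.

Lemma cvg_jets (F : set_system (smooth_space G V)) (FF : Filter F) f :
  (forall J p, compact_jets J -> cseminorm p ->
    F [set g | forall j, J j -> p (jet_eval g j - jet_eval f j) < 1]) ->
  F --> f.
Proof.
move=> Fj; have dF : derivatives g @[g --> F] --> derivatives f.
  apply/cvg_sup => -[c s] A /= [_ [[B Bo <-] Bf BA]].
  have fam : {family compacts_in (chart_img (val c)),
      (fun g : smooth_space G V => derivatives g (c, s)) g @[g --> F]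
        --> derivatives f (c, s)}.
    apply/fam_cvgP => K [Kc Kimg] W /uniform_nbhs[E [/entourage_cseminorm[p cp pE] EW]].
    have cG : atlas G (val c) by exact: set_mem (valP c).
    have Fx := Fj _ p (@compact_jets_piece (val c) s K cG Kc Kimg) cp.
    change (F [set g : smooth_space G V | W (derivatives g (c, s))]).
    apply: filterS Fx => g gK; apply: EW => y Ky; apply: pE.
    by rewrite -opprB (seminormN _ cp.1); exact: (gK (val c, s, y)).
  have nB : nbhs (derivatives f (c, s)) B by apply: open_nbhs_nbhs; split.
  change (F [set g : smooth_space G V | A (derivatives g)]).
  have FB : F [set g : smooth_space G V | B (derivatives g (c, s))] by exact: (fam _ nB).
  by apply: filterS FB => g Bg; exact: BA.
move=> A /= [_ [[B Bo <-] Bf BA]].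
have nB : nbhs (derivatives f) B by apply: open_nbhs_nbhs; split.
have FB : F [set g : smooth_space G V | B (derivatives g)] by exact: (dF _ nB).
by apply: filterS FB => g Bg; exact: BA.
Qed.

Lemma jet_bounded f J (p : V -> R) : compact_jets J -> cseminorm p ->
  exists M : R, forall j, J j -> p (jet_eval f j) <= M.
Proof.
move=> cJ cp; elim: cJ => [c s K cG Kc Kimg||J1 J2 _ [M1 h1] _ [M2 h2]]; last first.
- exists (Num.max M1 M2) => j [/h1|/h2] h; rewrite le_max h ?orbT//.
- by exists 0.
have sf := smooth_spaceP f cG.
have /compact_near_coveringP Knc := Kc.
have : \forall M \near +oo_R, K `<=` (fun x => p (jet_eval f (c, s, x)) <= M).
  apply: Knc => x Kx; pose y0 := jet_eval f (c, s, x).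
  have cf : {for x, continuous (partials s (f \o chart_inv c))}.
    exact: ((sf s).1 _ (mem_set (Kimg x Kx))).
  have n1 : \forall y \near x, p (jet_eval f (c, s, y) - y0) < 1.
    exact: (@cvg_cseminorm_lt _ _ _ _ (nbhs_filter x) _ _ _ _ cf cp ltr01).
  exists ([set y | p (jet_eval f (c, s, y) - y0) < 1], [set M | 1 + p y0 <= M]).
    by split => //=; apply: nbhs_pinfty_ge; exact: num_real.
  move=> [y M] /= [py]; apply: le_trans; rewrite -[jet_eval f _](subrK y0).
  by rewrite (le_trans (cp.1.1 _ _))// lerD2r ltW.
move=> [M [_ hM]]; exists (M + 1) => -[[c' s'] x] [/= [-> ->] Kx].
by apply: hM => //; rewrite ltrDl.
Qed.

End smooth_functions.

End jets.

(** * Distributions as functionals of jets *)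

(** This replaces the extraction of a finite subcover, and the choices that go
    with it, in most compactness arguments. *)
Lemma compact_ind (T : topologicalType) (K : set T) (P : set T -> Prop) :
  compact K -> P set0 -> (forall A B, A `<=` B -> P B -> P A) ->
  (forall A B, P A -> P B -> P (A `|` B)) ->
  (forall x, K x -> exists2 N, nbhs x N & P N) -> P K.
Proof.
move=> /compact_near_coveringP Kc P0 Psub PU Ploc.
pose F := filter_from P (fun A => [set B | A `<=` B]).
have FF : Filter F.
  apply: filter_from_filter; first by exists set0.
  move=> A B PA PB; exists (A `|` B); first exact: PU.
  by move=> D /= ABD; split => x ?; apply: ABD; [left|right].
have [|A PA KA] := Kc _ F (fun B x => B x) FF; last first.
  by apply: Psub PA; apply: KA.
move=> x /Ploc[N nN PN]; exists (N, [set B | N `<=` B]).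
  by split => //=; exists N.
by move=> [y B] /= [Ny NB]; exact: NB.
Qed.

Section bounded_functions.
Context (R : realType) (T : Type).
Local Notation C := (R[i]^o).

Definition bounded_pred : {pred T -> C} :=
  fun u => `[< exists M : R, forall t, cmod (u t) <= M >].

Lemma bounded_submod_closed : submod_closed bounded_pred.
Proof.
split=> [|a u v /asboolP[M uM] /asboolP[N vN]]; apply/asboolP.
  by exists 0 => t; rewrite cmod0.
exists (cmod a * M + N) => t; apply: (le_trans (cmodD _ _)).
by rewrite cmodM lerD// ler_wpM2l ?cmod_ge0.
Qed.

HB.instance Definition _ :=
  GRing.isSubmodClosed.Build _ _ bounded_pred bounded_submod_closed.

Record bfun := Bfun { bfun_val :> T -> C ; bfunP : bfun_val \in bounded_pred }.

HB.instance Definition _ := [isSub for bfun_val].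
HB.instance Definition _ := [Choice of bfun by <:].
HB.instance Definition _ := [SubChoice_isSubLmodule of bfun by <:].

(* adding 0 to the values makes the supremum meaningful for T empty *)
Definition sup_norm (u : bfun) : R := sup [set r | r = 0 \/ exists t, r = cmod (u t)].

Let bfun_bounded (u : bfun) : has_sup [set r | r = 0 \/ exists t, r = cmod (u t)].
Proof.
split; first by exists 0; left.
have /asboolP[M uM] := bfunP u; exists (Num.max 0 M) => r [->|[t ->]].
  by rewrite le_max lexx.
by rewrite le_max uM orbT.
Qed.

Lemma sup_norm_ge (u : bfun) t : cmod (u t) <= sup_norm u.
Proof. by apply: sup_upper_bound; [exact: bfun_bounded|right; exists t]. Qed.

Lemma sup_norm_le (u : bfun) (M : R) : 0 <= M ->
  (forall t, cmod (u t) <= M) -> sup_norm u <= M.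
Proof.
by move=> M0 uM; apply: ge_sup; [exact: (bfun_bounded u).1|move=> r [->|[t ->]]].
Qed.

Lemma sup_norm_ge0 (u : bfun) : 0 <= sup_norm u.
Proof. by apply: sup_upper_bound; [exact: bfun_bounded|left]. Qed.

Lemma sup_norm_seminorm : seminorm sup_norm.
Proof.
have le a (u : bfun) : sup_norm (a *: u) <= cmod a * sup_norm u.
  apply: sup_norm_le => [|t]; first by rewrite mulr_ge0 ?cmod_ge0 ?sup_norm_ge0.
  apply: (@le_trans _ _ (cmod a * cmod (u t))); first by rewrite -cmodM.
  by rewrite ler_wpM2l ?cmod_ge0// sup_norm_ge.
split => [u v|a u].
  apply: sup_norm_le => [|t]; first by rewrite addr_ge0 ?sup_norm_ge0.
  by apply: (le_trans (cmodD _ _)); rewrite lerD ?sup_norm_ge.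
apply/eqP; rewrite eq_le le /=.
have [->|a0] := eqVneq a 0; first by rewrite cmod0 mul0r sup_norm_ge0.
have ca := cmod_gt0 a0.
have := le a^-1 (a *: u).
by rewrite scalerA mulVf// scale1r cmodV mulrC ler_pdivlMr// mulrC.
Qed.

End bounded_functions.

Section jet_functionals.
Context (R : realType) (n : nat) (G : lieGroupType R n).
Local Notation C := (R[i]^o).
Local Notation jet := (jet G).

Definition bounded_on (J : set jet) (u : jet -> C) :=
  exists M : R, forall j, J j -> cmod (u j) <= M.

Definition jet_bound (J : set jet) (K : R) (D : smooth_space G C -> C) :=
  forall (f : smooth_space G C) (M : R), 0 <= M ->
    (forall j, J j -> cmod (jet_eval f j) <= M) -> cmod (D f) <= K * M.

(** The sets of functions with small jets generate a filter that converges to 0,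
    so D is small on one of these sets; the bound follows by homogeneity. *)
Lemma dist_bound (D : cs_distribution G) :
  exists J K, [/\ compact_jets J, 0 <= K & jet_bound J K D].
Proof.
have [Dl Dc] := clinP D.
have D0 : D 0 = 0 by have := Dl (-1) 0 0; rewrite scaler0 addr0 scaleN1r addNr.
have DZ a f : D (a *: f) = a * D f by rewrite -[a *: f]addr0 Dl D0 addr0.
pose N (Je : set jet * R) := [set f : smooth_space G C | forall j, Je.1 j ->
  cmod (jet_eval f j) < Je.2].
pose F := filter_from [set Je : set jet * R | compact_jets Je.1 /\ 0 < Je.2] N.
have FF : Filter F.
  apply: filter_from_filter; first by exists (set0, 1); split => //; exact: compact_jets0.
  move=> [J1 e1] [J2 e2] [/= cJ1 p1] [/= cJ2 p2].
  exists (J1 `|` J2, Num.min e1 e2); first by split; [exact: compact_jetsU|rewrite /= lt_min p1].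
  move=> f Nf; split => j Jj /=; apply: (lt_le_trans (Nf j _)) => /=; rewrite ?ge_min ?lexx ?orbT//.
    by left.
  by right.
have F0 : F --> (0 : smooth_space G C).
  apply: cvg_jets => J p cJ [sp np].
  have pE z : p z = cmod z * p 1 by rewrite -sp.2 /= /GRing.scale /= mulr1.
  have p10 : 0 < p 1 + 1 by rewrite ltr_wpDl// seminorm_ge0.
  exists (J, (p 1 + 1)^-1); first by split => //=; rewrite invr_gt0.
  move=> f Nf j Jj; have [jG jc] := compact_jetsP cJ Jj.
  rewrite -(jet_evalB 0 f jG jc) subr0 pE.
  apply: (@le_lt_trans _ _ (cmod (jet_eval f j) * (p 1 + 1))).
    by rewrite ler_wpM2l ?cmod_ge0// lerDl.
  by rewrite -ltr_pdivlMr// mul1r; exact: Nf.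
have : F [set f | cmod (D f) < 1].
  have := Dc 0; rewrite /continuous_at D0 => Dc0.
  have nb := nbhs_cmod (0 : C) ltr01.
  apply: filterS (F0 _ (Dc0 _ nb)) => f /=.
  by rewrite subr0.
move=> [[J e] [/= cJ e0] NJ]; exists J, (2 / e); split => //.
  by rewrite divr_ge0// ltW.
(* the case M = 0 is a limit of this one *)
have main (f : smooth_space G C) (M : R) : 0 < M -> (forall j, J j -> cmod (jet_eval f j) <= M) ->
    cmod (D f) <= 2 / e * M.
  move=> M0 fM; pose a : R := e / (2 * M).
  have a0 : 0 < a by rewrite divr_gt0// mulr_gt0.
  have : cmod (D (a%:C *: f)) < 1.
    apply: NJ => j Jj; have [jG jc] := compact_jetsP cJ Jj.
    rewrite jet_evalZ// cmodM cmodR gtr0_norm//.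
    apply: (@le_lt_trans _ _ (a * M)); first by rewrite ler_wpM2l ?fM// ltW.
    rewrite /a; have -> : e / (2 * M) * M = e / 2 by field; rewrite gt_eqF.
    by rewrite ltr_pdivrMr// ltr_pMr// ltr1n.
  rewrite DZ cmodM cmodR gtr0_norm// mulrC -ltr_pdivlMr// mul1r => /ltW.
  by rewrite /a invf_div (_ : 2 * M / e = 2 / e * M)// mulrAC.
move=> f M M0 fM; apply/ler_addgt0Pr => r r0.
have -> : 2 / e * M + r = 2 / e * (M + r * e / 2).
  by field; rewrite gt_eqF.
have r2 : 0 < r * e / 2 by rewrite divr_gt0// mulr_gt0.
apply: main => [|j Jj]; first by rewrite ltr_wpDl.
by rewrite (le_trans (fM j Jj))// lerDl ltW.
Qed.

(** A functional bounded by the jets over J is, by Hahn-Banach, a finitely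
    additive measure on J, applied to the jets. *)
Lemma jet_extension (J : set jet) (K : R) (D : smooth_space G C -> C) :
  (forall j, J j -> atlas G j.1.1 /\ chart_img j.1.1 j.2) ->
  (forall f, bounded_on J (jet_eval (f : smooth_space G C))) ->
  linear D -> 0 <= K -> jet_bound J K D ->
  exists L : (jet -> C) -> C,
  [/\ forall a u v, bounded_on J u -> bounded_on J v ->
        L (fun j => a * u j + v j) = a * L u + L v,
      forall f : smooth_space G C, L (jet_eval f) = D f &
      forall u M, 0 <= M -> (forall j, J j -> cmod (u j) <= M) ->
        cmod (L u) <= K * M].
Proof.
move=> Jv Jb Dl K0 DJ.
pose cut (u : jet -> C) : jet -> C := fun j => if `[< J j >] then u j else 0.
have cutP u : bounded_on J u -> cut u \in @bounded_pred R jet.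
  move=> [M uM]; apply/asboolP; exists (Num.max 0 M) => j; rewrite /cut.
  by case: asboolP => Jj; rewrite ?cmod0 le_max ?lexx ?uM ?orbT.
pose j0 (f : smooth_space G C) := Bfun (cutP _ (Jb f)).
have j0l : linear j0.
  move=> a f g; apply: val_inj; apply/funext => j /=; rewrite /cut !fctE /=.
  case: asboolP => Jj; first by have [h1 h2] := Jv j Jj; rewrite jet_eval_linear.
  by rewrite scaler0 addr0.
pose jl : {linear smooth_space G C -> bfun R jet} := HB.pack j0
  (GRing.isLinear.Build _ _ _ _ _ j0l).
have sK : seminorm (fun u : bfun R jet => K * sup_norm u).
  have [sD sZ] := @sup_norm_seminorm R jet.
  by split => [u v|a u]; [rewrite -mulrDr ler_wpM2l|rewrite sZ mulrCA].
have [||L [Ll LE Lp]] := @hahn_banach R (bfun R jet) _ jl D _ _ sK.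
- exact: Dl.
- move=> f; apply: (DJ f); first exact: sup_norm_ge0.
  move=> j Jj; have := sup_norm_ge (j0 f) j.
  by rewrite /= /cut asboolT.
pose toB u := if pselect (bounded_on J u) is left b then Bfun (cutP u b) else 0.
have toBE u (b : bounded_on J u) : toB u = Bfun (cutP u b).
  by rewrite /toB; case: pselect => // b'; apply: val_inj.
exists (fun u => L (toB u)); split => [a u v bu bv|f|u M M0 uM].
- have bs : bounded_on J (fun j => a * u j + v j).
    move: bu bv => [M uM] [N vN]; exists (cmod a * M + N) => j Jj.
    by rewrite (le_trans (cmodD _ _))// cmodM lerD ?vN// ler_wpM2l ?cmod_ge0 ?uM.
  rewrite (toBE _ bs) (toBE _ bu) (toBE _ bv) -Ll; congr L.
  apply: val_inj; apply/funext => j /=; rewrite /cut !fctE /=.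
  by case: asboolP => // _; rewrite scaler0 addr0.
- by rewrite (toBE _ (Jb f)) -LE.
- have bu : bounded_on J u by exists M.
  rewrite (toBE _ bu) (le_trans (Lp _))// ler_wpM2l// sup_norm_le// => j /=.
  by rewrite /cut; case: asboolP => [/uM//|_]; rewrite cmod0.
Qed.

Lemma functional_eq_on (J : set jet) (K : R) (L : (jet -> C) -> C) u v :
  (forall a u v, bounded_on J u -> bounded_on J v ->
     L (fun j => a * u j + v j) = a * L u + L v) ->
  (forall u M, 0 <= M -> (forall j, J j -> cmod (u j) <= M) ->
     cmod (L u) <= K * M) ->
  bounded_on J v -> (forall j, J j -> u j = v j) -> L u = L v.
Proof.
move=> Ll LK bv uv.
have bu : bounded_on J u by have [M vM] := bv; exists M => j Jj; rewrite uv// vM.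
have := Ll (-1) v u bv bu; rewrite (_ : L (fun j => _) = 0).
  by move/esym/eqP; rewrite mulN1r addrC subr_eq0 => /eqP.
apply: cmod_eq0; apply/eqP; rewrite eq_le cmod_ge0 andbT -(mulr0 K).
by apply: LK => // j Jj; rewrite uv// mulN1r addNr cmod0.
Qed.

Lemma jet_bound_continuous (J : set jet) (K : R) (D : smooth_space G C -> C) :
  compact_jets J -> 0 <= K -> linear D -> jet_bound J K D -> continuous D.
Proof.
move=> cJ K0 Dl DJ f.
apply: (@cvg_cmodP R _ (nbhs f) (nbhs_filter f) D (D f)).2 => e e0.
have K1 : 0 < K + 1 by rewrite ltr_wpDl.
have e1 : 0 < e / (K + 1) by rewrite divr_gt0.
apply: (@filterS _ _ (nbhs_filter f) _ _ _ (near_jets f cJ (cmod_cseminorm R) e1)).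
move=> g gf; have -> : D g - D f = D (g - f).
  by rewrite (_ : g - f = -1 *: f + g) ?Dl ?scaleN1r addrC.
apply: (@le_lt_trans _ _ (K * (e / (K + 1)))).
  apply: DJ => [|j Jj]; first exact: ltW.
  have [jG jc] := compact_jetsP cJ Jj.
  by rewrite jet_evalB// ltW// gf.
by rewrite mulrA ltr_pdivrMr// mulrC ltr_pM2l// ltrDl.
Qed.

(** L accepts every bounded function on J, not only the jets of smooth functions.
    A family of jets can therefore be differentiated under L with respect to a
    parameter without knowing that the derivatives are jets again. *)
Lemma dist_extension (D : cs_distribution G) : exists J K L,
  [/\ compact_jets J, 0 <= K,
      forall a u v, bounded_on J u -> bounded_on J v ->
        L (fun j : jet => a * u j + v j) = a * L u + L v,
      forall f : smooth_space G C, L (jet_eval f) = D f &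
      forall u M, 0 <= M -> (forall j, J j -> cmod (u j) <= M) ->
        cmod (L u) <= K * M].
Proof.
have [J [K [cJ K0 DJ]]] := dist_bound D.
have [Dl _] := clinP D.
have [|f0|L [Ll LE LK]] := @jet_extension J K D _ _ Dl K0 DJ.
- by move=> j Jj; exact: (compact_jetsP cJ).
- have [M fM] := jet_bounded f0 cJ (cmod_cseminorm R).
  by exists M.
by exists J, K, L.
Qed.

End jet_functionals.

(** * Distributions applied to vector-valued functions *)

Section clin_theory.
Context (K : numFieldType) (V W : preTopologicalLmodType K).
Variable (l : clin V W).

Lemma clinD x y : l (x + y) = l x + l y.
Proof. by have [ll _] := clinP l; rewrite -{1}[x]scale1r ll scale1r. Qed.

Lemma clin0 : l 0 = 0.
Proof. by apply: (@addrI _ (l 0)); rewrite -clinD !addr0. Qed.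

Lemma clinZ a x : l (a *: x) = a *: l x.
Proof. by have [ll _] := clinP l; rewrite -[a *: x]addr0 ll clin0 addr0. Qed.

Lemma clinB x y : l (x - y) = l x - l y.
Proof. by rewrite clinD -scaleN1r clinZ scaleN1r. Qed.

Lemma clin_sum (I : Type) (s : seq I) (F : I -> V) :
  l (\sum_(k <- s) F k) = \sum_(k <- s) l (F k).
Proof.
by elim/big_rec2: _ => [|k x y _ <-]; [exact: clin0|exact: clinD].
Qed.

Lemma clin_ext (l' : clin V W) : l =1 l' -> l = l'.
Proof. by move=> ll'; apply: val_inj; apply/funext. Qed.

End clin_theory.

Section composition_with_clin.
Context (R : realType) (V W : lcsType R[i]) (l : clin V W).

Lemma diff_quot_clin n (i : 'I_n) (f : 'rV[R]_n -> V) x (d : V) :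
  diff_quot i f x h @[h --> 0^'] --> d ->
  diff_quot i (l \o f) x h @[h --> 0^'] --> l d.
Proof.
move=> fd; have [_ lc] := clinP l.
have : l (diff_quot i f x h) @[h --> 0^'] --> l d by exact: (cvg_comp _ _ fd (lc d)).
apply: cvg_trans; apply: near_eq_cvg; apply: nearW => h.
by rewrite /diff_quot clinZ clinB.
Qed.

Lemma partials_clin n (U : set 'rV[R]_n) (f : 'rV[R]_n -> V) s : open U ->
  smooth_on U f -> {in U, forall x, partials s (l \o f) x = l (partials s f x)}.
Proof.
move=> Uo sf; elim: s => // i s IH x /[!inE] Ux /=; apply: partialE.
apply: (@diff_quot_cvg_eq _ _ _ U i (l \o partials s f)) => //.
  by move=> y /IH.
by apply: diff_quot_clin; exact: smooth_on_cvg.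
Qed.

Lemma smooth_on_clin n (U : set 'rV[R]_n) (f : 'rV[R]_n -> V) : open U ->
  smooth_on U f -> smooth_on U (l \o f).
Proof.
move=> Uo sf; apply: (@smooth_on_coind _ _ _ U (fun g => exists s, g = l \o partials s f)) => //.
  move=> _ [s ->]; split=> [x Ux|i].
    apply: continuous_comp; first exact: ((sf s).1 x Ux).
    by have [_ lc] := clinP l; exact: lc.
  exists (l \o partials (i :: s) f); first by exists (i :: s).
  by move=> x /[!inE] Ux; apply: diff_quot_clin; exact: smooth_on_cvg.
by exists [::].
Qed.

Context (n : nat) (G : lieGroupType R n).

Lemma smooth_clin (f : smooth_space G V) : (l \o f) \in @smooth_pred R n G W.
Proof.
apply/asboolP => c cG; have sf := smooth_spaceP f cG.
exact: (smooth_on_clin (@chart_img_open _ _ _ c) sf).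
Qed.

Definition clin_smooth (f : smooth_space G V) : smooth_space G W :=
  SmoothSpace (smooth_clin f).

Lemma jet_eval_clin (f : smooth_space G V) j : atlas G j.1.1 ->
  chart_img j.1.1 j.2 -> jet_eval (clin_smooth f) j = l (jet_eval f j).
Proof.
case: j => [[c s] x] /= cG cx; have sf := smooth_spaceP f cG.
exact: (partials_clin s (@chart_img_open _ _ _ c) sf (mem_set cx)).
Qed.

End composition_with_clin.

Section weak_integral.
Context (R : realType) (n : nat) (G : lieGroupType R n) (V : lcsType R[i]).
Hypothesis Vcomplete : complete_space V.
Local Notation C := (R[i]^o).
Local Notation jet := (jet G).
Local Notation dual := (clin V (C : tvsType R[i])).

(** The jets of f over J form a finite union of continuous images of compact
    sets. *)
Lemma jet_totally_bounded (f : smooth_space G V) (J : set jet) p :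
  compact_jets J -> cseminorm p ->
  exists s : seq V, forall j, J j -> exists2 v, v \in s & p (jet_eval f j - v) <= 1.
Proof.
move=> cJ cp; elim: cJ => [c s K cG Kc Kimg||J1 J2 _ [s1 h1] _ [s2 h2]]; last first.
- exists (s1 ++ s2) => j [/h1|/h2] [v vs pv]; exists v => //;
    by rewrite mem_cat vs ?orbT.
- by exists [::].
pose F x := jet_eval f (c, s, x).
suff [t ht] : exists t : seq V, forall x, K x -> exists2 v, v \in t & p (F x - v) <= 1.
  by exists t => -[[c' s'] x] [/= [-> ->] Kx]; exact: ht.
apply: (@compact_ind _ K (fun A => exists t : seq V, forall x, A x ->
  exists2 v, v \in t & p (F x - v) <= 1)) => //.
- by exists [::].
- by move=> A B AB [t ht]; exists t => x /AB; exact: ht.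
- move=> A B [t1 ht1] [t2 ht2]; exists (t1 ++ t2) => x [/ht1|/ht2] [v vs pv];
    by exists v => //; rewrite mem_cat vs ?orbT.
move=> x Kx; exists [set y | p (F y - F x) < 1]; last first.
  by exists [:: F x] => y /ltW; exists (F x) => //; rewrite inE.
have sf := smooth_spaceP f cG.
have cf : {for x, continuous (partials s (f \o chart_inv c))}.
  exact: ((sf s).1 _ (mem_set (Kimg x Kx))).
exact: (@cvg_cseminorm_lt _ _ _ _ (nbhs_filter x) _ _ _ _ cf cp ltr01).
Qed.

(** The integral of F against L, seen as a finitely additive measure on J, is the
    limit of sums of values of F times measures of sets, over finer and finer
    finite partitions of J.  That these sums are Cauchy is tested on functionals,
    where it is the bound of L; completeness then provides the limit. *)
Lemma weak_integral (J : set jet) (L : (jet -> C) -> C) (K : R) (F : jet -> V) :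
  (forall a u v, bounded_on J u -> bounded_on J v ->
     L (fun j => a * u j + v j) = a * L u + L v) ->
  (forall u M, 0 <= M -> (forall j, J j -> cmod (u j) <= M) ->
     cmod (L u) <= K * M) ->
  0 <= K -> (forall p, cseminorm p -> exists s : seq V, forall j, J j ->
     exists2 v, v \in s & p (F j - v) <= 1) ->
  exists w, forall l : dual, l w = L (fun j => l (F j)).
Proof.
move=> Ll LK K0 Ftb.
have dualp (l : dual) : cseminorm (fun x => cmod (l x)).
  exact: clin_cseminorm (cmod_cseminorm R).
have dB (l : dual) x y : cmod (l x - l y) = cmod (l (x - y)) by rewrite clinB.
have Fb (l : dual) : bounded_on J (fun j => l (F j)).
  have [s hs] := Ftb _ (dualp l).
  exists (1 + \sum_(v <- s) cmod (l v)) => j /hs[v vs lv].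
  rewrite -[F j](subrK v) clinD (le_trans (cmodD _ _))// lerD//.
  rewrite (big_rem v)//= lerDl; apply: sumr_ge0 => ? _; exact: cmod_ge0.
have b0 : bounded_on J (fun=> 0) by exists 0 => j _; rewrite cmod0.
have bD a u v : bounded_on J u -> bounded_on J v -> bounded_on J (fun j => a * u j + v j).
  move=> [M uM] [N vN]; exists (cmod a * M + N) => j Jj.
  by rewrite (le_trans (cmodD _ _))// cmodM lerD ?vN// ler_wpM2l ?cmod_ge0 ?uM.
have L0 : L (fun=> 0) = 0.
  apply: cmod_eq0; apply/eqP; rewrite eq_le cmod_ge0 andbT -(mulr0 K).
  by apply: LK => // j _; rewrite cmod0.
have LB u v : bounded_on J u -> bounded_on J v -> L (fun j => u j - v j) = L u - L v.
  move=> bu bv; have := Ll (-1) v u bv bu; rewrite mulN1r [RHS]addrC => <-.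
  by congr L; apply/funext => j; rewrite mulN1r addrC.
have Lsum (s : seq V) (c : V -> C) (u : V -> jet -> C) : (forall a, bounded_on J (u a)) ->
    bounded_on J (fun j => \sum_(a <- s) c a * u a j) /\
    L (fun j => \sum_(a <- s) c a * u a j) = \sum_(a <- s) c a * L (u a).
  move=> bu; elim: s => [|a s [bs IH]].
    by rewrite big_nil; under eq_fun do rewrite big_nil; rewrite L0.
  rewrite big_cons -IH; split; under eq_fun do rewrite big_cons; first exact: bD.
  exact: Ll.
(* the possible values of the integral up to an error measured by p *)
pose A p := [set w : V | forall (l : dual) (r : R), 0 < r ->
  (forall x, r * cmod (l x) <= p x) -> r * cmod (l w - L (fun j => l (F j))) <= K].
have A0 p : cseminorm p -> A p !=set0.
  move=> cp; have [s hs] := Ftb _ cp.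
  pose v0 j := if pselect (J j) is left Jj then s2val (cid2 (hs j Jj)) else 0.
  have v0P j : J j -> v0 j \in s /\ p (F j - v0 j) <= 1.
    by move=> Jj; rewrite /v0; case: pselect => // Jj'; case: cid2.
  pose one (a : V) : jet -> C := fun j => (v0 j == a)%:R.
  have oneb a : bounded_on J (one a).
    by exists 1 => j _; rewrite /one; case: eqP => _; rewrite ?cmod1 ?cmod0.
  (* v0 is a simple function that approximates F, and this is its integral *)
  exists (\sum_(a <- undup s) L (one a) *: a) => l r r0 lp.
  have [bs LE] := Lsum (undup s) l one oneb.
  have -> : l (\sum_(a <- undup s) L (one a) *: a) =
      L (fun j => \sum_(a <- undup s) l a * one a j).
    rewrite clin_sum LE; apply: eq_bigr => a _.
    by rewrite clinZ /GRing.scale /= mulrC.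
  rewrite -LB// mulrC -ler_pdivlMr//; apply: LK => [|j Jj]; first by rewrite invr_ge0 ltW.
  have [vs pv] := v0P j Jj.
  have -> : \sum_(a <- undup s) l a * one a j = l (v0 j).
    rewrite (bigD1_seq (v0 j)) ?mem_undup ?undup_uniq//= /one eqxx mulr1.
    by rewrite big1 ?addr0// => a; rewrite eq_sym => /negbTE ->; rewrite mulr0.
  rewrite cmodBC dB -[_^-1]mul1r ler_pdivlMr// mulrC.
  exact: le_trans (lp _) pv.
pose Fi := filter_from [set p | cseminorm p] A.
have FF : Filter Fi.
  apply: filter_from_filter.
    by exists (fun x => cmod ((0 : dual) x)); exact: dualp.
  move=> p q cp cq; exists (p \+ q); first exact: cseminormD.
  move=> w Aw; split=> l r r0 lp; apply: Aw => // x.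
    by rewrite (le_trans (lp x))//= lerDl seminorm_ge0//; case: cq.
  by rewrite (le_trans (lp x))//= lerDr seminorm_ge0//; case: cp.
have PF : ProperFilter Fi by apply: filter_from_proper => p; exact: A0.
have [|w Fw] := Vcomplete PF.
  move=> E /entourage_cseminorm[q cq qE]; pose M := 2 * K + 1.
  have M0 : 0 < M by rewrite ltr_wpDl// mulr_ge0.
  have cp := cseminormZ (ltW M0) cq.
  pose p := fun x => M * q x.
  exists (A p, A p); first by split; exists p.
  move=> [w w'] [/= Aw Aw']; apply: qE.
  have [l [lE lq]] := norming_functional (w - w') cq.
  have lp x : M * cmod (l x) <= p x by rewrite ler_pM2l.
  have := lerD (Aw l M M0 lp) (Aw' l M M0 lp).
  rewrite -mulrDr -ler_pdivlMl// => h.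
  have : q (w - w') <= M^-1 * (K + K).
    apply: le_trans h; rewrite -[q _]ger0_norm ?seminorm_ge0 ?cq.1//; last by case: cq.
    rewrite -cmodR -lE -dB [X in _ <= _ + X]cmodBC (le_trans _ (cmodD _ _))//.
    by rewrite subrKA.
  by move=> /le_lt_trans; apply; rewrite -mulr2n -mulr_natl ltr_pdivrMl// mulr1 /M ltrDl.
exists w => l; apply/eqP; rewrite -subr_eq0; apply/eqP/cmod_eq0.
apply/eqP; rewrite eq_le cmod_ge0 andbT; apply/ler_addgt0Pr => e e0; rewrite add0r.
pose M := 2 * (K + 1) / e.
have M0 : 0 < M by rewrite divr_gt0// mulr_gt0// ltr_wpDl.
have cp := cseminormZ (ltW M0) (dualp l).
have FA : Fi (A (fun x => M * cmod (l x))) by exists (fun x => M * cmod (l x)).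
have e2 : 0 < e / 2 by rewrite divr_gt0.
have [_ lc] := clinP l.
have nw : nbhs w [set x | cmod (l x - l w) < e / 2].
  exact: (@cvg_cmod_lt _ _ (nbhs w) (nbhs_filter w) _ _ _ (lc w) e2).
have [w' [Aw' lw']] := @filter_ex _ Fi PF _ (filterI FA (Fw _ nw)).
have := Aw' l M M0 (fun x => lexx _); rewrite -ler_pdivlMl// => h.
rewrite -[_ - _](subrKA (l w')) (le_trans (cmodD _ _))// (splitr e) lerD//.
  by rewrite cmodBC ltW.
have K1 : 0 < K + 1 by rewrite ltr_wpDl.
apply: (le_trans h); have -> : M^-1 * K = e / 2 * (K / (K + 1)).
  by rewrite /M; field; rewrite !gt_eqF.
by rewrite ler_piMr ?(ltW e2)// ler_pdivrMr// mul1r lerDl.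
Qed.

(** The integral of the jets of f; its value does not depend on the extension L
    because the functionals l separate points. *)
Lemma weak_pairing (D : cs_distribution G) (f : smooth_space G V) :
  exists w, forall l : dual, l w = D (clin_smooth l f).
Proof.
have [J [K [L [cJ K0 Ll LE LK]]]] := dist_extension D.
have [w wE] := weak_integral Ll LK K0 (fun p => jet_totally_bounded f cJ).
exists w => l; rewrite wE -LE; apply: (functional_eq_on Ll LK).
  by have [M vM] := jet_bounded (clin_smooth l f) cJ (cmod_cseminorm R); exists M.
by move=> j Jj; have [jG jc] := compact_jetsP cJ Jj; rewrite jet_eval_clin.
Qed.

End weak_integral.

(** * Smooth maps into the group *)

Lemma locally_compact_rV (R : realType) (n : nat) (U : set 'rV[R]_n) x :
  open U -> U x -> exists K, [/\ nbhs x K, compact K & K `<=` U].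
Proof.
move=> Uo Ux; have nU : nbhs x U by apply: open_nbhs_nbhs.
have [d d0 dU] := nbhs_boxP nU.
pose I j := `[x ord0 j - d / 2, x ord0 j + d / 2]%classic.
have d2 : 0 < d / 2 by rewrite divr_gt0.
exists [set y : 'rV[R]_n | forall j, I j (y ord0 j)]; split.
- apply: filterS (nbhs_box x d2) => y xy j; rewrite /I /= in_itv /=.
  have := xy j; rewrite ltr_norml => /andP[h1 h2].
  by rewrite lerBlDr -lerBlDl; apply/andP; split; lra.
- by apply: rV_compact => j; exact: segment_compact.
- move=> y yI; apply: dU => j; have := yI j; rewrite /I /= in_itv /= => /andP[h1 h2].
  have h : `|y ord0 j - x ord0 j| <= d / 2 by rewrite ler_norml; apply/andP; split; lra.
  by apply: (le_lt_trans h); rewrite ltr_pdivrMr// ltr_pMr// ltr1n.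
Qed.

Section smooth_parametrizations.
Context (R : realType) (n : nat) (G : lieGroupType R n).
Local Notation C := (R[i]^o).

(** Inverses of charts and the multiplication read in charts are both of this
    kind, so changes of charts and translations can be treated together. *)
Record smooth_param k (U : set 'rV[R]_k) (mu : 'rV[R]_k -> G) : Prop := {
  param_open : open U ;
  param_continuous : {in U, continuous mu} ;
  param_smooth_map : forall e, atlas G e ->
    smooth_map_on (U `&` mu @^-1` chart_dom e) (e \o mu)
}.

Section one_param.
Context (k : nat) (U : set 'rV[R]_k) (mu : 'rV[R]_k -> G).
Hypothesis sm : smooth_param U mu.

Let dom (e : chart R n G) := U `&` mu @^-1` chart_dom e.

Lemma param_preimage_open (A : set G) : open A -> open (U `&` mu @^-1` A).
Proof.
move=> Ao; rewrite openE => x [Ux Ax]; apply: filterI.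
  by apply: open_nbhs_nbhs; split => //; exact: param_open sm.
apply: (param_continuous sm (mem_set Ux)).
exact: open_nbhs_nbhs.
Qed.

Let dom_open e : open (dom e).
Proof. exact/param_preimage_open/chart_dom_open. Qed.

Let dom_img (e : chart R n G) : {homo e \o mu : y / dom e y >-> chart_img e y}.
Proof. by move=> y [_ dy]; exact: chart_fun_img. Qed.

Let through_chart (V : Type) (f : G -> V) (e : chart R n G) :
  {in dom e, (f \o chart_inv e) \o (e \o mu) =1 f \o mu}.
Proof. by move=> y /[!inE] -[_ dy] /=; rewrite chart_funK ?inE. Qed.

Lemma param_smooth (f : smooth_space G C) : smooth_on (V := C) U (f \o mu).
Proof.
apply: smooth_on_local => x Ux; have [e eG ex] := atlas_cover (mu x).
exists (dom e); split => //.
apply: (smooth_on_eq (@dom_open e) (@through_chart _ f e)).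
apply: (smooth_on_comp (@dom_open e) (@chart_img_open _ _ _ e) (@dom_img e)).
  exact: param_smooth_map.
exact: smooth_spaceP.
Qed.

(** The coefficients in the formula for the derivatives of f o mu are continuous,
    hence bounded near x, and independent of f. *)
Lemma param_jets_local s x (e : chart R n G) : U x -> atlas G e -> chart_dom e (mu x) ->
  exists (N : set 'rV[R]_k) (ts : seq (seq 'I_n)) (K : R),
  [/\ nbhs x N, N `<=` dom e, 0 <= K &
    forall (f : smooth_space G C) (M : R) y, N y ->
      (forall t, t \in ts -> cmod (jet_eval f (e, t, e (mu y))) <= M) ->
      cmod (partials (V := C) s (f \o mu) y) <= K * M].
Proof.
move=> Ux eG ex; have dx : dom e x by [].
have [I [a [t [sa aE]]]] := @partials_comp R n k (dom e) (chart_img e) (e \o mu)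
  (@dom_open e) (@chart_img_open _ _ _ e) (@dom_img e) (param_smooth_map sm eG) s.
have near_a : \forall y \near x, forall p, cmod (a p y - a p x) < 1.
  apply: (@filter_forall _ _ (fun p y => cmod (a p y - a p x) < 1)
    (nbhs x) (nbhs_filter _)) => p.
  exact: (@cvg_cmod_lt _ _ _ (nbhs_filter x) _ _ _
    (smooth_on_continuous (sa p) (mem_set dx)) ltr01).
exists ([set y | forall p, cmod (a p y - a p x) < 1] `&` dom e),
  [seq t p | p <- enum I], (\sum_p (cmod (a p x) + 1)); split.
- by apply: filterI => //; apply: open_nbhs_nbhs.
- by move=> y [].
- by apply: sumr_ge0 => p _; rewrite addr_ge0 ?cmod_ge0.
move=> f M y [ay dy] fM.
rewrite -(partials_eq s (@dom_open e) (@through_chart _ f e) (mem_set dy)).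
rewrite (aE (f \o chart_inv e)) ?inE//; last exact: smooth_spaceP.
rewrite /jet_combination (le_trans (cmod_sum _ _))// mulr_suml.
apply: ler_sum => p _; rewrite cmodM ler_pM ?cmod_ge0//.
  rewrite -[a p y](subrK (a p x)) addrC (le_trans (cmodD _ _))// lerD2l.
  exact/ltW/ay.
by apply: fM; apply/mapP; exists p => //; rewrite mem_enum.
Qed.

Lemma param_jets_compact s (K : set 'rV[R]_k) : compact K -> K `<=` U ->
  exists J L, [/\ compact_jets (G := G) J, 0 <= L &
    forall (f : smooth_space G C) (M : R) y, 0 <= M -> K y ->
      (forall j, J j -> cmod (jet_eval f j) <= M) ->
      cmod (partials (V := C) s (f \o mu) y) <= L * M].
Proof.
move=> Kc KU; apply: (@compact_ind _ K (fun A => exists J L,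
  [/\ compact_jets (G := G) J, 0 <= L &
    forall (f : smooth_space G C) (M : R) y, 0 <= M -> A y ->
      (forall j, J j -> cmod (jet_eval f j) <= M) ->
      cmod (partials (V := C) s (f \o mu) y) <= L * M])) => //.
- by exists set0, 0; split => //; exact: compact_jets0.
- move=> A B AB [J [L [cJ L0 h]]]; exists J, L; split => // f M y M0 /AB; exact: h.
- move=> A B [J [L [cJ L0 h]]] [J' [L' [cJ' L0' h']]].
  exists (J `|` J'), (L + L'); split; [exact: compact_jetsU|exact: addr_ge0|].
  move=> f M y M0 [Ay|By] fM.
    rewrite (le_trans (h f M y M0 Ay _))// => [j Jj|]; first by apply: fM; left.
    by rewrite ler_wpM2r// lerDl.
  rewrite (le_trans (h' f M y M0 By _))// => [j Jj|]; first by apply: fM; right.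
  by rewrite ler_wpM2r// lerDr.
move=> x Kx; have Ux := KU x Kx; have [e eG ex] := atlas_cover (mu x).
have [N [ts [L [nN Ndom L0 NL]]]] := param_jets_local s Ux eG ex.
have ix : chart_img e (e (mu x)) by exact: chart_fun_img.
have [K' [nK' cK' K'i]] := locally_compact_rV (@chart_img_open _ _ _ e) ix.
have cemu : {for x, continuous (e \o mu)}.
  apply: continuous_comp; first exact: (param_continuous sm (mem_set Ux)).
  exact: (chart_fun_continuous (mem_set ex)).
exists (N `&` (e \o mu) @^-1` K'); first by apply: filterI => //; exact: cemu.
exists (\big[setU/set0]_(t <- ts) jet_piece e t K'), L; split => //.
  elim/big_rec: _ => [|t J _ cJ]; first exact: compact_jets0.
  by apply: compact_jetsU => //; exact: compact_jets_piece.
move=> f M y M0 [Ny K'y] fM; apply: NL => // t tts; apply: fM.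
by rewrite -bigcup_seq; exists t => //; split.
Qed.

End one_param.

Lemma chart_inv_param c : atlas G c -> smooth_param (chart_img c) (chart_inv c).
Proof.
move=> cG; split; [exact: chart_img_open|exact: chart_inv_continuous|].
by move=> e eG; exact: atlas_compatible.
Qed.

End smooth_parametrizations.

(** * Convolution *)

Section coordinate_products.
Context (R : realType) (n m : nat).

Lemma lsubmx_continuous : continuous (@lsubmx R 1 n m).
Proof.
move=> z N /nbhs_boxP[d d0 dN]; apply: filterS (nbhs_box z d0) => y yz.
by apply: dN => j; rewrite !mxE; exact: yz.
Qed.

Lemma rsubmx_continuous : continuous (@rsubmx R 1 n m).
Proof.
move=> z N /nbhs_boxP[d d0 dN]; apply: filterS (nbhs_box z d0) => y yz.
by apply: dN => j; rewrite !mxE; exact: yz.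
Qed.

Lemma row_mx_continuous :
  continuous (fun p : 'rV[R]_n * 'rV[R]_m => row_mx p.1 p.2).
Proof.
move=> [x y] N /nbhs_boxP[d d0 dN].
exists (box x d, box y d); first by split => /=; exact: nbhs_box.
move=> [u v] [/= xu yv]; apply: dN => j /=.
by rewrite !mxE; case: (fintype.split j) => i; [exact: xu|exact: yv].
Qed.

Lemma delta_mx_lshift (i : 'I_n) :
  delta_mx ord0 (lshift m i) = row_mx (delta_mx ord0 i) 0 :> 'rV[R]_(n + m).
Proof.
apply/rowP => j; rewrite !mxE; case: splitP => k jk; rewrite !mxE /=.
  by congr (_ %:R); rewrite -!val_eqE /= jk.
by rewrite -val_eqE /= jk gtn_eqF// (leq_trans (ltn_ord i))// leq_addr.
Qed.

Lemma delta_mx_rshift (i : 'I_m) :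
  delta_mx ord0 (rshift n i) = row_mx 0 (delta_mx ord0 i) :> 'rV[R]_(n + m).
Proof.
apply/rowP => j; rewrite !mxE; case: splitP => k jk; rewrite !mxE /=.
  by rewrite -val_eqE /= jk ltn_eqF// (leq_trans (ltn_ord k))// leq_addr.
by congr (_ %:R); rewrite -!val_eqE /= jk eqn_add2l.
Qed.

Lemma row_mx_lshift (x : 'rV[R]_n) (y : 'rV[R]_m) (h : R) i :
  row_mx x y + h *: delta_mx ord0 (lshift m i) = row_mx (x + h *: delta_mx ord0 i) y.
Proof. by rewrite delta_mx_lshift scale_row_mx add_row_mx scaler0 addr0. Qed.

Lemma row_mx_rshift (x : 'rV[R]_n) (y : 'rV[R]_m) (h : R) i :
  row_mx x y + h *: delta_mx ord0 (rshift n i) = row_mx x (y + h *: delta_mx ord0 i).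
Proof. by rewrite delta_mx_rshift scale_row_mx add_row_mx scaler0 addr0. Qed.

Lemma partials_slice (V : lcsType R[i]) (U : set 'rV[R]_(n + m)) (A : set 'rV[R]_m)
    (x : 'rV[R]_n) (F : 'rV[R]_(n + m) -> V) s :
  open A -> (forall y, A y -> U (row_mx x y)) -> smooth_on U F ->
  {in A, forall y, partials s (fun y => F (row_mx x y)) y =
    partials (map (@rshift n m) s) F (row_mx x y)}.
Proof.
move=> Ao AU sF; elim: s => // i s IH y /[!inE] Ay /=; apply: partialE.
have IH' : {in A, (fun y => partials (map (@rshift n m) s) F (row_mx x y)) =1
    partials s (fun y => F (row_mx x y))} by move=> z Az; rewrite IH.
apply: (diff_quot_cvg_eq Ao Ay IH').
have := smooth_on_cvg (map (@rshift n m) s) (rshift n i) sF (AU y Ay).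
apply: cvg_trans; apply: near_eq_cvg; apply: nearW => h.
by rewrite /diff_quot row_mx_rshift.
Qed.

Lemma smooth_on_slice (V : lcsType R[i]) (U : set 'rV[R]_(n + m)) (A : set 'rV[R]_m)
    (x : 'rV[R]_n) (F : 'rV[R]_(n + m) -> V) :
  open A -> (forall y, A y -> U (row_mx x y)) -> smooth_on U F ->
  smooth_on A (fun y => F (row_mx x y)).
Proof.
move=> Ao AU sF; apply: (@smooth_on_coind _ _ _ A (fun f => exists s, f =
  fun y => partials s F (row_mx x y))) => //; last by exists [::].
move=> _ [s ->]; split=> [y /[!inE] Ay|i].
  apply: (@continuous_comp _ _ _ (fun y => row_mx x y) (partials s F)); last first.
    exact: ((sF s).1 _ (mem_set (AU y Ay))).
  apply: (@continuous_comp _ _ _ (fun y => (x, y)) (fun p : 'rV[R]_n * 'rV[R]_m => row_mx p.1 p.2)).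
    move=> N [[B D] [/= nB nD] BD]; apply: filterS nD => z Dz; apply: BD.
    by split => //=; exact: nbhs_singleton.
  exact: row_mx_continuous.
exists (fun y => partials (rshift n i :: s) F (row_mx x y)); first by exists (rshift n i :: s).
move=> y /[!inE] Ay; have := smooth_on_cvg s (rshift n i) sF (AU y Ay).
apply: cvg_trans; apply: near_eq_cvg; apply: nearW => h.
by rewrite /diff_quot row_mx_rshift.
Qed.

End coordinate_products.

Section multiplication.
Context (R : realType) (n : nat) (G : lieGroupType R n).
Local Notation C := (R[i]^o).
Implicit Types (c d e : chart R n G).

Definition mul_param c d (z : 'rV[R]_(n + n)) : G :=
  (chart_inv c (lsubmx z) * chart_inv d (rsubmx z))%g.

Definition mul_dom c d := [set z : 'rV[R]_(n + n) |
  chart_img c (lsubmx z) /\ chart_img d (rsubmx z)].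

Lemma mul_smooth_param c d : atlas G c -> atlas G d ->
  smooth_param (mul_dom c d) (mul_param c d).
Proof.
move=> cG dG; split.
- rewrite openE => z [zc zd]; apply: filterI.
    by apply: lsubmx_continuous; apply: open_nbhs_nbhs; split => //; exact: chart_img_open.
  by apply: rsubmx_continuous; apply: open_nbhs_nbhs; split => //; exact: chart_img_open.
- move=> z /[!inE] -[zc zd].
  apply: (@continuous_comp _ _ _ (fun z => (chart_inv c (lsubmx z), chart_inv d (rsubmx z)))
    (fun xy : G * G => (xy.1 * xy.2)%g)); last exact: lie_mul_continuous.
  apply: (@cvg_pair _ _ _ (nbhs z) (nbhs (chart_inv c (lsubmx z)))
     (nbhs (chart_inv d (rsubmx z)))).
    apply: (@continuous_comp _ _ _ (@lsubmx R 1 n n) (chart_inv c)).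
      exact: lsubmx_continuous.
    exact: (chart_inv_continuous (mem_set zc)).
  apply: (@continuous_comp _ _ _ (@rsubmx R 1 n n) (chart_inv d)).
    exact: rsubmx_continuous.
  exact: (chart_inv_continuous (mem_set zd)).
- move=> e eG; have := @lie_mul_smooth R n G c d e cG dG eG.
  congr smooth_map_on; apply/seteqP; split=> z /=; first by case.
  by move=> [[]].
Qed.

Lemma mul_domE c d z w : chart_img c z -> chart_img d w -> mul_dom c d (row_mx z w).
Proof. by rewrite /mul_dom /= row_mxKl row_mxKr. Qed.

Lemma mul_paramE c d z w :
  mul_param c d (row_mx z w) = (chart_inv c z * chart_inv d w)%g.
Proof. by rewrite /mul_param row_mxKl row_mxKr. Qed.

Lemma smooth_translate (f : smooth_space G C) (g : G) :
  (fun x => f (g * x)%g) \in @smooth_pred R n G C.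
Proof.
have [c cG cg] := atlas_cover g; apply/asboolP => d dG.
have := @smooth_on_slice R n n C (mul_dom c d) (chart_img d) (c g) (f \o mul_param c d).
rewrite (_ : (fun y => _) = ((fun x => f (g * x)%g) \o chart_inv d)); last first.
  by apply/funext => w; rewrite /= mul_paramE chart_funK ?inE.
apply; [exact: chart_img_open|move=> w dw|exact: (param_smooth (mul_smooth_param cG dG))].
by apply: mul_domE => //; exact: chart_fun_img.
Qed.

Definition translate f g := SmoothSpace (smooth_translate f g).

(** The mixed derivative in both variables of f(xy), in charts c and d. *)
Definition mixed_jet (f : G -> C) (c : chart R n G) (t : seq 'I_n) (z : 'rV[R]_n)
    (j : jet G) : C :=
  partials (map (@lshift n n) t ++ map (@rshift n n) j.1.2)
    (f \o mul_param c j.1.1) (row_mx z j.2).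

Lemma jet_eval_translate (f : smooth_space G C) c z j : atlas G c -> chart_img c z ->
  atlas G j.1.1 -> chart_img j.1.1 j.2 ->
  jet_eval (translate f (chart_inv c z)) j = mixed_jet f c [::] z j.
Proof.
case: j => [[d s] w] /= cG cz dG dw; rewrite /jet_eval /mixed_jet /=.
rewrite -(partials_slice (U := mul_dom c d) s (@chart_img_open _ _ _ d)) ?inE//.
- by congr (partials s _ w); apply/funext => x; rewrite /= mul_paramE.
- by move=> y dy; exact: mul_domE.
- exact: (param_smooth (mul_smooth_param cG dG)).
Qed.

(** The points concerned form a compact set of pairs in the domain of the
    multiplication read in charts. *)
Lemma mixed_jets_bound (J1 J2 : set (jet G)) : compact_jets J1 -> compact_jets J2 ->
  exists J L, [/\ compact_jets (G := G) J, 0 <= L &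
    forall (f : smooth_space G C) (M : R) j1 j2, 0 <= M -> J1 j1 -> J2 j2 ->
      (forall j, J j -> cmod (jet_eval f j) <= M) ->
      cmod (mixed_jet f j1.1.1 j1.1.2 j1.2 j2) <= L * M].
Proof.
pose P J1 J2 J (L : R) := forall (f : smooth_space G C) (M : R) j1 j2, 0 <= M -> J1 j1 -> J2 j2 ->
  (forall j, J j -> cmod (jet_eval f j) <= M) ->
  cmod (mixed_jet f j1.1.1 j1.1.2 j1.2 j2) <= L * M.
have Pweak A B J J' (L L' : R) : J `<=` J' -> L <= L' -> P A B J L -> P A B J' L'.
  move=> JJ LL h f M j1 j2 M0 A1 B2 fM; rewrite (le_trans (h f M j1 j2 M0 A1 B2 _))//.
    by move=> j /JJ; exact: fM.
  by rewrite ler_wpM2r.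
move=> cJ1; elim: cJ1 J2 => [c t K1 cG Kc1 K1c||A B _ IHA _ IHB] J2 cJ2; last first.
- have [J [L [cJ L0 h]]] := IHA J2 cJ2; have [J' [L' [cJ' L0' h']]] := IHB J2 cJ2.
  exists (J `|` J'), (L + L'); split; [exact: compact_jetsU|exact: addr_ge0|].
  have LL1 : L <= L + L' by rewrite lerDl.
  have LL2 : L' <= L + L' by rewrite lerDr.
  move=> f M j1 j2 M0 [A1|B1] h2 fM.
    exact: (Pweak A J2 J _ L _ (@subsetUl _ J J') LL1 h f M j1 j2 M0 A1 h2 fM).
  exact: (Pweak B J2 J' _ L' _ (@subsetUr _ J J') LL2 h' f M j1 j2 M0 B1 h2 fM).
- by exists set0, 0; split => //; exact: compact_jets0.
elim: cJ2 => [d s K2 dG Kc2 K2d||A B _ IHA _ IHB]; last first.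
- have [J [L [cJ L0 h]]] := IHA; have [J' [L' [cJ' L0' h']]] := IHB.
  exists (J `|` J'), (L + L'); split; [exact: compact_jetsU|exact: addr_ge0|].
  have LL1 : L <= L + L' by rewrite lerDl.
  have LL2 : L' <= L + L' by rewrite lerDr.
  move=> f M j1 j2 M0 h1 [A2|B2] fM.
    exact: (Pweak _ A J _ L _ (@subsetUl _ J J') LL1 h f M j1 j2 M0 h1 A2 fM).
  exact: (Pweak _ B J' _ L' _ (@subsetUr _ J J') LL2 h' f M j1 j2 M0 h1 B2 fM).
- by exists set0, 0; split => //; exact: compact_jets0.
pose K := (fun p : 'rV[R]_n * 'rV[R]_n => row_mx p.1 p.2) @` (K1 `*` K2).
have Kc : compact K.
  apply: continuous_compact; last exact: compact_setX.
  by apply: continuous_subspaceT; exact: row_mx_continuous.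
have KU : K `<=` mul_dom c d.
  by move=> _ [[z w] [/= /K1c ? /K2d ?] <-]; exact: mul_domE.
have [J [L [cJ L0 h]]] := param_jets_compact (mul_smooth_param cG dG)
  (map (@lshift n n) t ++ map (@rshift n n) s) Kc KU.
exists J, L; split => // f M [[c' t'] z] [[d' s'] w] M0 [/= [-> ->] Kz] [/= [-> ->] Kw] fM.
by apply: h => //; exists (z, w).
Qed.

Section one_function.
Context (f : smooth_space G C) (c : chart R n G) (cG : atlas G c).
Variables (J : set (jet G)) (cJ : compact_jets J).

Let mixed_smooth d s : atlas G d ->
  smooth_on (V := C) (mul_dom c d) (partials s (f \o mul_param c d)).
Proof.
by move=> dG; apply: smooth_on_partials; exact: (param_smooth (mul_smooth_param cG dG)).
Qed.

Let mixed_continuous t z (e : R) : chart_img c z -> 0 < e ->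
  \forall z' \near z, forall j, J j -> cmod (mixed_jet f c t z' j - mixed_jet f c t z j) <= e.
Proof.
move=> cz e0; elim: cJ => [d s K dG Kc Kd||J1 J2 _ IH1 _ IH2].
- pose Q := partials (map (@lshift n n) t ++ map (@rshift n n) s) (f \o mul_param c d).
  have : \forall z' \near z, K `<=` (fun w => cmod (Q (row_mx z' w) - Q (row_mx z w)) <= e).
    have /compact_near_coveringP Knc := Kc.
    apply: (Knc _ (nbhs z) (fun z' w => cmod (Q (row_mx z' w) - Q (row_mx z w)) <= e)
      (nbhs_filter z)) => w Kw.
    have cQ : {for row_mx z w, continuous Q}.
      have := smooth_on_continuous (mixed_smooth (map (@lshift n n) t ++ map (@rshift n n) s) dG).
      by apply; rewrite inE; apply: mul_domE => //; exact: Kd.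
    have e2 : 0 < e / 2 by rewrite divr_gt0.
    have nQ := @cvg_cmod_lt _ _ _ (nbhs_filter (row_mx z w)) _ _ _ cQ e2.
    have [[A B] /= [nA nB] AB] := @row_mx_continuous R n n (z, w) _ nQ.
    exists (B, A) => // -[w' z'] [/= Bw Az].
    have /= h1 := AB (z', w') (conj Az Bw).
    have /= h2 := AB (z, w') (conj (nbhs_singleton nA) Bw).
    rewrite -[_ - _](subrKA (Q (row_mx z w))) (le_trans (cmodD _ _))// (splitr e).
    by rewrite lerD ?ltW// cmodBC.
  by apply: filterS => z' Kz [[d' s'] w] [/= [-> ->] Kw]; exact: Kz.
- apply: (@filterS _ _ (nbhs_filter z) setT) => [z' _ j []|].
  exact: (@filterT _ _ (nbhs_filter z)).
- apply: (@filterS2 _ _ (nbhs_filter z) _ _ _ _ IH1 IH2) => z' h1 h2 j.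
  by move=> [/h1|/h2].
Qed.

(* By compactness of J the derivative in x is continuous in x uniformly in j, and
   the mean value inequality makes the difference quotients converge uniformly. *)
Let mixed_derive t z i (e : R) : chart_img c z -> 0 < e ->
  \forall h \near (0 : R)^', forall j, J j ->
    cmod (h^-1%:C * (mixed_jet f c t (z + h *: delta_mx ord0 i) j - mixed_jet f c t z j) -
      mixed_jet f c (i :: t) z j) <= e.
Proof.
move=> cz e0; have e2 : 0 < e / 2 by rewrite divr_gt0.
have nz : nbhs z (chart_img c) by apply: open_nbhs_nbhs; split => //; exact: chart_img_open.
have [d d0 dz] := nbhs_boxP (filterI nz (@mixed_continuous (i :: t) z _ cz e2)).
have small : \forall h \near (0 : R)^', `|h| < d.
  apply: nbhs_dnbhs; apply/nbhs_ballP; exists d => //= h.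
  by rewrite /ball /= sub0r normrN.
have n0 : \forall h \near (0 : R)^', h != 0 by exact: nbhs_dnbhs_neq.
apply: filterS2 small n0 => h hd h0 [[b s] w] Jj.
have [bG bw] := compact_jetsP cJ Jj; rewrite /= in bG bw.
pose u := map (@lshift n n) t ++ map (@rshift n n) s.
pose Q := partials u (f \o mul_param c b).
have := @line_estimate R (n + n) (lshift n i) Q (row_mx z w)
  (partials (lshift n i :: u) (f \o mul_param c b))
  (mixed_jet f c (i :: t) z (b, s, w)) d (e / 2) h.
rewrite row_mx_lshift => est.
have {est} : cmod (mixed_jet f c t (z + h *: delta_mx ord0 i) (b, s, w) -
    mixed_jet f c t z (b, s, w) - h%:C * mixed_jet f c (i :: t) z (b, s, w)) <= e * `|h|.
  rewrite (_ : e * `|h| = 2 * (e / 2) * `|h|); last by field.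
  apply: est => // r rd /=; rewrite row_mx_lshift.
  have zr : box z d (z + r *: delta_mx ord0 i).
    move=> j; rewrite !mxE addrAC subrr add0r eqxx /=.
    by case: (j == i); rewrite ?mulr1// mulr0 normr0.
  have [cr hr] := dz _ zr; split; last exact: (hr (b, s, w) Jj).
  apply: smooth_on_cvg; first exact: (param_smooth (mul_smooth_param cG bG)).
  exact: mul_domE.
have scal (x y : R[i]) : h^-1%:C * x - y = h^-1%:C * (x - h%:C * y).
  by rewrite [RHS]mulrBr mulrA -rmorphM /= mulVf// mul1r.
by rewrite -ler_pdivrMr ?normr_gt0// scal cmodM cmodR normfV mulrC.
Qed.

Context (L : (jet G -> C) -> C) (K : R).
Hypotheses (Ll : forall a u v, bounded_on J u -> bounded_on J v ->
    L (fun j => a * u j + v j) = a * L u + L v)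
  (LK : forall u M, 0 <= M -> (forall j, J j -> cmod (u j) <= M) ->
    cmod (L u) <= K * M) (K0 : 0 <= K).

Let LKe (e : R) (u : jet G -> C) : 0 < e ->
  (forall j, J j -> cmod (u j) <= e / (K + 1)) -> cmod (L u) < e.
Proof.
move=> e0 ue; have K1 : 0 < K + 1 by rewrite ltr_wpDl.
apply: (@le_lt_trans _ _ (K * (e / (K + 1)))).
  by apply: LK => //; rewrite divr_ge0// ltW.
by rewrite mulrA ltr_pdivrMr// mulrC ltr_pM2l// ltrDl.
Qed.

Let mixed_bounded t z : chart_img c z -> bounded_on J (mixed_jet f c t z).
Proof.
move=> cz; have cz1 : compact_jets (jet_piece c t [set z]).
  by apply: compact_jets_piece => // [|_ ->//]; exact: compact_set1.
have [J' [L' [cJ' L0' h]]] := mixed_jets_bound cz1 cJ.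
have [M fM] := jet_bounded f cJ' (cmod_cseminorm R).
exists (L' * Num.max 0 M) => j Jj.
apply: (h f (Num.max 0 M) (c, t, z) j) => // [|j' /fM jM]; first by rewrite le_max lexx.
by rewrite le_max jM orbT.
Qed.

(** Differentiation under L.  The derivatives in x are taken after those in y,
    which L has absorbed, so that the order of derivatives is never exchanged. *)
Lemma mixed_functional_smooth :
  smooth_on (V := C) (chart_img c) (fun z => L (mixed_jet f c [::] z)) /\
  forall t, {in chart_img c, forall z,
    partials (V := C) t (fun z => L (mixed_jet f c [::] z)) z = L (mixed_jet f c t z)}.
Proof.
have LB u v : bounded_on J u -> bounded_on J v -> L (fun j => u j - v j) = L u - L v.
  move=> bu bv; have := Ll (-1) bv bu; rewrite mulN1r [RHS]addrC => <-.
  by congr L; apply/funext => j; rewrite mulN1r addrC.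
have bB a u v : bounded_on J u -> bounded_on J v -> bounded_on J (fun j => a * (u j - v j)).
  move=> [M uM] [N vN]; exists (cmod a * (M + N)) => j Jj.
  by rewrite cmodM ler_wpM2l ?cmod_ge0// (le_trans (cmodB _ _))// lerD ?uM ?vN.
have LZ a u : bounded_on J u -> L (fun j => a * u j) = a * L u.
  move=> bu; have b0 : bounded_on J (fun=> 0) by exists 0 => j _; rewrite cmod0.
  have L0 : L (fun=> 0) = 0.
    by have := LB _ _ b0 b0; rewrite !subrr.
  have := Ll a bu b0; rewrite L0 addr0 => <-.
  by congr L; apply/funext => j; rewrite addr0.
have cim := @chart_img_open _ _ _ c.
have step t z i : chart_img c z -> diff_quot (V := C) i (fun z => L (mixed_jet f c t z)) z h
    @[h --> 0^'] --> L (mixed_jet f c (i :: t) z).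
  move=> cz; apply/cvg_cmodP => e e0.
  have eK : 0 < e / (K + 1) by rewrite divr_gt0// ltr_wpDl.
  have nc := near_line i cim cz.
  apply: filterS2 nc (@mixed_derive t z i _ cz eK) => h ch hd.
  have b1 := mixed_bounded t ch; have b2 := mixed_bounded t cz.
  have b3 := mixed_bounded (i :: t) cz.
  have b12 : bounded_on J (fun j => mixed_jet f c t (z + h *: delta_mx ord0 i) j -
      mixed_jet f c t z j).
    by have := bB 1 _ _ b1 b2; under eq_fun do rewrite mul1r.
  have := LKe e0 hd; rewrite (LB _ _ (bB _ _ _ b1 b2) b3) (LZ _ _ b12) (LB _ _ b1 b2).
  exact.
have partE t : {in chart_img c, forall z,
    partials (V := C) t (fun z => L (mixed_jet f c [::] z)) z = L (mixed_jet f c t z)}.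
  elim: t => // i t IH z /[!inE] cz /=; apply: partialE.
  apply: (@diff_quot_cvg_eq _ _ C _ i (fun z => L (mixed_jet f c t z)) _ _ _ cim cz).
    by move=> y /IH ->.
  exact: step.
split => // t; split=> [z /[!inE] cz|i z /[!inE] cz]; last first.
  exists (L (mixed_jet f c (i :: t) z)).
  apply: (@diff_quot_cvg_eq _ _ C _ i (fun z => L (mixed_jet f c t z)) _ _ _ cim cz).
    by move=> y cy; rewrite partE.
  exact: step.
apply: (@continuous_eq _ _ C _ (fun z => L (mixed_jet f c t z)) _ _ cim cz).
  by move=> y cy; rewrite partE.
apply: (@cvg_cmodP R _ (nbhs z) (nbhs_filter z) _ _).2 => e e0.
have eK : 0 < e / (K + 1) by rewrite divr_gt0// ltr_wpDl.
have nz : nbhs z (chart_img c) by apply: open_nbhs_nbhs.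
apply: filterS2 nz (@mixed_continuous t z _ cz eK) => z' cz' hz'.
by have := LKe e0 hz'; rewrite (LB _ _ (mixed_bounded t cz') (mixed_bounded t cz)).
Qed.

End one_function.

End multiplication.

Section convolutions.
Context (R : realType) (n : nat) (G : lieGroupType R n).
Local Notation C := (R[i]^o).
Implicit Types (D : cs_distribution G) (f : smooth_space G C).

Definition conv_fun D f : G -> C := fun x => D (translate f x).

Lemma conv_fun_jets D : exists J K,
  [/\ compact_jets (G := G) J, 0 <= K & forall f,
    conv_fun D f \in @smooth_pred R n G C /\
    forall j (M : R), atlas G j.1.1 -> chart_img j.1.1 j.2 -> 0 <= M ->
      (forall j', J j' -> cmod (mixed_jet f j.1.1 j.1.2 j.2 j') <= M) ->
      cmod (jet_eval (V := C) (conv_fun D f) j) <= K * M].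
Proof.
have [J [K [L [cJ K0 Ll LE LK]]]] := dist_extension D.
exists J, K; split => // f.
have cE c : atlas G c ->
    {in chart_img c, (fun z => L (mixed_jet f c [::] z)) =1 conv_fun D f \o chart_inv c}.
  move=> cG z /[!inE] cz; rewrite /= /conv_fun -LE; apply: (functional_eq_on Ll LK).
    have [M fM] := jet_bounded (translate f (chart_inv c z)) cJ (cmod_cseminorm R).
    by exists M.
  by move=> j Jj; have [jG jc] := compact_jetsP cJ Jj; rewrite jet_eval_translate.
split.
  apply/asboolP => c cG; apply: (smooth_on_eq (@chart_img_open _ _ _ c) (cE c cG)).
  by have [] := mixed_functional_smooth f cG cJ Ll LK K0.
move=> [[c t] z] M /= cG cz M0 hM; rewrite /jet_eval /=.
have [_ partE] := mixed_functional_smooth f cG cJ Ll LK K0.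
rewrite -(partials_eq (V := C) t (@chart_img_open _ _ _ c) (cE c cG) (mem_set cz)).
by rewrite partE ?inE//; exact: LK.
Qed.

Lemma smooth_conv D f : conv_fun D f \in @smooth_pred R n G C.
Proof. by have [J [K [_ _ h]]] := conv_fun_jets D; have [] := h f. Qed.

Definition conv_smooth D f := SmoothSpace (smooth_conv D f).

Lemma smooth_insubd (u : G -> C) (su : u \in @smooth_pred R n G C) :
  insubd (0 : smooth_space G C) u = SmoothSpace su.
Proof. by apply: val_inj; rewrite insubdK. Qed.

Lemma translate_linear (a : R[i]) f g x :
  translate (a *: f + g) x = a *: translate f x + translate g x.
Proof. exact: val_inj. Qed.

Lemma conv_smooth_linear D (a : R[i]) f g :
  conv_smooth D (a *: f + g) = a *: conv_smooth D f + conv_smooth D g.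
Proof.
have [Dl _] := clinP D; apply: val_inj; apply/funext => x /=.
by rewrite /conv_fun translate_linear Dl.
Qed.

(** The default values in the definition of the convolution are never used: the
    inner function is smooth, and the outer functional is continuous because the
    mixed derivatives of f(xy) are bounded by the jets of f. *)
Lemma convolutionE D1 D2 f : convolution D1 D2 f = D1 (conv_smooth D2 f).
Proof.
have inner (g : smooth_space G C) : insubd (0 : smooth_space G C)
    (fun x => D2 (insubd (0 : smooth_space G C) (fun y => g (x * y)%g))) =
    conv_smooth D2 g.
  have -> : (fun x => D2 (insubd (0 : smooth_space G C) (fun y => g (x * y)%g))) =
      conv_fun D2 g.
    apply/funext => x; rewrite /conv_fun; congr (clin_fun D2 _).
    exact: (smooth_insubd (smooth_translate g x)).
  exact: (smooth_insubd (smooth_conv D2 g)).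
have outer : (fun g : smooth_space G C => D1 (insubd (0 : smooth_space G C)
    (fun x => D2 (insubd (0 : smooth_space G C) (fun y => g (x * y)%g))))) =
    fun g => D1 (conv_smooth D2 g).
  by apply/funext => g; rewrite inner.
rewrite /convolution outer insubdK//; apply/asboolP.
have [Dl _] := clinP D1.
have lin : linear (fun g => D1 (conv_smooth D2 g)).
  by move=> a g k; rewrite conv_smooth_linear Dl.
split => //.
have [J1 [K1 [cJ1 K10 D1J]]] := dist_bound D1.
have [J2 [K2 [cJ2 K20 h2]]] := conv_fun_jets D2.
have [J [K [cJ K0 hJ]]] := mixed_jets_bound cJ1 cJ2.
apply: (jet_bound_continuous cJ (_ : 0 <= K1 * (K2 * K)) lin).
  by rewrite !mulr_ge0.
move=> g M M0 gM; rewrite -!mulrA; apply: D1J => [|j Jj]; first by rewrite !mulr_ge0.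
have [jG jc] := compact_jetsP cJ1 Jj.
apply: (h2 g).2 => // [|j' Jj']; first by rewrite mulr_ge0.
exact: hJ.
Qed.

End convolutions.

(** * Equicontinuity of bounded sets of distributions *)

Section patches.
Context (R : realType) (n : nat) (G : lieGroupType R n).
Local Notation C := (R[i]^o).
Local Notation patch := (set (chart R n G * 'rV[R]_n)).
Implicit Types (P Q : patch) (e c : chart R n G).

(** A compact subset of G together with the charts in which it is seen. *)
Inductive compact_patch : patch -> Prop :=
| compact_patch1 e K : atlas G e -> compact K -> K `<=` chart_img e ->
    compact_patch [set x | x.1 = e /\ K x.2]
| compact_patch0 : compact_patch set0
| compact_patchU P Q : compact_patch P -> compact_patch Q ->
    compact_patch (P `|` Q).

Lemma compact_patchP P x : compact_patch P -> P x -> atlas G x.1 /\ chart_img x.1 x.2.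
Proof.
move=> cP; elim: cP x => [e K eG Kc Ke [e' x] [/= -> Kx]|//|].
  by split => //; exact: Ke.
by move=> P1 P2 _ IH1 _ IH2 x [/IH1|/IH2].
Qed.

Definition patch_base P : set G := [set chart_inv x.1 x.2 | x in P].

Definition patch_interior P : set G := [set g | exists e,
  [/\ atlas G e, chart_dom e g & \forall x \near e g, P (e, x)]].

(** The multi-indices are countable, so every one is admitted for k large, but
    only finitely many for each k. *)
Definition patch_jets P (k : nat) : set (jet G) :=
  [set j | P (j.1.1, j.2) /\ (pickle j.1.2 < k)%N].

Lemma patch_base_compact P : compact_patch P -> compact (patch_base P).
Proof.
move=> cP; elim: cP => [e K eG Kc Ke||P1 P2 _ IH1 _ IH2].
- rewrite (_ : patch_base _ = chart_inv e @` K); last first.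
    apply/seteqP; split=> [_ [[e' x] [/= -> Kx] <-]|_ [x Kx <-]]; first by exists x.
    by exists (e, x).
  apply: continuous_compact => //; apply: continuous_in_subspaceT => x Kx.
  by apply: (@chart_inv_continuous _ _ _ e); rewrite inE; apply: Ke; rewrite -inE.
- by rewrite /patch_base image_set0; exact: compact0.
- by rewrite /patch_base image_setU; exact: compactU.
Qed.

Lemma patch_jets_compact P k : compact_patch P -> compact_jets (patch_jets P k).
Proof.
move=> cP; elim: k => [|k IH].
  rewrite (_ : patch_jets P 0 = set0); first exact: compact_jets0.
  by apply/seteqP; split=> j // [].
pose new : set (jet G) := [set j | P (j.1.1, j.2) /\ pickle j.1.2 = k].
have -> : patch_jets P k.+1 = patch_jets P k `|` new.
  apply/seteqP; split=> j /=.
    by move=> [Pj]; rewrite ltnS leq_eqVlt => /orP[/eqP|]; [right|left].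
  by move=> [[Pj jk]|[Pj jk]]; split => //; [exact: ltnW|rewrite jk].
apply: compact_jetsU => //; rewrite /new {IH new}.
have [[t tk]|nt] := pselect (exists t : seq 'I_n, pickle t = k); last first.
  rewrite (_ : [set _ | _] = set0); first exact: compact_jets0.
  by apply/seteqP; split=> j // [_ jk]; apply: nt; exists j.1.2.
have -> : [set j : jet G | P (j.1.1, j.2) /\ pickle j.1.2 = k] =
    [set j | P (j.1.1, j.2) /\ j.1.2 = t].
  apply/seteqP; split=> j /= [Pj jk]; split => //; last by rewrite jk.
  by apply: (pcan_inj pickleK); rewrite jk.
elim: cP => [e K eG Kc Ke||P1 P2 _ IH1 _ IH2].
- rewrite (_ : [set _ | _] = jet_piece e t K); first exact: compact_jets_piece.
  apply/seteqP; split=> -[[e' t'] x] /=; first by move=> [[-> Kx] ->].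
  by move=> [[-> ->] Kx].
- rewrite (_ : [set _ | _] = set0); first exact: compact_jets0.
  by apply/seteqP; split=> j // [].
- rewrite (_ : [set _ | _] = [set j | P1 (j.1.1, j.2) /\ j.1.2 = t] `|`
      [set j | P2 (j.1.1, j.2) /\ j.1.2 = t]); first exact: compact_jetsU.
  apply/seteqP; split=> j /=; first by move=> [[]]; [left|right].
  by move=> [[? ?]|[? ?]]; split => //; [left|right].
Qed.

Lemma jets_in_patch J : compact_jets (G := G) J ->
  exists2 P, compact_patch P & forall j, J j -> P (j.1.1, j.2).
Proof.
elim=> [c s K cG Kc Kimg||J1 J2 _ [P1 c1 h1] _ [P2 c2 h2]].
- exists [set x | x.1 = c /\ K x.2]; first exact: compact_patch1.
  by move=> [[c' s'] x] [/= [-> _] Kx].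
- by exists set0 => //; exact: compact_patch0.
- exists (P1 `|` P2); first exact: compact_patchU.
  by move=> j [/h1|/h2]; [left|right].
Qed.

Lemma chart_compact_nbhs g : exists e K, [/\ atlas G e, chart_dom e g,
  nbhs (e g) K, compact K & K `<=` chart_img e].
Proof.
have [e eG eg] := atlas_cover g; have ig : chart_img e (e g) by exact: chart_fun_img.
have [K [nK cK Ki]] := locally_compact_rV (@chart_img_open _ _ _ e) ig.
by exists e, K.
Qed.

Lemma near_chart_nbhs g e (K : set 'rV[R]_n) : chart_dom e g -> nbhs (e g) K ->
  \forall g' \near g, chart_dom e g' /\ K (e g').
Proof.
move=> eg nK; apply: filterI; last exact: (chart_fun_continuous (mem_set eg) nK).
by apply: open_nbhs_nbhs; split => //; exact: chart_dom_open.
Qed.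

Lemma compact_in_patch (L : set G) : compact L ->
  exists2 P, compact_patch P & L `<=` patch_interior P.
Proof.
move=> Lc; apply: (@compact_ind _ L (fun A => exists2 P, compact_patch P &
  A `<=` patch_interior P)) => //.
- by exists set0 => //; exact: compact_patch0.
- by move=> A B AB [P cP BP]; exists P => //; exact: subset_trans BP.
- move=> A B [P cP AP] [Q cQ BQ]; exists (P `|` Q); first exact: compact_patchU.
  move=> g [/AP|/BQ] [e [eG eg near_e]]; exists e; split => //.
    by apply: filterS near_e => x; left.
  by apply: filterS near_e => x; right.
move=> g Lg; have [e [K [eG eg nK cK Ki]]] := chart_compact_nbhs g.
exists [set g' | chart_dom e g' /\ nbhs (e g') K].
  exact: (near_chart_nbhs eg (nbhs_interior nK)).
exists [set x | x.1 = e /\ K x.2]; first exact: compact_patch1.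
move=> g' [eg' nK']; exists e; split => //.
by apply: filterS nK' => x Kx.
Qed.

Lemma compact_nbhs1 : exists2 W : set G, compact W & nbhs (1%g : G) W.
Proof.
have [e [K [eG eg nK cK Ki]]] := chart_compact_nbhs (1%g : G).
exists (patch_base [set x | x.1 = e /\ K x.2]).
  exact/patch_base_compact/compact_patch1.
apply: filterS (near_chart_nbhs eg nK) => g [dg Kg].
by exists (e, e g) => //=; rewrite chart_funK// inE.
Qed.

Lemma compact_thickening (W L : set G) : compact W -> compact L ->
  compact [set (w * g)%g | w in W & g in L].
Proof.
move=> Wc Lc; rewrite (_ : [set _ | _ in _ & _ in _] =
  (fun xy : G * G => (xy.1 * xy.2)%g) @` (W `*` L)); last first.
  apply/seteqP; split=> x; first by move=> [w Ww [g Lg <-]]; exists (w, g).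
  by move=> [[w g] [/= Ww Lg] <-]; exists w => //; exists g.
apply: continuous_compact; last exact: compact_setX.
by apply: continuous_subspaceT; exact: lie_mul_continuous.
Qed.

End patches.

Section cutting.
Context (R : realType) (n : nat) (G : lieGroupType R n).
Local Notation C := (R[i]^o).
Variables (H : set G) (Ho : open H) (Hc : open (~` H)).
Implicit Types (f : smooth_space G C).

Definition cut f : G -> C := fun g => if `[< H g >] then f g else 0.

Let cut_eq_in f (c : chart R n G) :
  {in chart_img c `&` chart_inv c @^-1` H, f \o chart_inv c =1 cut f \o chart_inv c}.
Proof. by move=> x /[!inE] -[_ Hx]; rewrite /= /cut asboolT. Qed.

Let cut_eq_out f (c : chart R n G) :
  {in chart_img c `&` chart_inv c @^-1` (~` H), (0 : 'rV[R]_n -> C) =1 cut f \o chart_inv c}.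
Proof. by move=> x /[!inE] -[_ Hx]; rewrite /= /cut asboolF. Qed.

Lemma smooth_cut f : cut f \in @smooth_pred R n G C.
Proof.
apply/asboolP => c cG; apply: smooth_on_local => x cx.
have pc := chart_inv_param cG.
have [Hx|nHx] := pselect (H (chart_inv c x)).
  exists (chart_img c `&` chart_inv c @^-1` H); split => //.
  apply: (smooth_on_eq (param_preimage_open pc Ho) (@cut_eq_in f c)).
  by apply: smooth_on_sub (smooth_spaceP f cG) => y [].
exists (chart_img c `&` chart_inv c @^-1` (~` H)); split => //.
apply: (smooth_on_eq (param_preimage_open pc Hc) (@cut_eq_out f c)).
exact: smooth_on0.
Qed.

Definition smooth_cutoff f := SmoothSpace (smooth_cut f).

Lemma jet_eval_cut_in f j : atlas G j.1.1 -> chart_img j.1.1 j.2 ->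
  H (chart_inv j.1.1 j.2) -> jet_eval (smooth_cutoff f) j = jet_eval f j.
Proof.
case: j => [[c s] x] /= cG cx Hx; rewrite /jet_eval /=; apply: esym.
apply: (partials_eq (V := C) s (param_preimage_open (chart_inv_param cG) Ho) (@cut_eq_in f c)).
by rewrite inE.
Qed.

Lemma jet_eval_cut_out f j : atlas G j.1.1 -> chart_img j.1.1 j.2 ->
  ~ H (chart_inv j.1.1 j.2) -> jet_eval (smooth_cutoff f) j = 0.
Proof.
case: j => [[c s] x] /= cG cx Hx; rewrite /jet_eval /=.
have oc := param_preimage_open (chart_inv_param cG) Hc.
rewrite -(partials_eq (V := C) s oc (@cut_eq_out f c)) ?inE//.
have := jet_evalZ 0 (0 : smooth_space G C) (j := (c, s, x)) cG cx.
by rewrite !scale0r.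
Qed.

End cutting.

Section uniform_boundedness.
Context (R : realType) (n : nat) (G : lieGroupType R n).
Local Notation C := (R[i]^o).
Local Notation patch := (set (chart R n G * 'rV[R]_n)).

(** As for open subgroups: when x is close to g, both x g^-1 and g x^-1 are in W,
    so g and x belong to the union together. *)
Lemma clopen_union (W : set G) (L : nat -> set G) : nbhs (1%g : G) W ->
  (forall k, [set (w * g)%g | w in W & g in L k] `<=` L k.+1) ->
  open (\bigcup_k L k) /\ open (~` \bigcup_k L k).
Proof.
move=> nW LS.
have nWg (g : G) : nbhs g [set x | W (x * g^-1)%g].
  have : {for g, continuous (fun x : G => (x * g^-1)%g)}.
    apply: (@continuous_comp _ _ _ (fun x => (x, g^-1%g)) (fun xy : G * G => (xy.1 * xy.2)%g)).
      move=> N [[B D] [/= nB nD] BD]; apply: filterS nB => z Bz; apply: BD.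
      by split => //=; exact: nbhs_singleton.
    exact: lie_mul_continuous.
  by rewrite /prop_for /continuous_at mulgV; apply.
have nWg' (g : G) : nbhs g [set x | W (g * x^-1)%g].
  have : {for g, continuous (fun x : G => (g * x^-1)%g)}.
    apply: (@continuous_comp _ _ _ (fun x => (g, x^-1%g)) (fun xy : G * G => (xy.1 * xy.2)%g)).
      move=> N [[B D] [/= nB nD] BD].
      have nI : nbhs g [set z | D (z^-1)%g] := @lie_inv_continuous R n G g D nD.
      apply: filterS nI => z Dz; apply: BD.
      by split => //=; exact: nbhs_singleton.
    exact: lie_mul_continuous.
  by rewrite /prop_for /continuous_at mulgV; apply.
split; rewrite openE => g.
  move=> [k _ Lg]; apply: filterS (nWg g) => x Wx; exists k.+1 => //.
  by apply: LS; exists (x * g^-1)%g => //; exists g => //; rewrite mulgVK.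
move=> nHg; apply: filterS (nWg' g) => x Wx [k _ Lx]; apply: nHg; exists k.+1 => //.
by apply: LS; exists (g * x^-1)%g => //; exists x => //; rewrite mulgVK.
Qed.

(** D defeats the bound by k times the jets over P, and f is rescaled.  The patch Q
    is large enough to contain the support of D, so that D does not notice what
    happens to f elsewhere, and a thickening of P, so that a union of such patches
    is open and closed. *)
Lemma exhaustion_step (S : set (cs_distribution G)) (W : set G) : compact W ->
  (forall J K, compact_jets J -> 0 <= K -> exists2 D, S D & ~ jet_bound J K D) ->
  forall (k : nat) (P : patch), compact_patch P ->
  exists (D : cs_distribution G) (f : smooth_space G C) (Q : patch),
  [/\ S D /\ compact_patch Q,
      forall j, patch_jets P k j -> cmod (jet_eval f j) <= 1,
      k%:R < cmod (D f),
      forall f1 f2 : smooth_space G C,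
        (forall j, Q (j.1.1, j.2) -> jet_eval f1 j = jet_eval f2 j) -> D f1 = D f2 &
      P `<=` Q /\ [set (w * g)%g | w in W & g in patch_base P] `<=` patch_interior Q].
Proof.
move=> Wc notS k P cP.
have [D SD /existsNP[f0 /existsNP[M /not_implyP[M0 /not_implyP[f0M /negP]]]]] :=
  notS _ _ (patch_jets_compact k cP) (ler0n R k).
rewrite -ltNge => kD.
have Dz (a : R[i]) : D (a *: f0) = a * D f0 by rewrite clinZ.
have [f [fj fD]] : exists f : smooth_space G C,
    (forall j, patch_jets P k j -> cmod (jet_eval f j) <= 1) /\ k%:R < cmod (D f).
  have val j : patch_jets P k j -> atlas G j.1.1 /\ chart_img j.1.1 j.2.
    by move=> /(compact_jetsP (patch_jets_compact k cP)).
  have [M0'|M0'] := eqVneq M 0.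
    have D0 : 0 < cmod (D f0) by move: kD; rewrite M0' mulr0.
    exists (((k%:R + 1) / cmod (D f0))%:C *: f0); split=> [j Jj|].
      have [jG jc] := val j Jj; rewrite jet_evalZ// cmodM.
      have -> : cmod (jet_eval f0 j) = 0.
        by apply/eqP; rewrite eq_le cmod_ge0 andbT -{1}M0' f0M.
      by rewrite mulr0.
    rewrite Dz cmodM cmodR gtr0_norm ?divr_gt0 ?ltr_wpDl ?ler0n//.
    by rewrite divfK ?gt_eqF// ltrDl.
  have Mp : 0 < M by rewrite lt_neqAle eq_sym M0'.
  exists ((M^-1)%:C *: f0); split=> [j Jj|].
    have [jG jc] := val j Jj; rewrite jet_evalZ// cmodM cmodR gtr0_norm ?invr_gt0//.
    by rewrite ler_pdivrMl// mulr1 f0M.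
  by rewrite Dz cmodM cmodR gtr0_norm ?invr_gt0// mulrC ltr_pdivlMr.
have [J [K [cJ K0 DJ]]] := dist_bound D.
have [P1 cP1 JP1] := jets_in_patch cJ.
have [P2 cP2 LP2] := compact_in_patch (compact_thickening Wc (patch_base_compact cP)).
exists D, f, (P `|` (P1 `|` P2)); split => //.
- by split => //; do !apply: compact_patchU.
- move=> f1 f2 f12; apply/eqP; rewrite -subr_eq0; apply/eqP; rewrite -clinB.
  apply: cmod_eq0; apply/eqP; rewrite eq_le cmod_ge0 andbT -(mulr0 K).
  apply: DJ => // j Jj; have [jG jc] := compact_jetsP cJ Jj.
  rewrite jet_evalB// f12 ?subrr ?cmod0//.
  by right; left; exact: JP1.
- split; first by move=> x; left.
  move=> g /LP2[e [eG eg near_e]]; exists e; split => //.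
  by apply: filterS near_e => x; right; right.
Qed.

(** When G has uncountably many components, E(G) is not metrizable and sequences
    of seminorms do not describe its topology.  But a failure of equicontinuity
    yields sequences of distributions D_k and functions f_k that live on a union H
    of countably many compact sets.  This H is open and closed, so the f_k may be
    cut off outside H; then they form a bounded set, since on each compact set all
    but finitely many of them satisfy the same bound on a given derivative, and the
    D_k are unbounded on it. *)
Theorem bounded_dist_equicontinuous (S : set (cs_distribution G)) : bounded_dist S ->
  exists J K, [/\ compact_jets J, 0 <= K & forall D, S D -> jet_bound J K D].
Proof.
move=> bS; apply: contrapT => notS.
have {}notS J K : compact_jets J -> 0 <= K -> exists2 D, S D & ~ jet_bound J K D.
  move=> cJ K0; apply: contrapT => h; apply: notS; exists J, K; split => // D SD.
  by apply: contrapT => h'; apply: h; exists D.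
have [W Wc nW] := compact_nbhs1 G.
pose T := {P : patch | compact_patch P}.
have /choice[next nextP] : forall x : nat * T,
    exists y : cs_distribution G * smooth_space G C * T,
  [/\ S y.1.1,
      forall j, patch_jets (sval x.2) x.1 j -> cmod (jet_eval y.1.2 j) <= 1,
      x.1%:R < cmod (y.1.1 y.1.2),
      forall f1 f2 : smooth_space G C,
        (forall j, sval y.2 (j.1.1, j.2) -> jet_eval f1 j = jet_eval f2 j) ->
        y.1.1 f1 = y.1.1 f2 &
      sval x.2 `<=` sval y.2 /\
      [set (w * g)%g | w in W & g in patch_base (sval x.2)] `<=` patch_interior (sval y.2)].
  move=> [k [P cP]]; have [D [f [Q [[SD cQ] h1 h2 h3 h4]]]] := exhaustion_step Wc notS k cP.
  by exists (D, f, exist _ Q cQ).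
pose seqP := fix seqP k : T := if k is k'.+1 then (next (k', seqP k')).2
  else exist _ set0 (compact_patch0 G).
pose P k := sval (seqP k); have cP k : compact_patch (P k) := svalP (seqP k).
pose D k := (next (k, seqP k)).1.1; pose f k := (next (k, seqP k)).1.2.
have DS k : S (D k) by have [] := nextP (k, seqP k).
have fP k j : patch_jets (P k) k j -> cmod (jet_eval (f k) j) <= 1.
  by have [_ + _ _ _] := nextP (k, seqP k); apply.
have Df k : k%:R < cmod (D k (f k)) by have [] := nextP (k, seqP k).
have Dloc k (f1 f2 : smooth_space G C) :
    (forall j, P k.+1 (j.1.1, j.2) -> jet_eval f1 j = jet_eval f2 j) -> D k f1 = D k f2.
  by have [_ _ _ + _] := nextP (k, seqP k); apply.
have PS k : P k `<=` P k.+1 by have [_ _ _ _ []] := nextP (k, seqP k).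
have PW k : [set (w * g)%g | w in W & g in patch_base (P k)] `<=` patch_interior (P k.+1).
  by have [_ _ _ _ []] := nextP (k, seqP k).
have Pmono k m : (k <= m)%N -> P k `<=` P m.
  by move=> /subnK <-; elim: (m - k)%N => // d IH; exact: subset_trans IH (PS _).
have W1 : W 1%g by exact: nbhs_singleton.
have baseI k : patch_base (P k) `<=` patch_interior (P k.+1).
  by move=> g bg; apply: PW; exists 1%g => //; exists g => //; rewrite mul1g.
have intB k : patch_interior (P k) `<=` patch_base (P k).
  move=> g [e [eG eg /nbhs_singleton Pe]]; exists (e, e g) => //=.
  by rewrite chart_funK ?inE.
pose H := \bigcup_k patch_base (P k).
have [Ho Hc] : open H /\ open (~` H).
  apply: (@clopen_union W (fun k => patch_base (P k)) nW) => k.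
  exact: subset_trans (PW k) (intB _).
pose h k := smooth_cutoff Ho Hc (f k).
have Dh k : D k (h k) = D k (f k).
  apply: Dloc => j Pj; have [jG jc] := compact_patchP (cP k.+1) Pj.
  by apply: jet_eval_cut_in => //; exists k.+1 => //; exists (j.1.1, j.2).
have [|M hM] := bS (range h).
  move=> c s K cG Kc Kimg.
  suff [M hM] : exists M : R, forall k x, K x -> cmod (jet_eval (h k) (c, s, x)) <= M.
    by exists M => _ x [k _ <-] Kx; rewrite cmod_le; exact: hM.
  apply: (@compact_ind _ K (fun A => exists M : R, forall k x, A x ->
    cmod (jet_eval (h k) (c, s, x)) <= M)) => //.
  - by exists 0.
  - by move=> A B AB [M hM]; exists M => k x /AB; exact: hM.
  - move=> A B [M hM] [N hN]; exists (Num.max M N) => k x [/hM|/hN] le;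
      by rewrite le_max le ?orbT.
  move=> x Kx; have cx := Kimg x Kx; have pc := chart_inv_param cG.
  have [[m _ Hx]|nHx] := pselect (H (chart_inv c x)); last first.
    exists (chart_img c `&` chart_inv c @^-1` (~` H)).
      by apply: open_nbhs_nbhs; split => //; exact: param_preimage_open.
    by exists 0 => k y [cy nHy]; rewrite jet_eval_cut_out// cmod0.
  have [e [eG eg near_e]] := baseI m _ Hx.
  have [N [ts [L [nN Ndom L0 NL]]]] := param_jets_local pc s cx eG eg.
  have ce : {for x, continuous (e \o chart_inv c)}.
    apply: continuous_comp; first exact: (chart_inv_continuous (mem_set cx)).
    exact: (chart_fun_continuous (mem_set eg)).
  (* from k0 on, the bound on the jets over the patches applies; the functions
     before are finitely many and are bounded by continuity *)
  pose k0 := maxn m.+1 (\max_(t <- ts) pickle t).+1.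
  have near_k : \forall y \near x, forall k : 'I_k0,
      cmod (jet_eval (h k) (c, s, y) - jet_eval (h k) (c, s, x)) < 1.
    apply: (@filter_forall _ _ (fun (k : 'I_k0) y =>
      cmod (jet_eval (h k) (c, s, y) - jet_eval (h k) (c, s, x)) < 1)
      (nbhs x) (nbhs_filter x)) => k.
    have ck : {for x, continuous (partials s (h k \o chart_inv c))}.
      exact: ((smooth_spaceP (h k) cG s).1 _ (mem_set cx)).
    exact: (@cvg_cmod_lt _ _ _ (nbhs_filter x) _ _ _ ck ltr01).
  exists (N `&` [set y | P m.+1 (e, e (chart_inv c y))] `&`
    [set y | forall k : 'I_k0, cmod (jet_eval (h k) (c, s, y) - jet_eval (h k) (c, s, x)) < 1]).
    by apply: filterI => //; apply: filterI => //; exact: (ce _ near_e).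
  exists (L + \sum_(k < k0) (1 + cmod (jet_eval (h k) (c, s, x)))) => k y [[Ny Py] yk].
  have S0 : 0 <= \sum_(k < k0) (1 + cmod (jet_eval (h k) (c, s, x))).
    by apply: sumr_ge0 => i _; rewrite addr_ge0 ?cmod_ge0.
  have [kk0|k0k] := ltnP k k0.
    have /ltW /= yk1 := yk (Ordinal kk0).
    have S1 : 0 <= \sum_(i < k0 | i != Ordinal kk0) (1 + cmod (jet_eval (h i) (c, s, x))).
      by apply: sumr_ge0 => i _; rewrite addr_ge0 ?cmod_ge0.
    have le1 : cmod (jet_eval (h k) (c, s, y)) <= 1 + cmod (jet_eval (h k) (c, s, x)).
      rewrite -[jet_eval _ (c, s, y)](subrK (jet_eval (h k) (c, s, x))).
      by rewrite (le_trans (cmodD _ _))// lerD2r.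
    rewrite (bigD1 (Ordinal kk0))//=; apply: (le_trans le1).
    by rewrite addrCA lerDl addr_ge0.
  have [cy dy] := Ndom y Ny.
  have Hy : H (chart_inv c y).
    exists m.+1 => //; exists (e, e (chart_inv c y)) => //=.
    by rewrite chart_funK ?inE.
  rewrite jet_eval_cut_in//.
  have -> : L + \sum_(k < k0) (1 + cmod (jet_eval (h k) (c, s, x))) =
      L * 1 + \sum_(k < k0) (1 + cmod (jet_eval (h k) (c, s, x))) by rewrite mulr1.
  rewrite ler_wpDr//; apply: NL => // t tts; apply: fP; split => /=.
    by apply: Pmono Py; rewrite (leq_trans _ k0k)// leq_maxl.
  apply: leq_trans k0k; rewrite leq_max; apply/orP; right.
  by rewrite ltnS; exact: leq_bigmax_seq.
have [k Mk] : exists k : nat, M < k%:R.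
  by exists (Num.trunc `|M|).+1; rewrite (le_lt_trans (ler_norm M))// truncnS_gt.
have := hM (D k) (h k) (DS k) (imageP _ I); rewrite cmod_le Dh => /(lt_le_trans (Df k)).
by rewrite ltNge (ltW Mk).
Qed.

End uniform_boundedness.

(** * From bounded homomorphisms to smooth representations *)

Section jet_distributions.
Context (R : realType) (n : nat) (G : lieGroupType R n).
Local Notation C := (R[i]^o).

(** A derivative of a point mass. *)
Definition jet_dist (j : jet G) : cs_distribution G :=
  insubd (0 : cs_distribution G) (fun f : smooth_space G C => jet_eval f j).

Lemma jet_distE (j : jet G) (f : smooth_space G C) : atlas G j.1.1 -> chart_img j.1.1 j.2 ->
  jet_dist j f = jet_eval f j.
Proof.
case: j => [[c s] x] /= cG cx; rewrite /jet_dist insubdK//; apply/asboolP.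
have lin : linear (fun f : smooth_space G C => jet_eval f (c, s, x)).
  by move=> a u v; rewrite jet_eval_linear.
split => //; have cK : compact_jets (jet_piece c s [set x]).
  by apply: compact_jets_piece => // [|_ ->//]; exact: compact_set1.
apply: (jet_bound_continuous cK ler01 lin) => g M M0 gM.
by rewrite mul1r; apply: gM; split.
Qed.

#[local] Opaque jet_dist.

Lemma jet_dist_delta c x : atlas G c -> chart_img c x ->
  jet_dist (c, [::], x) = delta_dist (chart_inv c x).
Proof. by move=> cG cx; apply: val_inj; apply/funext => f; exact: jet_distE. Qed.

Lemma compact_jets_bounded J : compact_jets J -> bounded_dist [set jet_dist j | j in J].
Proof.
move=> cJ B bB; have val j : J j -> atlas G j.1.1 /\ chart_img j.1.1 j.2.
  exact: compact_jetsP.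
suff [M hM] : exists M : R, forall j f, J j -> B f -> cmod (jet_eval f j) <= M.
  exists M => _ f [j Jj <-] Bf; have [jG jc] := val j Jj.
  by rewrite jet_distE// cmod_le; exact: hM.
elim: cJ {val} => [c s K cG Kc Kimg||J1 J2 _ [M1 h1] _ [M2 h2]].
- have [M hM] := bB c s K cG Kc Kimg; exists M => -[[c' s'] x] f [/= [-> ->] Kx] Bf.
  by rewrite -cmod_le; exact: hM.
- by exists 0.
- by exists (Num.max M1 M2) => j f [/h1|/h2] h Bf; rewrite le_max h ?orbT.
Qed.

Lemma box_in_chart (c : chart R n G) x : chart_img c x ->
  exists (d : R) (K : set 'rV[R]_n), [/\ 0 < d, compact K, K `<=` chart_img c, K x &
    box x d `<=` K].
Proof.
move=> cx; have [K [nK cK Ki]] := locally_compact_rV (@chart_img_open _ _ _ c) cx.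
have [d d0 dK] := nbhs_boxP nK; exists d, K; split => //.
exact: nbhs_singleton.
Qed.

Lemma box_line (x : 'rV[R]_n) (i : 'I_n) (d t : R) : `|t| < d ->
  box x d (x + t *: delta_mx ord0 i).
Proof.
move=> td j; rewrite !mxE addrAC subrr add0r eqxx /=.
by case: (j == i); rewrite ?mulr1// mulr0 normr0 (le_lt_trans _ td).
Qed.

(** Taylor's formula to the second order, with a remainder that is uniform over
    bounded sets of functions.  This is the sense in which g |-> delta_g is
    differentiable. *)
Lemma second_difference_bounded c s x (i : 'I_n) : atlas G c -> chart_img c x ->
  exists2 d : R, 0 < d & bounded_dist [set D | exists2 h : R, 0 < `|h| < d &
    D = h^-1%:C *: (h^-1%:C *: (jet_dist (c, s, x + h *: delta_mx ord0 i) -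
      jet_dist (c, s, x)) - jet_dist (c, i :: s, x))].
Proof.
move=> cG cx; have [d [K [d0 Kc Kimg Kx bK]]] := box_in_chart cx.
exists (d / 2); first by rewrite divr_gt0.
move=> B bB; have [M hM] := bB c (i :: i :: s) K cG Kc Kimg.
exists (8 * M) => _ f [h /andP[h0 hd] ->] Bf.
have d2 : d / 2 < d by rewrite ltr_pdivrMr// ltr_pMr// ltr1n.
have imgx t : `|t| < d -> chart_img c (x + t *: delta_mx ord0 i).
  by move=> td; apply/Kimg/bK/box_line.
have sf := smooth_spaceP f cG.
have M0 : 0 <= M by have := hM f x Bf Kx; rewrite cmod_le; apply: le_trans; exact: cmod_ge0.
have est1 t : `|t| < d -> cmod (jet_eval f (c, i :: s, x + t *: delta_mx ord0 i) -
    jet_eval f (c, i :: s, x)) <= 2 * M * `|t|.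
  move=> td; have := @line_estimate R n i (partials (i :: s) (f \o chart_inv c)) x
    (partials (i :: i :: s) (f \o chart_inv c)) 0 d M t.
  rewrite mulr0 subr0; apply => // r rd /=; split; last first.
    by rewrite subr0 -cmod_le; apply: hM => //; exact/bK/box_line.
  exact: (smooth_on_cvg (i :: s) i sf (imgx r rd)).
(* 2|h| is the radius because the estimate needs |h| to be strictly smaller *)
have := @line_estimate R n i (partials s (f \o chart_inv c)) x
    (partials (i :: s) (f \o chart_inv c)) (jet_eval f (c, i :: s, x)) (2 * `|h|)
    (2 * M * (2 * `|h|)) h.
have h2d : 2 * `|h| < d by rewrite -ltr_pdivlMl// mulrC.
have hn0 : h != 0 by rewrite -normr_gt0.
have hd' : `|h| < d by exact: lt_trans hd d2.
have est r : `|r| < 2 * `|h| -> let y := x + r *: delta_mx ord0 i in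
     diff_quot (V := C) i (partials s (f \o chart_inv c)) y h @[h --> 0^'] -->
       partials (i :: s) (f \o chart_inv c) y /\
     cmod (partials (V := C) (i :: s) (f \o chart_inv c) y - jet_eval f (c, i :: s, x)) <=
       2 * M * (2 * `|h|).
  move=> rh /=; have rd := lt_trans rh h2d; split.
    exact: (smooth_on_cvg s i sf (imgx r rd)).
  by apply: le_trans (est1 r rd) _; rewrite ler_wpM2l ?mulr_ge0// ltW.
move=> /(_ est) {est}; rewrite ltr_pMl// ltr1n => /(_ isT) est.
have cy := imgx h hd'; move: est cy; set y := x + h *: delta_mx ord0 i.
clearbody y => est cy.
have -> : (h^-1%:C *: (h^-1%:C *: (jet_dist (c, s, y) - jet_dist (c, s, x)) -
    jet_dist (c, i :: s, x)) : cs_distribution G) f =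
  h^-1%:C * (h^-1%:C * (jet_eval f (c, s, y) - jet_eval f (c, s, x) -
    h%:C * jet_eval f (c, i :: s, x))).
  have num (a b e a' b' e' : R[i]) : a = a' -> b = b' -> e = e' ->
      h^-1%:C * (h^-1%:C * (a - b) - e) = h^-1%:C * (h^-1%:C * (a' - b' - h%:C * e')).
    move=> -> -> ->.
    by rewrite [in RHS]mulrBr [_ * (h%:C * _)]mulrA -rmorphM /= mulVf// mul1r.
  have e1 : jet_dist (c, s, y) f = jet_eval f (c, s, y) by exact: jet_distE.
  have e2 : jet_dist (c, s, x) f = jet_eval f (c, s, x) by exact: jet_distE.
  have e3 : jet_dist (c, i :: s, x) f = jet_eval f (c, i :: s, x) by exact: jet_distE.
  exact: num e1 e2 e3.
rewrite cmod_le !cmodM cmodR mulrA -expr2 normfV exprVn.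
rewrite ler_pdivrMl ?exprn_gt0//; apply: (le_trans est).
by rewrite le_eqVlt; apply/orP; left; apply/eqP; ring.
Qed.

(** The mean value inequality, uniform over bounded sets of functions. *)
Lemma first_difference_bounded c s x : atlas G c -> chart_img c x ->
  exists2 d : R, 0 < d & bounded_dist [set D | exists r y, [/\ 0 < r < d, box x r y &
    D = r^-1%:C *: (jet_dist (c, s, y) - jet_dist (c, s, x))]].
Proof.
move=> cG cx; have [d [K [d0 Kc Kimg Kx bK]]] := box_in_chart cx; exists d => // B bB.
have /choice[M hM] : forall i, exists M : R, forall f x, B f -> K x ->
    `|partials (i :: s) (f \o chart_inv c) x| <= M%:C.
  by move=> i; exact: bB.
exists (2 * (\sum_i `|M i|) * n%:R) => _ f [r [y [/andP[r0 rd] xy ->]]] Bf.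
have sf := smooth_spaceP f cG.
have yd : box x d y by move=> j; exact: lt_trans (xy j) rd.
have [ky kx] : chart_img c y /\ chart_img c x by split => //; exact/Kimg/bK.
have := @c1_estimate R n (partials s (f \o chart_inv c)) x (y - x)
  (fun i => partials (i :: s) (f \o chart_inv c)) (fun=> 0) r (\sum_i `|M i|).
rewrite (_ : x + (y - x) = y) => [est|]; last by rewrite addrC subrK.
have {est} : cmod (jet_eval f (c, s, y) - jet_eval f (c, s, x)) <=
    2 * (\sum_i `|M i|) * \sum_i `|(y - x) ord0 i|.
  move: est; rewrite [X in cmod (_ - X)]big1 => [|i _]; last exact: mulr0.
  rewrite subr0 => est; apply: est.
    move=> z i xz; have Kz : K z by apply: bK => j; exact: lt_trans (xz j) rd.
    split; first exact: (smooth_on_cvg s i sf (Kimg z Kz)).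
    rewrite subr0; have := hM i f z Bf Kz; rewrite cmod_le => /le_trans; apply.
    rewrite (bigD1 i)//= (le_trans (ler_norm _))// lerDl.
    by apply: sumr_ge0.
  by move=> i; rewrite !mxE; exact: xy.
have -> : (r^-1%:C *: (jet_dist (c, s, y) - jet_dist (c, s, x)) : cs_distribution G) f =
    r^-1%:C * (jet_eval f (c, s, y) - jet_eval f (c, s, x)).
  have num (a b a' b' : R[i]) : a = a' -> b = b' ->
      r^-1%:C * (a - b) = r^-1%:C * (a' - b') by move=> -> ->.
  have e1 : jet_dist (c, s, y) f = jet_eval f (c, s, y) by exact: jet_distE.
  have e2 : jet_dist (c, s, x) f = jet_eval f (c, s, x) by exact: jet_distE.
  exact: num e1 e2.
move=> est; rewrite cmod_le cmodM cmodR gtr0_norm ?invr_gt0// ler_pdivrMl//.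
apply: (le_trans est).
have S0 : 0 <= \sum_i `|M i| by apply: sumr_ge0.
have le : \sum_i `|(y - x) ord0 i| <= r * n%:R.
  apply: (@le_trans _ _ (\sum_(i < n) r)).
    by apply: ler_sum => i _; rewrite !mxE ltW.
  by rewrite sumr_const card_ord mulr_natr.
rewrite [leRHS](_ : _ = 2 * (\sum_i `|M i|) * (r * n%:R)); last by ring.
by rewrite ler_wpM2l// mulr_ge0.
Qed.

End jet_distributions.

Section smoothness_from_distributions.
Context (R : realType) (n : nat) (G : lieGroupType R n) (V : lcsType R[i]).
Local Notation C := (R[i]^o).
Variables (pi : representation G V) (Phi : cs_distribution G -> clin V V).
Hypotheses (Phil : linear Phi) (Phib : bounded_hom Phi)
  (Phid : forall g, Phi (delta_dist g) = pi g).

Lemma equicontinuous_cseminorm (S : set (clin V V)) (v : V) p :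
  equicontinuous_set S -> cseminorm p ->
  \forall w \near v, forall T, S T -> p (T w - T v) < 1.
Proof.
move=> eS cp; have eE := entourage_inv (cseminorm_entourage cp ltr01).
by apply: filterS (eS v _ eE) => w h T ST; exact: h.
Qed.

(** For S a set of operators of the form r^-1 T this makes T v small with r. *)
Lemma equicontinuous_scale (S : set (clin V V)) (v : V) p :
  equicontinuous_set S -> cseminorm p ->
  exists2 e : R, 0 < e & forall (r : R) T, `|r| < e -> S T -> p (r%:C *: T v) < 1.
Proof.
move=> eS cp; have := equicontinuous_cseminorm 0 eS cp; rewrite -{1}(scale0r v).
move=> /nbhs_scale[e e0 [W nW WS]]; exists e => // r T re ST.
have := WS r%:C v; rewrite subr0 cmodR => /(_ re (nbhs_singleton nW)).
by move=> /(_ T ST); rewrite clin0 subr0 clinZ.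
Qed.

Let PhiB D E v : Phi (D - E) v = Phi D v - Phi E v.
Proof.
have -> : D - E = -1 *: E + D by rewrite scaleN1r addrC.
by rewrite Phil scaleN1r addrC.
Qed.

Let PhiZ a D v : Phi (a *: D) v = a *: Phi D v.
Proof.
have P0 : Phi 0 = 0 by have := Phil (-1) 0 0; rewrite scaler0 addr0 scaleN1r addNr.
by rewrite -[a *: D]addr0 Phil P0 addr0.
Qed.

Let jd_derive c s x i v : atlas G c -> chart_img c x ->
  diff_quot i (fun z => Phi (jet_dist (c, s, z)) v) x h @[h --> 0^'] -->
    Phi (jet_dist (c, i :: s, x)) v.
Proof.
move=> cG cx; apply/cvg_cseminormP => p cp.
have [d d0 bS] := second_difference_bounded s i cG cx.
have [e e0 eS] := equicontinuous_scale v (Phib bS) cp.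
have small : \forall h \near (0 : R)^', `|h| < Num.min d e.
  apply: nbhs_dnbhs; apply/nbhs_ballP; exists (Num.min d e) => /=; first by rewrite lt_min d0.
  by move=> h; rewrite /ball /= sub0r normrN.
have nz : \forall h \near (0 : R)^', h != 0 by exact: nbhs_dnbhs_neq.
apply: filterS2 small nz => h; rewrite lt_min => /andP[hd he] h0.
set D := h^-1%:C *: (h^-1%:C *: (jet_dist (c, s, x + h *: delta_mx ord0 i) -
  jet_dist (c, s, x)) - jet_dist (c, i :: s, x)).
have := eS h (Phi D) he; rewrite /D PhiZ scalerA -rmorphM /= divff// scale1r.
rewrite PhiB PhiZ PhiB; apply; exists D => //; exists h => //.
by rewrite normr_gt0 h0.
Qed.

Let jd_continuous c s v : atlas G c ->
  {in chart_img c, continuous (fun z => Phi (jet_dist (c, s, z)) v)}.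
Proof.
move=> cG x /[!inE] cx; apply: (@cvg_cseminormP _ _ _ _ (nbhs_filter x) _ _).2 => p cp.
have [d d0 bS] := first_difference_bounded s cG cx.
have [e e0 eS] := equicontinuous_scale v (Phib bS) cp.
pose r := Num.min d e / 2.
have m0 : 0 < Num.min d e by rewrite lt_min d0.
have r0 : 0 < r by rewrite divr_gt0.
have rm : r < Num.min d e by rewrite ltr_pdivrMr// ltr_pMr// ltr1n.
have [rd re] : r < d /\ r < e by move: rm; rewrite lt_min => /andP[].
apply: filterS (nbhs_box x r0) => y xy.
set D := r^-1%:C *: (jet_dist (c, s, y) - jet_dist (c, s, x)).
have := eS r (Phi D); rewrite gtr0_norm// /D PhiZ scalerA -rmorphM /= divff ?gt_eqF//.
rewrite scale1r PhiB; apply => //; exists D => //; exists r, y; split => //.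
by rewrite r0.
Qed.

Definition orbit_map (v : V) : G -> V := fun g => pi g v.

Let orbit_jd c v : atlas G c ->
  {in chart_img c, (fun z => Phi (jet_dist (c, [::], z)) v) =1 orbit_map v \o chart_inv c}.
Proof. by move=> cG x /[!inE] cx; rewrite jet_dist_delta// Phid. Qed.

Lemma orbit_map_smooth v : orbit_map v \in @smooth_pred R n G V.
Proof.
apply/asboolP => c cG; have co := @chart_img_open _ _ _ c.
apply: (smooth_on_eq co (orbit_jd v cG)).
apply: (@smooth_on_coind _ _ _ _ (fun f => exists s, f =
  fun z => Phi (jet_dist (c, s, z)) v)) => //; last by exists [::].
move=> _ [s ->]; split; first exact: jd_continuous.
move=> i; exists (fun z => Phi (jet_dist (c, i :: s, z)) v); first by exists (i :: s).
by move=> x /[!inE] cx; exact: jd_derive.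
Qed.

Lemma jet_eval_orbit v j : atlas G j.1.1 -> chart_img j.1.1 j.2 ->
  jet_eval (orbit_map v) j = Phi (jet_dist j) v.
Proof.
case: j => [[c s] x] /= cG cx; rewrite /jet_eval /=.
have co := @chart_img_open _ _ _ c.
elim: s x cx => [|i s IH] x cx.
  exact: esym (orbit_jd v cG (mem_set cx)).
rewrite /=; apply: partialE.
have eqs : {in chart_img c, (fun z => Phi (jet_dist (c, s, z)) v) =1
    partials s (orbit_map v \o chart_inv c)}.
  by move=> z; rewrite inE => cz; exact: esym (IH z cz).
exact: (diff_quot_cvg_eq co cx eqs (@jd_derive c s x i v cG cx)).
Qed.

Let pi_ (v : V) : smooth_space G V := SmoothSpace (orbit_map_smooth v).

(** The jets of the orbit map of v are the vectors Phi(D) v for D a derivative of a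
    point mass; over a compact set these D are bounded, so the operators Phi(D) are
    equicontinuous. *)
Lemma smooth_from_bounded_hom : smooth_representation pi.
Proof.
have lin : linear pi_.
  move=> a u v; apply: val_inj; apply/funext => g /=.
  by rewrite /orbit_map clinD clinZ.
have cont : continuous pi_.
  move=> v; apply: cvg_jets => J p cJ cp.
  have := equicontinuous_cseminorm v (Phib (compact_jets_bounded cJ)) cp.
  apply: filterS => w h j Jj; have [jG jc] := compact_jetsP cJ Jj.
  rewrite /= !jet_eval_orbit//; apply: h; exists (jet_dist j) => //.
  by exists j.
by exists (Clin (asboolT (conj lin cont))).
Qed.

End smoothness_from_distributions.

(** * From smooth representations to bounded homomorphisms *)

Section integration.
Context (R : realType) (n : nat) (G : lieGroupType R n) (V : lcsType R[i]).
Hypothesis Vcomplete : complete_space V.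
Local Notation C := (R[i]^o).
Local Notation dual := (clin V (C : tvsType R[i])).
Variables (pi : representation G V) (pi_ : clin V (smooth_space G V)).
Hypothesis pi_E : forall v g, pi_ v g = pi g v.

Definition int_fun (D : cs_distribution G) (v : V) : V :=
  sval (cid (weak_pairing Vcomplete D (pi_ v))).

Lemma int_funE D v (l : dual) : l (int_fun D v) = D (clin_smooth l (pi_ v)).
Proof. by rewrite /int_fun; case: cid. Qed.

Lemma clin_smooth_linear (l : dual) (a : R[i]) (f g : smooth_space G V) :
  clin_smooth l (a *: f + g) = a *: clin_smooth l f + clin_smooth l g.
Proof. by apply: val_inj; apply/funext => x; rewrite /= clinD clinZ. Qed.

Lemma int_fun_linear D : linear (int_fun D).
Proof.
move=> a u v; apply: functionals_separate => l.
rewrite clinD clinZ !int_funE clinD clinZ clin_smooth_linear.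
by rewrite clinD clinZ.
Qed.

(** A functional that attains p reduces this to the bound of D on scalar
    functions. *)
Lemma int_fun_bound (D : cs_distribution G) J (K : R) p v (M : R) :
  compact_jets J -> jet_bound J K D ->
  cseminorm p -> 0 <= M ->
  (forall j, J j -> p (jet_eval (pi_ v) j) <= M) -> p (int_fun D v) <= K * M.
Proof.
move=> cJ DJ cp M0 vM; have [l [lE lp]] := norming_functional (int_fun D v) cp.
rewrite -[p _]ger0_norm ?(seminorm_ge0 _ cp.1)// -cmodR -lE int_funE.
apply: DJ => // j Jj; have [jG jc] := compact_jetsP cJ Jj.
by rewrite jet_eval_clin//; exact: le_trans (lp _) (vM j Jj).
Qed.

Lemma int_fun_equicontinuous J (K : R) p : compact_jets J -> 0 <= K ->
  cseminorm p -> \forall v \near 0, forall D : cs_distribution G,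
    jet_bound J K D -> p (int_fun D v) < 1.
Proof.
move=> cJ K0 cp; have [_ pc] := clinP pi_.
have K1 : 0 < K + 1 by rewrite ltr_wpDl.
have e0 : 0 < (K + 1)^-1 by rewrite invr_gt0.
have := near_jets (pi_ 0) cJ cp e0 => /pc near_v.
have {}near_v : nbhs 0 [set v | forall j, J j ->
  p (jet_eval (pi_ v) j - jet_eval (pi_ 0) j) < (K + 1)^-1] by exact: near_v.
apply: filterS near_v => v vJ D DJ.
apply: (@le_lt_trans _ _ (K * (K + 1)^-1)); last by rewrite ltr_pdivrMr// mul1r ltrDl.
apply: (int_fun_bound cJ DJ cp (ltW e0)) => j Jj; have [jG jc] := compact_jetsP cJ Jj.
have := vJ j Jj; rewrite -jet_evalB// clin0 subr0 => h.
exact: ltW.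
Qed.

Lemma int_fun_continuous D : continuous (int_fun D).
Proof.
apply: cseminorm_clin; first exact: int_fun_linear.
have lD := @int_fun_linear D => q cq; have [J [K [cJ K0 DJ]]] := dist_bound D.
split; last by apply: filterS (int_fun_equicontinuous cJ K0 cq) => v; apply.
have D0 : int_fun D 0 = 0.
  by have := lD (-1) 0 0; rewrite scaler0 addr0 scaleN1r addNr.
split=> [u v|a u]; last by rewrite -[a *: u]addr0 lD D0 addr0 cq.1.2.
by rewrite -[u]scale1r lD !scale1r cq.1.1.
Qed.

Definition int_rep (D : cs_distribution G) : clin V V :=
  Clin (asboolT (conj (@int_fun_linear D) (@int_fun_continuous D))).

Lemma int_rep_linear : linear int_rep.
Proof.
move=> a D E; apply: clin_ext => v; apply: functionals_separate => l.
rewrite [int_rep _ v]/= int_funE.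
have -> : (a *: int_rep D + int_rep E) v = a *: int_fun D v + int_fun E v by [].
by rewrite clinD clinZ !int_funE.
Qed.

(** Tested on a functional l, both sides are the value of D1 at the function
    x |-> D2 (y |-> l (pi_x (pi_y v))), since l o pi_x is a functional again. *)
Lemma int_rep_convolution D1 D2 : int_rep (convolution D1 D2) =1 int_rep D1 \o int_rep D2.
Proof.
move=> v; apply: functionals_separate => l.
rewrite [int_rep _ v]/= [(int_rep _ \o _) v]/= !int_funE convolutionE.
congr (clin_fun D1 _); apply: val_inj; apply/funext => x.
rewrite /= /conv_fun pi_E.
have lpi : linear (fun w => l (pi x w)) /\ continuous (fun w => l (pi x w) : C).
  split=> [a u w|w]; first by rewrite clinD clinZ clinD clinZ.
  apply: (@continuous_comp _ _ _ (pi x) l); first by have [_] := clinP (pi x); apply.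
  by have [_] := clinP l; apply.
pose m : dual := Clin (asboolT lpi).
have -> : translate (clin_smooth l (pi_ v)) x = clin_smooth m (pi_ v).
  by apply: val_inj; apply/funext => y; rewrite /= !pi_E rep_mul.
by rewrite -int_funE.
Qed.

Lemma int_rep_delta g : int_rep (delta_dist g) = pi g.
Proof.
apply: clin_ext => v; apply: functionals_separate => l.
by rewrite [int_rep _ v]/= int_funE /= pi_E.
Qed.

Lemma int_rep_bounded : bounded_hom int_rep.
Proof.
move=> S /bounded_dist_equicontinuous[J [K [cJ K0 SJ]]] x E /entourage_cseminorm[p cp pE].
have n0 := int_fun_equicontinuous cJ K0 cp.
have cx : {for x, continuous (fun y => x - y)}.
  move=> N; rewrite subrr => nN; have nN' := entourage_diff nN.
  by apply: filterS (nbhs_entourage x nN') => y /xsectionP.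
move: (cx); rewrite /prop_for /continuous_at subrr => /(_ _ n0) near_x.
have {}near_x : nbhs x [set y | forall D : cs_distribution G,
    jet_bound J K D -> p (int_fun D (x - y)) < 1].
  exact: near_x.
apply: filterS near_x => y yD _ [D SD <-]; apply: pE.
rewrite -[_ - _]/(int_rep D x - int_rep D y) -clinB; apply: yD.
exact: SJ.
Qed.

End integration.


Theorem proposition3p19 (R : realType) (n : nat) (G : lieGroupType R n)
    (V : lcsType R[i]) (Vcomplete : complete_space V)
    (pi : representation G V) :
  smooth_representation pi <->
  exists int_pi : cs_distribution G -> clin V V,
    [/\ algebra_hom int_pi, bounded_hom int_pi
      & forall g : G, int_pi (delta_dist g) = pi g].
Proof.
split=> [[pi_ pi_E]|[Phi [[Phil _] Phib Phid]]]; last first.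
  exact: smooth_from_bounded_hom Phil Phib Phid.
exists (int_rep Vcomplete pi_); split; last exact: int_rep_delta.
  by split; [exact: int_rep_linear|exact: int_rep_convolution pi_E].
exact: int_rep_bounded.
Qed.
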